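(* Let $H$ be a stringent skew hyperfield. Let $E$ be a finite set, and let $\mathcal{V}\subseteq H^E$. There is a left $H$-matroid $M$ such that $\mathcal{V}=\mathcal{V}(M)$ if and only if (V0) $0\in \mathcal{V}$; (V1) if $a\in H$ and $V\in \mathcal{V}$, then $aV\in \mathcal{V}$; (V2)$'$ if $V, W\in \mathcal{V}$ and $\underline{V\circ W}=\underline{V}\cup \underline{W}$, then $V\circ W\in\mathcal{V}$; (V3) if $V, W\in \mathcal{V}, e\in E$ such that $V_e=-W_e\neq 0$, then there is a $Z\in \mathcal{V}$ such that $Z_f\in V_f\boxplus W_f$ for all $f\in E$ and $Z_e=0$. Then $\mathcal{C}(M)=\mathrm{Min}(\mathcal{V}\setminus\{0\})$.
   Context: A skew hyperfield $H$ has a multiplication making $H^\star=H\setminus\{0\}$ a group (with $0\cdot x=x\cdot 0=0$) and a commutative associative hyperaddition $\boxplus$ with $x\boxplus 0=\{x\}$, unique negatives $-x$ with $0\in x\boxplus(-x)$, reversibility and two-sided distributivity. $H$ is stringent if $a\boxplus b$ is a singleton whenever $a\neq -b$. By the classification of Bowler and Su, for stringent $H$ there is a linearly ordered group $\Gamma$ and a surjective group homomorphism $\psi:H^\star\to\Gamma$ with $\psi(x)>\psi(y)\Rightarrow x\boxplus y=\{x\}$, such that the residue $R:=\{0\}\cup\ker\psi$ is a sub-hyperfield which is the Krasner hyperfield, the sign hyperfield, or a skew field. The composition $\circ$ on $H$ is: $a\circ b=c$ if $a\boxplus b=\{c\}$; $a\circ b=a$ if $a=-b$ and $R$ is the Krasner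 or sign hyperfield; $a\circ b=0$ if $a=-b$ and $R$ is a skew field. For vectors it is applied componentwise. $\underline{X}$ denotes the support $\{e:X_e\neq0\}$. A left $H$-matroid on $E$ is given by its circuit set $\mathcal C(M)\subseteq H^E$ satisfying (C0) $0\notin\mathcal C$, (C1) closure under left scaling by $H^\star$, (C2) nested supports imply scalar multiples, (C3) modular circuit elimination. $X\perp Y$ means $0$ lies in the iterated hypersum $X_{e_1}Y_{e_1}\boxplus\cdots\boxplus X_{e_n}Y_{e_n}$ ($E=\{e_1,\dots,e_n\}$); the cocircuits are the circuits of the dual matroid; $\mathcal V(M)$, the set of vectors, consists of all $V\in H^E$ with $V\perp Y$ for every cocircuit $Y$. $\mathrm{Min}(\mathcal Q)$ is the set of $Q\in\mathcal Q$ whose support is inclusion-minimal among supports of elements of $\mathcal Q$. *)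

(* Defs.v *)
From HB Require Import structures.
From mathcomp Require Import all_boot all_order.
From mathcomp Require Import boolp classical_sets.

Set Implicit Arguments.
Unset Strict Implicit.
Unset Printing Implicit Defensive.

Declare Scope hyper_scope.
Delimit Scope hyper_scope with H.
Local Open Scope classical_set_scope.
Local Open Scope hyper_scope.

(** * Skew hyperfields *)

HB.mixin Record isSkewHyperfield (H : Type) of Choice H := {
  hzero : H;
  hone : H;
  hopp : H -> H;
  hmul : H -> H -> H;
  hadd : H -> H -> set H;
  (* hyperaddition: a commutative hypergroup *)
  hadd_neq0 : forall x y, hadd x y !=set0;
  haddC : forall x y, hadd x y = hadd y x;
  haddA : forall x y z,
    \bigcup_(t in hadd x y) hadd t z = \bigcup_(t in hadd y z) hadd x t;
  haddx0 : forall x, hadd x hzero = [set x];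
  haddxN : forall x, hadd x (hopp x) hzero;
  hopp_uniq : forall x y, hadd x y hzero -> y = hopp x;
  hadd_rev : forall x y z, hadd y z x -> hadd x (hopp y) z;
  (* multiplication: a group on the nonzero elements, with 0 absorbing *)
  hone_neq0 : hone <> hzero;
  hmulA : forall x y z, hmul x (hmul y z) = hmul (hmul x y) z;
  hmul1x : forall x, hmul hone x = x;
  hmulx1 : forall x, hmul x hone = x;
  hmul0x : forall x, hmul hzero x = hzero;
  hmulx0 : forall x, hmul x hzero = hzero;
  hmulVex : forall x, x <> hzero ->
    exists y, hmul y x = hone /\ hmul x y = hone;
  (* distributivity, as equalities of sets *)
  hmulDr : forall a x y, hmul a @` hadd x y = hadd (hmul a x) (hmul a y);
  hmulDl : forall a x y, hmul^~ a @` hadd x y = hadd (hmul x a) (hmul y a)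
}.

#[short(type="skewHyperfieldType")]
HB.structure Definition SkewHyperfield := {H of isSkewHyperfield H & Choice H}.

Notation "0" := (@hzero _) : hyper_scope.
Notation "1" := (@hone _) : hyper_scope.
Notation "- x" := (hopp x) : hyper_scope.
Notation "- 1" := (hopp 1) : hyper_scope.
Notation "x * y" := (hmul x y) : hyper_scope.
Notation "x [+] y" := (hadd x y) (at level 50, left associativity) : hyper_scope.

Definition stringent (H : skewHyperfieldType) : Prop :=
  forall a b : H, a <> - b -> exists c, a [+] b = [set c].

(** * Linearly ordered groups (bi-invariant order, not necessarily abelian) *)

HB.mixin Record Group_isOrdered (d : Order.disp_t) G of Group G & Order.Total d G := {
  ltog_mul2l : forall z x y : G, (x < y)%O -> (z * x < z * y)%g%O;
  ltog_mul2r : forall z x y : G, (x < y)%O -> (x * z < y * z)%g%O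
}.

#[short(type="orderedGroupType")]
HB.structure Definition OrderedGroup (d : Order.disp_t) :=
  {G of Group_isOrdered d G & Group G & Order.Total d G}.

(** * Residue and composition *)

Section Residue.
Variables (H : skewHyperfieldType) (d : Order.disp_t) (G : orderedGroupType d).
Variable psi : H -> G.

(* psi stands for a map on the nonzero elements only: its value at 0 is junk. *)
Definition hvaluation : Prop :=
  [/\ forall x y, x <> 0 -> y <> 0 -> psi (x * y) = (psi x * psi y)%g,
      forall g, exists2 x, x <> 0 & psi x = g &
      forall x y, x <> 0 -> y <> 0 -> (psi y < psi x)%O -> x [+] y = [set x]].

Definition residue : set H := [set x | x = 0 \/ psi x = 1%g].

(* The hyperaddition of the residue as a sub-hyperfield; for x, y in the
   residue, x [+] y itself may contain elements outside the residue. *)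
Definition radd (x y : H) : set H := (x [+] y) `&` residue.

(* The remaining entries of the addition tables follow from the axioms. *)
Definition residue_krasner : Prop :=
  residue = [set 0; 1] /\ radd 1 1 = [set 0; 1].

Definition residue_sign : Prop :=
  [/\ residue = [set 0; 1; - 1], (1 : H) <> - 1,
      radd 1 1 = [set 1] & radd 1 (- 1) = [set 0; 1; - 1]].

Definition residue_skew_field : Prop :=
  forall x y, residue x -> residue y -> exists z, radd x y = [set z].

End Residue.

(* For a stringent H a map psi for which one of the three residue cases
   holds exists, and its kernel does not depend on any choice, so that the
   existential below does not depend on psi. *)
Definition krasner_or_sign_residue (H : skewHyperfieldType) : Prop :=
  exists (d : Order.disp_t) (G : orderedGroupType d) (psi : H -> G),
    hvaluation psi /\ (residue_krasner psi \/ residue_sign psi).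

(* When a [+] b is not a singleton and H is stringent, a = - b; then the
   value is a for a Krasner or sign residue, and 0 for a skew field. *)
Definition hcomp (H : skewHyperfieldType) (a b : H) : H :=
  if `[< exists c, a [+] b = [set c] >] then xget 0 [set c | a [+] b = [set c]]
  else if `[< krasner_or_sign_residue H >] then a else 0.

(** * Vectors *)

Section Vectors.
Variables (H : skewHyperfieldType) (E : finType).
Implicit Types (V W X Y Z : {ffun E -> H}).

Definition vzero : {ffun E -> H} := [ffun=> 0].
Definition lscale (a : H) V : {ffun E -> H} := [ffun e => a * V e].
Definition rscale (a : H) V : {ffun E -> H} := [ffun e => V e * a].
Definition vcomp V W : {ffun E -> H} := [ffun e => hcomp (V e) (W e)].
Definition vadd V W : set {ffun E -> H} :=
  [set Z | forall e, (V e [+] W e) (Z e)].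
Definition vsupp V : {set E} := [set e | V e != 0]%SET.

(* Well defined irrespective of the enumeration, by haddC and haddA. *)
Definition hsum (s : seq H) : set H :=
  foldr (fun a S => \bigcup_(t in S) (a [+] t)) [set 0] s.

Definition orthogonal X Y : Prop := hsum [seq X e * Y e | e <- enum E] 0.

Definition Min (Q : set {ffun E -> H}) : set {ffun E -> H} :=
  [set X | Q X /\ forall Y, Q Y -> ~~ (vsupp Y \proper vsupp X)].

(** * Matroids over H, given by their sets of circuits *)

Implicit Types (C D : set {ffun E -> H}).

(* Distinctness is required of the supports, not just of X and Y: in (C3),
   X and - X do not form a modular pair. *)
Definition modular_pair C X Y : Prop :=
  vsupp X <> vsupp Y /\
  forall X' Y', C X' -> C Y' -> vsupp X' <> vsupp Y' ->
    ~~ (vsupp X' :|: vsupp Y' \proper vsupp X :|: vsupp Y)%SET.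

Record circuit_axioms (scale : H -> {ffun E -> H} -> {ffun E -> H}) C : Prop :=
  CircuitAxioms {
    circuit0 : ~ C vzero;
    circuitZ : forall a X, a <> 0 -> C X -> C (scale a X);
    circuit_incomp : forall X Y, C X -> C Y -> vsupp X \subset vsupp Y ->
      exists2 a, a <> 0 & Y = scale a X;
    circuit_elim : forall X Y e, C X -> C Y -> modular_pair C X Y ->
      X e = - Y e -> X e <> 0 ->
      exists Z, [/\ C Z, Z e = 0 & vadd X Y Z]
  }.

Definition left_matroid C : Prop := circuit_axioms lscale C.
Definition right_matroid D : Prop := circuit_axioms rscale D.

(* The bases of the underlying matroid, whose circuits are the supports of
   the elements of C. *)
Definition basis C (B : {set E}) : bool :=
  maxset (fun I : {set E} =>
            `[< forall X, C X -> ~~ (vsupp X \subset I) >]) B.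

(* The dual of a left H-matroid is the unique right H-matroid whose
   underlying matroid is the dual of the underlying one, and whose circuits D
   satisfy X _|_ Y for X in C, Y in D with at most 3 common support elements.
   (Full orthogonality may fail over a general skew hyperfield.) *)
Definition is_dual C D : Prop :=
  [/\ right_matroid D,
      forall B : {set E}, basis D (~: B)%SET = basis C B &
      forall X Y, C X -> D Y ->
        #|(vsupp X :&: vsupp Y)%SET| <= 3%N -> orthogonal X Y].

Definition cocircuits C : set {ffun E -> H} :=
  [set Y | exists2 D, is_dual C D & D Y].

Definition vectors C : set {ffun E -> H} :=
  [set V | forall Y, cocircuits C Y -> orthogonal V Y].

End Vectors.

(* Main.v *)
Require Import Defs.
From HB Require Import structures.
From mathcomp Require Import all_boot all_order.
From mathcomp Require Import boolp classical_sets.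

Set Implicit Arguments.
Unset Strict Implicit.
Unset Printing Implicit Defensive.

Local Open Scope classical_set_scope.
Local Open Scope hyper_scope.

(* The sets hN y = y [+] (- y) form a chain, so in a stringent hyperfield the
   sets arising as sums (single elements and sets hN y) have the Helly property:
   if they meet pairwise, they all meet. Hence a family of boxes contains a
   vector orthogonal to a set VV as soon as VV admits elimination and each of its
   members is orthogonal to the family. Applied alternately over H and over the
   opposite hyperfield, by induction on the ground set, this proves elimination
   (V3) for the orthogonal complement of either half of an orthogonal pair (P, Q)
   satisfying Minty's painting property.
   For a left matroid C the pair consists of C and the circuits of the dual. The
   latter are built from ratios X e / X g of circuits meeting a cocircuit in two
   points. That circuits are orthogonal to cocircuits follows by induction on the
   size of the intersection: the cocircuit is a composition of two cocircuits
   meeting the circuit in fewer points.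
   Conversely, a set V with (V0)-(V3) has a matroid C of minimal nonzero elements.
   Elimination writes each element of V, and each vector of C, as a composition of
   circuits; so V is orthogonal to the cocircuits, and contains every vector. *)

(** * Hypersums *)

(** The main argument uses no valuation: levels are compared by inclusion of the sets [hN y], and
    the type of residue enters only through the question whether 1 lies in [1 [+] (- 1)] ([ks]). If
    [ks] holds, a sum avoiding 0 is a single absorbing term, and cancellation does no harm to
    compositions; if it fails, every composition in use is a single-valued sum. Several arguments
    split along this line. A [psi] is built only near the end, because [hcomp] chooses its default
    by the existence of one. Two obstacles shape the rest. Duality prescribes orthogonality only up
    to three common support elements, so the orthogonality of all circuits and cocircuits has to be
    proved; this is where stringency first enters the matroid part. And the dual lives on the other
    side of a noncommutative multiplication, so induction on minors has to treat H and its opposite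
    together. *)

Definition hplus (H : skewHyperfieldType) (A B : set H) : set H :=
  [set z | exists a b, [/\ A a, B b & (a [+] b) z]].

Reserved Notation "\hsum_ ( i 'in' S ) F"
  (at level 34, F at level 34, i, S at level 60,
   format "'[' \hsum_ ( i  'in'  S ) '/  '  F ']'").
Notation "\hsum_ ( i 'in' S ) F" :=
  (\big[@hplus _/[set 0]]_(i in S) F) : hyper_scope.

Section Hyperfield.
Variable H : skewHyperfieldType.
Implicit Types (a b c x y z : H) (A B C : set H).

Lemma hoppK : involutive (@hopp H).
Proof. by move=> x; apply/esym/hopp_uniq; rewrite haddC; apply: haddxN. Qed.

Lemma hopp_inj : injective (@hopp H).
Proof. exact: can_inj hoppK. Qed.

Lemma hadd0x x : 0 [+] x = [set x].
Proof. by rewrite haddC haddx0. Qed.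

Lemma hopp0 : - 0 = 0 :> H.
Proof. by apply/esym/hopp_uniq; rewrite haddx0. Qed.

Lemma hopp_eq0 x : - x = 0 -> x = 0.
Proof. by move=> /(congr1 (@hopp H)); rewrite hoppK hopp0. Qed.

Lemma hadd_eq0 x y : (x [+] y) 0 -> x = - y.
Proof. by move=> /hopp_uniq ->; rewrite hoppK. Qed.

Lemma hmulxN a x : a * (- x) = - (a * x).
Proof.
apply: hopp_uniq; rewrite -hmulDr -[X in _ X](hmulx0 a).
by apply: imageP; apply: haddxN.
Qed.

Lemma hmulNx a x : (- x) * a = - (x * a).
Proof.
apply: hopp_uniq; rewrite -hmulDl -[X in _ X](hmul0x a).
by apply: (@imageP _ _ (hmul^~ a)); apply: haddxN.
Qed.

Definition hinv a : H := xget 0 [set b | b * a = 1 /\ a * b = 1].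

Lemma hmulVx a : a <> 0 -> hinv a * a = 1.
Proof.
by move=> /hmulVex[b hb]; rewrite /hinv; case: xgetP => [_ _ []//|/(_ b)/(_ hb)].
Qed.

Lemma hmulxV a : a <> 0 -> a * hinv a = 1.
Proof.
by move=> /hmulVex[b hb]; rewrite /hinv; case: xgetP => [_ _ []//|/(_ b)/(_ hb)].
Qed.

Lemma hmulKV a x : a <> 0 -> a * (hinv a * x) = x.
Proof. by move=> a0; rewrite hmulA hmulxV// hmul1x. Qed.

Lemma hmulVK a x : a <> 0 -> hinv a * (a * x) = x.
Proof. by move=> a0; rewrite hmulA hmulVx// hmul1x. Qed.

Lemma hmulKVr a x : a <> 0 -> x * hinv a * a = x.
Proof. by move=> a0; rewrite -hmulA hmulVx// hmulx1. Qed.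

Lemma hmulVKr a x : a <> 0 -> x * a * hinv a = x.
Proof. by move=> a0; rewrite -hmulA hmulxV// hmulx1. Qed.

Lemma hmulI a x y : a <> 0 -> a * x = a * y -> x = y.
Proof. by move=> a0 e; rewrite -(hmulVK x a0) e hmulVK. Qed.

Lemma hmulIr a x y : a <> 0 -> x * a = y * a -> x = y.
Proof. by move=> a0 e; rewrite -(hmulVKr x a0) e hmulVKr. Qed.

Lemma hmul_neq0 a x : a <> 0 -> x <> 0 -> a * x <> 0.
Proof. by move=> a0 x0 e; apply: x0; apply: (hmulI a0); rewrite e hmulx0. Qed.

Lemma hinv_neq0 a : a <> 0 -> hinv a <> 0.
Proof.
by move=> a0 e; apply: (@hone_neq0 H); rewrite -(hmulVx a0) e hmul0x.
Qed.

Lemma hopp_neq0 a : a <> 0 -> - a <> 0.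
Proof. by move=> a0 /hopp_eq0. Qed.

Lemma haddNN x y z : (x [+] y) z -> ((- x) [+] (- y)) (- z).
Proof.
move=> h; have := imageP (hmul (- 1)) h.
by rewrite hmulDr !hmulNx !hmul1x.
Qed.

Lemma hadd_rev' x y z : (y [+] z) x -> ((- z) [+] x) y.
Proof. by rewrite [y [+] z]haddC [in X in _ -> X]haddC => /hadd_rev. Qed.

Lemma hplusC : commutative (@hplus H).
Proof.
by move=> A B; apply/seteqP; split=> z [a [b [? ? ?]]]; exists b, a;
  rewrite haddC.
Qed.

Lemma hplusA : associative (@hplus H).
Proof.
move=> A B C; apply/seteqP; split=> z.
- move=> [a [t [Aa [b [c [Bb Cc tbc]]] zat]]].
  have: (\bigcup_(t in b [+] c) (a [+] t)) z by exists t.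
  rewrite -haddA => -[s sab zsc].
  by exists s, c; split=> //; exists a, b.
- move=> [s [c [[a [b [Aa Bb sab]]] Cc zsc]]].
  have: (\bigcup_(t in a [+] b) (t [+] c)) z by exists s.
  rewrite haddA => -[t tbc zat].
  by exists a, t; split=> //; exists b, c.
Qed.

Lemma hplus0 : left_id [set 0] (@hplus H).
Proof.
move=> A; apply/seteqP; split=> z.
- by move=> [a [b [-> Ab]]]; rewrite hadd0x => ->.
- by move=> Az; exists 0, z; rewrite hadd0x.
Qed.

#[warning="-redundant-canonical-projection"]
HB.instance Definition _ :=
  Monoid.isComLaw.Build (set H) [set 0] (@hplus H) hplusA hplusC hplus0.

Lemma hplus11 x y : hplus [set x] [set y] = x [+] y.
Proof.
apply/seteqP; split=> z; first by move=> [a [b [-> -> ]]].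
by move=> h; exists x, y.
Qed.

Lemma hplus_sub A B A' B' :
  A `<=` A' -> B `<=` B' -> hplus A B `<=` hplus A' B'.
Proof. by move=> hA hB z [a [b [/hA ? /hB ? ?]]]; exists a, b. Qed.

Lemma hplus_has0 A B : hplus A B 0 <-> exists2 a, A a & B (- a).
Proof.
split=> [[a [b [Aa Bb /hopp_uniq e]]]|[a Aa Ba]].
  by exists a; rewrite -?e.
by exists a, (- a); split=> //; apply: haddxN.
Qed.

Lemma hmul_hplus a A B :
  hmul a @` hplus A B = hplus (hmul a @` A) (hmul a @` B).
Proof.
apply/seteqP; split=> z.
- move=> [w [x [y [Ax By wxy]]] <-]; exists (a * x), (a * y).
  by split; [exact: imageP|exact: imageP|rewrite -hmulDr; exact: imageP].
- move=> [_ [_ [[x Ax <-] [y By <-]]]]; rewrite -hmulDr => -[w wxy <-].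
  by apply: imageP; exists x, y.
Qed.

Lemma hmulr_hplus a A B :
  hmul^~ a @` hplus A B = hplus (hmul^~ a @` A) (hmul^~ a @` B).
Proof.
apply/seteqP; split=> z.
- move=> [w [x [y [Ax By wxy]]] <-]; exists (x * a), (y * a).
  split; [exact: (@imageP _ _ (hmul^~ a))|exact: (@imageP _ _ (hmul^~ a))|].
  by rewrite -hmulDl; exact: (@imageP _ _ (hmul^~ a)).
- move=> [_ [_ [[x Ax <-] [y By <-]]]]; rewrite -hmulDl => -[w wxy <-].
  by apply: (@imageP _ _ (hmul^~ a)); exists x, y.
Qed.

Lemma hopp_hplus A B : @hopp H @` hplus A B = hplus (@hopp H @` A) (@hopp H @` B).
Proof.
have e X : @hopp H @` X = hmul (- 1) @` X.
  by apply: eq_imagel => x _; rewrite hmulNx hmul1x.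
by rewrite !e hmul_hplus.
Qed.

Section Sums.
Variable I : finType.
Implicit Types (S : {set I}) (F G : I -> set H).

Lemma hsum_sub S F G : (forall i, i \in S -> F i `<=` G i) ->
  \hsum_(i in S) F i `<=` \hsum_(i in S) G i.
Proof.
move=> h; apply: (big_ind2 (fun A B => A `<=` B)) => //.
by move=> A B A' B' *; apply: hplus_sub.
Qed.

Lemma hsum_mull S F a :
  hmul a @` (\hsum_(i in S) F i) =
  \hsum_(i in S) (hmul a @` F i).
Proof.
apply: (big_morph (fun A => hmul a @` A)) => [A B|]; first exact: hmul_hplus.
by rewrite image_set1 hmulx0.
Qed.

Lemma hsum_mulr S F a :
  hmul^~ a @` (\hsum_(i in S) F i) =
  \hsum_(i in S) (hmul^~ a @` F i).
Proof.
apply: (big_morph (fun A => hmul^~ a @` A)) => [A B|].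
  exact: hmulr_hplus.
by rewrite image_set1 hmul0x.
Qed.

Lemma hsumN S F :
  @hopp H @` (\hsum_(i in S) F i) =
  \hsum_(i in S) (@hopp H @` F i).
Proof.
apply: (big_morph (fun A => @hopp H @` A)) => [A B|]; first exact: hopp_hplus.
by rewrite image_set1 hopp0.
Qed.

Lemma hsum_choose S F z : (\hsum_(i in S) F i) z ->
  exists2 t : I -> H, forall i, i \in S -> F i (t i) &
    (\hsum_(i in S) [set t i]) z.
Proof.
have [n] := ubnP #|S|; elim: n S z => // n IH S z.
have [->|[i iS]] := set_0Vmem S.
  by rewrite !big_set0 => _ ->; exists (fun=> 0) => [i|]; rewrite ?inE ?big_set0.
rewrite (cardsD1 i) iS ltnS => cS; rewrite (big_setD1 i)//=.
move=> [a [b [Fa /(IH _ _ cS)[t tF tb] zab]]].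
exists (fun j => if j == i then a else t j).
  by move=> j jS; case: eqP => [->//|/eqP ji]; apply: tF; rewrite !inE ji.
rewrite (big_setD1 i)//= eqxx; exists a, b; split=> //.
rewrite (eq_bigr (fun j => [set t j]))// => j.
by rewrite !inE => /andP[/negPf->].
Qed.

Lemma hsum_zeros S : \hsum_(i in S) [set 0 : H] = [set 0].
Proof. by apply: big1. Qed.

End Sums.

End Hyperfield.

(** * Stringent hyperfields *)

(* The x with y in y [+] x (see hNP). These sets form a chain, which plays the
   role of the valuation: hN x `<=` hN y says that x is of at most the level
   of y. *)
Definition hN (H : skewHyperfieldType) (y : H) : set H := y [+] (- y).
Definition dom (H : skewHyperfieldType) (x y : H) : Prop := hN x `<=` hN y.
Definition krasner_or_sign_like (H : skewHyperfieldType) : Prop := hN (1 : H) 1.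

Notation ks := krasner_or_sign_like.
(* All sums of single elements in a stringent hyperfield are of this form. *)
Definition box (H : skewHyperfieldType) (A : set H) : Prop :=
  (exists c, A = [set c]) \/ (exists y, A = hN y).

Section Stringent.
Variables (H : skewHyperfieldType) (Hstr : stringent H).
Implicit Types (a b c u v w x y z : H) (A B C : set H).

Lemma hN0 : hN (0 : H) = [set 0].
Proof. by rewrite /hN hopp0 haddx0. Qed.

Lemma hN_has0 y : hN y 0.
Proof. exact: haddxN. Qed.

Lemma hN_opp y : hN (- y) = hN y.
Proof. by rewrite /hN hoppK haddC. Qed.

Lemma hN_sym y x : hN y x -> hN y (- x).
Proof. by move=> /haddNN; rewrite hoppK haddC. Qed.

(** By reversibility. It makes [hN y] the set of elements that y can absorb. *)
Lemma hNP y x : hN y x <-> (y [+] x) y.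
Proof.
by split=> [/hadd_rev'|/hadd_rev//]; rewrite hoppK.
Qed.

Lemma hN_mull a y : hmul a @` hN y = hN (a * y).
Proof. by rewrite /hN hmulDr hmulxN. Qed.

Lemma hN_mulr a y : hmul^~ a @` hN y = hN (y * a).
Proof. by rewrite /hN hmulDl hmulNx. Qed.

Lemma hadd_single a b c : a <> - b -> (a [+] b) c -> a [+] b = [set c].
Proof. by move=> /Hstr[d ->] ->. Qed.

Lemma hN_absorb1 y v : hN y v -> v <> - y -> y [+] v = [set y].
Proof.
move=> /hNP yv vy; apply: hadd_single => // e.
by apply: vy; rewrite e hoppK.
Qed.

(** If y absorbs v and [- v], associativity gives that adding all of [hN v] to y yields y only. The
    cases [v = y] and [v = - y], where one of the two sums need not be single, are trivial. *)
Lemma hN_dom y v : hN y v -> dom v y.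
Proof.
move=> yv; have [->//|vy] := pselect (v = y).
have [->|vNy] := pselect (v = - y); first by rewrite /dom hN_opp.
have yvE := hN_absorb1 yv vNy.
have yNvE : y [+] (- v) = [set y].
  by apply: hN_absorb1; [exact: hN_sym|move=> /hopp_inj].
have e : hplus [set y] (hN v) = [set y].
  by rewrite /hN -hplus11 hplusA hplus11 yvE hplus11.
move=> w vw; apply/hNP.
have [z yz] := hadd_neq0 y w.
have : hplus [set y] (hN v) z by exists y, w.
by rewrite e => zy; rewrite -[X in _ X]zy.
Qed.

(** If [u = - v], the sums form [hN v], which [hN_dom] bounds. Otherwise w is the only sum, and y is
    among the sums of y, u and v added in turn. *)
Lemma hN_add y u v w : hN y u -> hN y v -> (u [+] v) w -> hN y w.
Proof.
move=> yu yv uvw.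
have [e|uv] := pselect (u = - v).
  by apply: (hN_dom yv); rewrite /hN haddC -e.
have /hNP yyu := yu; have /hNP yyv := yv; apply/hNP.
have : hplus (hplus [set y] [set u]) [set v] y.
  by exists y, v; split=> //; rewrite hplus11.
rewrite -hplusA hplus11 (hadd_single uv uvw).
by rewrite hplus11.
Qed.

Lemma hN_absorb y u : hN y u -> hplus [set u] (hN y) = hN y.
Proof.
move=> yu; apply/seteqP; split=> [w [a [b [-> yb ub]]]|v yv].
  exact: (hN_add yu yb ub).
have [w vw] := hadd_neq0 (- u) v.
exists u, w; split=> //; first exact: (hN_add (hN_sym yu) yv vw).
by have := hadd_rev _ _ _ vw; rewrite hoppK haddC.
Qed.

(** Adding y and then [- y] to u gives a single element each time by stringency, and u is among the
    results. For u equal to y or [- y] the first sum may not be single, hence the separate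
    [main]. *)
Lemma hN_absorbed y u : ~ hN y u -> hplus [set u] (hN y) = [set u].
Proof.
have main (t : H) : ~ hN t t -> hplus [set t] (hN t) = [set t].
  move=> tt; apply/seteqP; split=> [w [a [b [-> tb]]]|w ->]; last first.
    by exists t, 0; split; [by []|exact: hN_has0|by rewrite haddx0].
  rewrite hN_absorb1// => e; apply: tt.
  by have := hN_sym tb; rewrite e hoppK.
move=> yu; have [uy|uy] := pselect (u = y).
  by rewrite uy in yu *; apply: main.
have [uNy|uNy] := pselect (u = - y).
  by rewrite -hN_opp -uNy; apply: main; rewrite {1}uNy hN_opp.
have [s us] := Hstr uNy.
have sy : s <> - - y.
  rewrite hoppK => e; apply: yu; apply/hNP.
  by rewrite haddC us e.
have [r sr] := Hstr sy.
have e : hplus [set u] (hN y) = [set r].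
  by rewrite /hN -hplus11 hplusA hplus11 us hplus11.
rewrite e; suff : [set r] u by move=> ->.
by rewrite -e; exists u, 0; split; [by []|exact: hN_has0|by rewrite haddx0].
Qed.

(** An element u of [hN x] outside [hN y] absorbs all of [hN y], so [hN y] lies in [hN u], and
    [hN u] in [hN x]. *)
Lemma dom_total x y : dom x y \/ dom y x.
Proof.
have [|xy] := pselect (dom x y); first by left.
right; have [u [xu yu]] : exists u, hN x u /\ ~ hN y u.
  apply: contrapT => h; apply: xy => u xu; apply: contrapT => yu.
  by apply: h; exists u.
move=> v yv; apply: (hN_dom xu); apply/hNP.
have := hN_absorbed yu.
have [w uw] := hadd_neq0 u v => e.
have : hplus [set u] (hN y) w by exists u, v.
by rewrite e => wu; rewrite -[X in _ X]wu.
Qed.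

Lemma dom_trans y x z : dom x y -> dom y z -> dom x z.
Proof. exact: subset_trans. Qed.

Lemma dom_opp x y : dom x y -> dom (- x) y.
Proof. by rewrite /dom hN_opp. Qed.

Lemma dom0 x : dom 0 x.
Proof. by rewrite /dom hN0 => _ ->; exact: hN_has0. Qed.

Lemma dom_mull a x y : dom x y -> dom (a * x) (a * y).
Proof. by rewrite /dom -!hN_mull => h; apply: image_subset. Qed.

Lemma dom_mulr a x y : dom x y -> dom (x * a) (y * a).
Proof. by rewrite /dom -!hN_mulr => h; apply: image_subset. Qed.

Lemma hplus_hN x y : dom x y -> hplus (hN x) (hN y) = hN y.
Proof.
move=> xy; apply/seteqP; split=> [w [a [b [/xy ya yb wab]]]|w yw].
  exact: hN_add wab.
by exists 0, w; split; [exact: hN_has0|by []|by rewrite hadd0x].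
Qed.

(** The ultrametric inequality: after regrouping, [w [+] (- w)] lies in the sum of [hN x] and
    [hN z]. *)
Lemma dom_add x y z w : dom x y -> dom z y -> (x [+] z) w -> dom w y.
Proof.
move=> xy zy xzw u wu.
have : hplus (hplus (hN x) (hN z)) [set 0] u.
  rewrite hplusC hplus0 /hN -!hplus11.
  rewrite -[X in X u]hplusA [hplus [set - x] _]hplusC -!hplusA.
  rewrite hplusA hplus11 [hplus [set - z] _]hplusC !hplus11.
  by exists w, (- w); split=> //; exact: haddNN.
rewrite hplusC hplus0 => -[a [b [/xy ya /zy yb]]].
exact: hN_add.
Qed.

Lemma box1 c : box [set c]. Proof. by left; exists c. Qed.

Lemma box_add a b : box (a [+] b).
Proof.
have [->|/Hstr ab] := pselect (a = - b); last by left.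
by right; exists b; rewrite haddC.
Qed.

(** A single element either lies in [hN y] and is swallowed by it, or absorbs it; of two sets [hN]
    one contains the other. *)
Lemma box_hplus A B : box A -> box B -> box (hplus A B).
Proof.
have h (c y : H) : box (hplus [set c] (hN y)).
  have [/hN_absorb ->|/hN_absorbed ->] := pselect (hN y c); last by left; exists c.
  by right; exists y.
move=> [[a ->]|[x ->]] [[b ->]|[y ->]]; rewrite ?hplus11//.
- exact: box_add.
- by rewrite hplusC.
- have [/hplus_hN ->|/hplus_hN] := dom_total x y; first by right; exists y.
  by rewrite hplusC => ->; right; exists x.
Qed.

Lemma box_hsum (I : finType) (S : {set I}) (F : I -> set H) :
  (forall i, i \in S -> box (F i)) -> box (\hsum_(i in S) F i).
Proof.
by move=> h; apply: big_ind => //; [exact: box1|exact: box_hplus].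
Qed.

Lemma box_mull a A : box A -> box (hmul a @` A).
Proof.
move=> [[c ->]|[y ->]]; first by rewrite image_set1; exact: box1.
by rewrite hN_mull; right; exists (a * y).
Qed.

Lemma box_opp A : box A -> box (@hopp H @` A).
Proof.
move=> [[c ->]|[y ->]]; first by rewrite image_set1; exact: box1.
right; exists y; apply/seteqP; split=> [_ [z yz <-]|z yz]; first exact: hN_sym.
by exists (- z); [exact: hN_sym|rewrite hoppK].
Qed.

Lemma box_neq0 A : box A -> A !=set0.
Proof. by case=> [[c ->]|[y ->]]; [exists c|exists 0; exact: hN_has0]. Qed.

(** If some member is a singleton, its element lies in all others; if none is, all members are sets
    [hN y] and share 0. *)
Lemma helly (F : set (set H)) : (forall A, F A -> box A) ->
    (forall A B, F A -> F B -> exists2 x, A x & B x) ->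
  exists x, forall A, F A -> A x.
Proof.
move=> Fb F2; have [[c Fc]|nF] := pselect (exists c, F [set c]).
  by exists c => A FA; have [x Ax <-] := F2 _ _ FA Fc.
exists 0 => A FA; have [[c e]|[y ->]] := Fb _ FA; last exact: hN_has0.
by case: nF; exists c; rewrite -e.
Qed.

Lemma ksN x : ks H -> hN x x.
Proof. by move=> /(imageP (hmul x)); rewrite hN_mull hmulx1. Qed.

Lemma nksN x : ~ ks H -> x <> 0 -> ~ hN x x.
Proof.
move=> nks x0 /(imageP (hmul (hinv x))).
by rewrite hN_mull hmulVx.
Qed.

Lemma dom0_eq x : ks H -> dom x 0 -> x = 0.
Proof. by move=> /(ksN x) xx /(_ _ xx); rewrite hN0. Qed.

(** Under [ks] an element belongs to its own [hN], so the summand of higher level is always among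
    the sums. *)
Lemma ks_add x y z : ks H -> x [+] y = [set z] -> z = x \/ z = y.
Proof.
move=> hk e; have [/(_ _ (ksN _ hk))|/(_ _ (ksN _ hk))] := dom_total x y.
  by move=> /hNP; rewrite haddC e; right.
by move=> /hNP; rewrite e; left.
Qed.

Lemma ks_eqN x y : ks H -> dom x y -> dom y x -> x = y \/ x = - y.
Proof.
move=> hk /(_ _ (ksN _ hk))/hNP yx /(_ _ (ksN _ hk))/hNP xy.
have [->|n] := pselect (x = - y); first by right.
by left; have [s e] := Hstr n; move: xy; rewrite haddC in yx; rewrite e in yx *; rewrite yx.
Qed.

End Stringent.

(** * Composition and vanishing sums *)

Section CompositionSum.
Variables (H : skewHyperfieldType) (Hstr : stringent H) (I : finType).
Implicit Types (S : {set I}) (t r z : I -> H) (T R Z : I -> set H).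

Lemma absorb_trans (a b c : H) :
  a [+] b = [set a] -> b [+] c = [set b] -> a [+] c = [set a].
Proof.
by move=> ab bc; rewrite -hplus11 -ab -hplus11 -hplusA hplus11 bc hplus11.
Qed.

Lemma sum_absorb S z e : e \in S ->
  (forall f, f \in S -> f <> e -> z e [+] z f = [set z e]) ->
  \hsum_(i in S) [set z i] = [set z e].
Proof.
move=> eS h; rewrite (big_setD1 e)//=.
apply: (big_ind (fun A => hplus [set z e] A = [set z e])) => [|A B hA hB|i].
- by rewrite hplus11 haddx0.
- by rewrite hplusA hA.
- by rewrite !inE => /andP[/eqP ie iS]; rewrite hplus11; exact: h.
Qed.

Lemma ks_sum_mem S z f : ks H -> (\hsum_(i in S) [set z i]) 0 ->
  f \in S -> (\hsum_(i in S) [set z i]) (z f).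
Proof.
move=> hk + fS; rewrite (big_setD1 f)//= => /hplus_has0[_ -> h].
by exists (z f), (- z f); split=> //; exact: ksN.
Qed.

(** Remove an index i. If the rest can sum to 0, their sum is some [hN y], which contains each of
    them by [ks_sum_mem] but not [z i]; so [z i] absorbs them. Otherwise the rest has an absorbing
    term by induction, and it is compared with [z i]. *)
Lemma ks_sum_witness S z : ks H ->
  ~ (\hsum_(i in S) [set z i]) 0 ->
  exists2 e, e \in S & forall f, f \in S -> f <> e -> z e [+] z f = [set z e].
Proof.
move=> hk; have [n] := ubnP #|S|; elim: n S => // n IH S.
have [->|[i iS]] := set_0Vmem S; first by rewrite big_set0 => _ [].
rewrite (cardsD1 i) iS ltnS => cS.
have [s0|s0] := pselect ((\hsum_(j in S :\ i) [set z j]) 0).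
  have [y ey] : exists y, \hsum_(j in S :\ i) [set z j] = hN y.
    have : box (\hsum_(j in S :\ i) [set z j]).
      by apply: box_hsum => // *; exact: box1.
    case=> [[c e]|[y ->]]; last by exists y.
    by exists 0; move: s0; rewrite hN0 e => ->.
  rewrite (big_setD1 i)//= ey => n0; exists i => // f fS fi.
  have nzi : ~ hN y (z i).
    move=> yz; apply: n0; exists (z i), (- z i).
    by split; [by []|exact: hN_sym|exact: haddxN].
  have [w wE] := hadd_neq0 (z i) (z f).
  have yzf : hN y (z f).
    by rewrite -ey; apply: ks_sum_mem => //; rewrite !inE fS andbT; apply/eqP.
  apply/seteqP; split=> [u uE|_ ->].
    by rewrite -(hN_absorbed Hstr nzi); exists (z i), (z f).
  suff wz : w = z i by rewrite -[X in _ X]wz.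
  have : hplus [set z i] (hN y) w by exists (z i), (z f).
  by rewrite (hN_absorbed Hstr nzi).
have [e] := IH _ cS s0; rewrite !inE => /andP[/eqP ei eS] he.
rewrite (big_setD1 i)//= (sum_absorb _ he) ?inE ?eS ?andbT; last exact/eqP.
rewrite hplus11 => n0; have ie : z i <> - z e.
  by move=> e0; apply: n0; rewrite e0 haddC; exact: haddxN.
have [w wE] := Hstr ie; have [we|we] := ks_add Hstr hk wE; rewrite we in wE.
- exists i => // f fS fi; have [->//|fe] := pselect (f = e).
  by apply: (absorb_trans wE); apply: he => //; rewrite !inE fS andbT; apply/eqP.
- exists e => // f fS fe; have [->|fi] := pselect (f = i); first by rewrite haddC.
  by apply: he => //; rewrite !inE fS andbT; apply/eqP.
Qed.

(** [hcomp] as a relation, except for its default value 0, which is taken when [a [+] b] is not a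
    singleton and [ks] fails. The support condition of (V2)' rules that default out. *)
Definition comp_rel (a b c : H) : Prop :=
  a [+] b = [set c] \/ [/\ ks H, a = - b & c = a].

Lemma ks_comp_rel (a b : H) : ks H -> exists2 c, (a [+] b) c & comp_rel a b c.
Proof.
move=> hk; have [ab|] := pselect (a = - b).
  exists a; last by right.
  by have := ksN (- b) hk; rewrite /hN hoppK -ab.
by move=> /Hstr[c e]; exists c; [rewrite e|left].
Qed.

(* In the Krasner or sign case a nonzero sum is a term absorbing all others;
   if the z i sum to c <> 0, the terms of t or those of r sum to c as well. *)
Lemma ks_comp_sum S t r z : ks H ->
  (forall i, i \in S -> comp_rel (t i) (r i) (z i)) ->
  (\hsum_(i in S) [set t i]) 0 ->
  (\hsum_(i in S) [set r i]) 0 ->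
  (\hsum_(i in S) [set z i]) 0.
Proof.
move=> hk tr t0 r0; apply: contrapT => nz0.
have [e eS he] := ks_sum_witness hk nz0.
have ze0 : z e <> 0.
  by move=> e0; apply: nz0; rewrite (sum_absorb eS he) e0.
have abs_add (c a b w : H) : c [+] w = [set c] -> a [+] b = [set w] ->
    c [+] a = [set c] /\ c [+] b = [set c].
  move=> cw ab; have [wa|wb] := ks_add Hstr hk ab.
    rewrite wa in cw ab; split=> //; exact: absorb_trans ab.
  rewrite wb in cw ab; split=> //; rewrite haddC in ab; exact: absorb_trans ab.
have tne f : f \in S -> t f = z e ->
    (forall g, g \in S -> g <> f -> z e [+] t g = [set z e]) -> False.
  move=> fS tf h; rewrite -tf in h ze0.
  by move: t0; rewrite (sum_absorb fS h) => /esym.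
have abst f : f \in S -> f <> e -> z e [+] t f = [set z e].
  move=> fS fe; have := he f fS fe.
  by case: (tr f fS) => [+ /abs_add h|[_ _ ->]//] => /h[].
have [te|te] := pselect (t e = z e); first exact: (tne e).
have [ter|[_ _ /esym]//] := tr e eS.
have [/esym//|re] := ks_add Hstr hk ter.
rewrite re in ter.
have abst' f : f \in S -> z e [+] t f = [set z e].
  move=> fS; have [->|] := pselect (f = e); last exact: abst.
  by rewrite re haddC.
have nt f : f \in S -> t f <> z e.
  by move=> fS tf; apply: (tne f) => // g gS _; exact: abst'.
(* Only a cancelling pair with [r f = - z e] could escape; then [t f = z e], which [nt] excludes. *)
have absr f : f \in S -> f <> e -> r e [+] r f = [set r e].
  rewrite -re => fS fe; have := he f fS fe.
  case: (tr f fS) => [+ /abs_add h|[_ tf _] _]; first by move=> /h[].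
  have ef := abst' _ fS.
  have zer : hN (z e) (r f).
    by rewrite -(hoppK (r f)) -tf; apply: hN_sym; apply/hNP; rewrite ef.
  apply: hN_absorb1 => // rf; apply: (nt f fS).
  by rewrite tf rf hoppK.
by move: r0; rewrite (sum_absorb eS absr) -re => /esym.
Qed.

(** Without [ks] the two sums simply add up, and 0 lies in [0 [+] 0]. Under [ks] one summand is
    chosen from each set and [ks_comp_sum] treats the choices. *)
Lemma comp_sum S T R Z :
  (forall i, i \in S -> hplus (T i) (R i) `<=` Z i \/
     ks H /\ exists2 t, T i = [set t] /\ R i = [set - t] & Z i t) ->
  (\hsum_(i in S) T i) 0 ->
  (\hsum_(i in S) R i) 0 ->
  (\hsum_(i in S) Z i) 0.
Proof.
move=> h T0 R0; have [hk|nk] := pselect (ks H).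
  have [t tT t0] := hsum_choose T0; have [r rR r0] := hsum_choose R0.
  pose z i := xget 0 [set w | Z i w /\ comp_rel (t i) (r i) w].
  have zP i : i \in S -> Z i (z i) /\ comp_rel (t i) (r i) (z i).
    move=> iS; apply: (@xgetPex _ 0 [set w | Z i w /\ comp_rel (t i) (r i) w]).
    have [TRZ|[_ [u [Tu Ru] Zu]]] := h i iS.
      have [c cE ?] := ks_comp_rel (t i) (r i) hk; exists c; split=> //.
      by apply: TRZ; exists (t i), (r i); split=> //; [exact: tT|exact: rR].
    exists u; split=> //; right.
    have := tT i iS; have := rR i iS; rewrite Tu Ru => -> ->.
    by rewrite hoppK.
  apply: (@hsum_sub _ _ S (fun i => [set z i])).
    by move=> i /zP[? _] _ ->.
  by apply: (ks_comp_sum hk _ t0 r0) => i /zP[].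
apply: (@hsum_sub _ _ S (fun i => hplus (T i) (R i))).
  by move=> i /h[//|[]].
by rewrite big_split; exists 0, 0; split=> //; rewrite haddx0.
Qed.

End CompositionSum.

Lemma fin_least (I : finType) (le : I -> I -> Prop) (A : {set I}) :
  (forall x y, le x y \/ le y x) ->
  (forall x y z, le x y -> le y z -> le x z) ->
  A != finset.set0 -> exists2 m, m \in A & forall x, x \in A -> le m x.
Proof.
move=> tot tr; have [n] := ubnP #|A|; elim: n A => // n IH A.
move=> + /set0Pn[a aA]; rewrite (cardsD1 a) aA ltnS => /IH h.
have refl x : le x x by case: (tot x x).
have [e|/h[m]] := eqVneq (A :\ a)%SET finset.set0.
  exists a => // x xA; have [->//|xa] := eqVneq x a.
  by have := finset.in_set0 x; rewrite -e !inE xa xA.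
rewrite !inE => /andP[ma mA] hm.
have [am|ma'] := tot a m; [exists a => //|exists m => //] => x xA;
  have [->//|xa] := eqVneq x a.
- by apply: (tr _ m) => //; apply: hm; rewrite !inE xa.
- by apply: hm; rewrite !inE xa.
Qed.

(** * Orthogonality and elimination *)

Section VectorSets.
Variables (H : skewHyperfieldType) (E : finType).
Implicit Types (V W X Y Z : {ffun E -> H}) (VV P Q : set {ffun E -> H}).

(** Minors are modelled by shrinking the set S of coordinates that count; the vectors themselves
    remain functions on all of E. *)
Definition perp (S : {set E}) X Y : Prop := (\hsum_(f in S) [set X f * Y f]) 0.

Definition suppS (S : {set E}) V : {set E} := [set e in S | V e != 0]%SET.

Definition scaled (scale : H -> {ffun E -> H} -> {ffun E -> H}) VV : Prop :=
  forall a V, a <> 0 -> VV V -> VV (scale a V).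

Definition eliminates (S : {set E}) VV : Prop := forall V W t,
  VV V -> VV W -> t \in S -> V t = - W t -> V t <> 0 ->
  exists Z, [/\ VV Z, forall f, f \in S -> (V f [+] W f) (Z f) & Z t = 0].

Definition supports_in (S : {set E}) VV P : Prop := forall V e,
  VV V -> e \in S -> V e <> 0 ->
  exists X, [/\ P X, X e <> 0 & forall f, f \in S -> V f = 0 -> X f = 0].

Lemma lscaleE a V e : lscale a V e = a * V e. Proof. by rewrite ffunE. Qed.

Lemma rscaleE a V e : rscale a V e = V e * a. Proof. by rewrite ffunE. Qed.

Lemma in_vsupp V e : (e \in vsupp V) = (V e != 0). Proof. by rewrite inE. Qed.

Lemma in_suppS S V e : (e \in suppS S V) = (e \in S) && (V e != 0).
Proof. by rewrite inE. Qed.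

End VectorSets.

(** * Writing a vector as a composition with a circuit *)

Section Decomposition.
Variables (H : skewHyperfieldType) (Hstr : stringent H) (E : finType).
Variables (S : {set E}) (VV P : set {ffun E -> H}).
Hypothesis (VZ : scaled (@lscale H E) VV) (PZ : scaled (@lscale H E) P).
Hypothesis (PV : P `<=` VV) (Vel : eliminates S VV) (VP : supports_in S VV P).
Implicit Types (V W X Y Z : {ffun E -> H}).

(** The scalar is the ratio [V f * hinv (X f)] of least level over the support of X. *)
Lemma least_ratio V X e : e \in S -> X e <> 0 ->
    (forall f, f \in S -> V f = 0 -> X f = 0) ->
  exists a f, [/\ a <> 0, f \in S, V f <> 0, a * X f = V f &
    forall g, g \in S -> dom (a * X g) (V g)].
Proof.
move=> eS Xe VX.
pose r f := V f * hinv (X f).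
have [|||f] := @fin_least _ (fun f g => dom (r f) (r g)) (suppS S X).
- by move=> f g; apply: dom_total.
- by move=> f g h; apply: dom_trans.
- by apply/set0Pn; exists e; rewrite in_suppS eS; apply/eqP.
rewrite in_suppS => /andP[fS /eqP Xf] hf.
have Vf : V f <> 0 by move=> /(VX f fS).
exists (r f), f; split=> //.
- by apply: hmul_neq0 => //; exact: hinv_neq0.
- by rewrite /r hmulKVr.
move=> g gS; have [->|Xg] := pselect (X g = 0).
  by rewrite hmulx0; exact: dom0.
have := hf g; rewrite in_suppS gS (introN eqP Xg) => /(_ isT)/(@dom_mulr _ (X g)).
by rewrite /r hmulKVr.
Qed.

(* Eliminating X, scaled to agree with V in e, leaves a W with V = X o W. *)
Lemma eliminate_circuit V X e : VV V -> P X -> e \in S -> V e <> 0 ->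
    X e = V e -> (forall f, f \in S -> V f = 0 -> X f = 0) ->
  exists W, [/\ VV W, suppS S W \proper suppS S V &
    forall f, f \in S -> (V f [+] (- X f)) (W f)].
Proof.
move=> VVV PX eS Ve XV VX.
have m1 : (- 1 : H) <> 0 by apply: hopp_neq0; exact: hone_neq0.
have XE f : lscale (- 1) X f = - X f by rewrite lscaleE hmulNx hmul1x.
have VXe : V e = - lscale (- 1) X e by rewrite XE XV hoppK.
have [W [VW WE We]] := Vel VVV (VZ m1 (PV PX)) eS VXe Ve.
exists W; split=> //; last by move=> f fS; rewrite -XE; exact: WE.
apply/properP; split.
  apply/fintype.subsetP => f; rewrite !in_suppS => /andP[fS Wf].
  rewrite fS; apply: contraNN Wf => /eqP Vf; have := WE f fS.
  by rewrite XE Vf (VX f fS Vf) hopp0 haddx0 => ->.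
by exists e; rewrite in_suppS eS ?We ?eqxx//=; apply/eqP.
Qed.

(** Over the sign hyperfield this says that x is 0 or v, the usual conformality of signs; in general
    v may also absorb elements of lower level. *)
Definition conforms (x v : H) : Prop := x = v \/ v [+] x = [set v].

Lemma conforms_dom x v : conforms x v -> dom x v.
Proof.
case=> [->//|e]; apply: hN_dom => //; apply/hNP; by rewrite e.
Qed.

Lemma conforms0 x : conforms x 0 -> x = 0.
Proof. by case=> //; rewrite hadd0x => /seteqP[/(_ x erefl)]. Qed.

Lemma dom_conforms x v : ks H -> dom x v -> x <> - v -> conforms x v.
Proof. by move=> hk /(_ _ (ksN x hk)) vx xv; right; exact: hN_absorb1. Qed.

(** Scale a circuit through e by [least_ratio]. If its entry at e has the level of [V e], the two
    agree up to sign. Otherwise eliminating at a place where circuit and V agree leaves a W of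
    smaller support with [W e = V e], whose conformal circuit is still dominated by V. *)
Lemma ks_dominated_circuit n :
    (forall V e, VV V -> #|suppS S V| < n -> e \in S -> V e <> 0 ->
      exists X, [/\ P X, X e = V e & forall f, f \in S -> conforms (X f) (V f)]) ->
  ks H -> forall V e, VV V -> #|suppS S V| <= n -> e \in S -> V e <> 0 ->
    exists X, [/\ P X, X e = V e & forall f, f \in S -> dom (X f) (V f)].
Proof.
move=> IH hk V e VVV cV eS Ve.
have [X [PX Xe VX]] := VP VVV eS Ve.
have [a [t [a0 tS Vt Xt Xd]]] := least_ratio eS Xe VX.
have [Vd|nVd] := pselect (dom (V e) (a * X e)).
  have [eV|eV] := ks_eqN Hstr hk (Xd e eS) Vd.
    by exists (lscale a X); split=> [||f fS]; rewrite ?lscaleE//; auto.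
  exists (lscale (- a) X); split=> [||f fS].
  - by apply: PZ => //; exact: hopp_neq0.
  - by rewrite lscaleE hmulNx eV hoppK.
  - by rewrite lscaleE hmulNx; apply: dom_opp; exact: Xd.
have VaX f : f \in S -> V f = 0 -> lscale a X f = 0.
  by move=> fS /(VX f fS); rewrite lscaleE => ->; rewrite hmulx0.
have Xt' : lscale a X t = V t by rewrite lscaleE.
have [W [VW WV WE]] := eliminate_circuit VVV (PZ a0 PX) tS Vt Xt' VaX.
have We : W e = V e.
  have := WE e eS; rewrite lscaleE.
  have -> : V e [+] (- (a * X e)) = [set V e]; last by [].
  apply: hN_absorb1 => //; first by apply/hN_sym/Xd => //; exact: ksN.
  by move=> /hopp_inj eV; apply: nVd; rewrite eV.
have cW := leq_trans (proper_card WV) cV.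
have We0 : W e <> 0 by rewrite We.
have [Y [PY Ye Yc]] := IH W e VW cW eS We0.
exists Y; split=> //; first by rewrite Ye.
move=> f fS; apply: (dom_trans (conforms_dom (Yc f fS))).
apply: (@dom_add _ Hstr (V f) (V f) (- (a * X f))) => //.
  by apply: dom_opp; exact: Xd.
by have := WE f fS; rewrite lscaleE.
Qed.

(** An inner induction lowers the number of entries where a dominated circuit X fails to conform. At
    such an entry t, [X t = - V t]; adding X to V kills t and changes nothing where X conforms. A
    conformal circuit of the result conforms to V there as well, and vanishes at t. *)
Lemma ks_conformal_circuit V e : ks H -> VV V -> e \in S -> V e <> 0 ->
  exists X, [/\ P X, X e = V e & forall f, f \in S -> conforms (X f) (V f)].
Proof.
move=> hk; have [n] := ubnP #|suppS S V|; elim: n V e => // n IH V e.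
rewrite ltnS => cV VVV eS Ve.
have dominated := ks_dominated_circuit (fun V e VV0 c => IH V e c VV0) hk.
pose sep X := [set f in S | ~~ `[< conforms (X f) (V f) >]]%SET.
have [X0 [PX0 Xe0 Xd0]] := dominated V e VVV cV eS Ve.
suff: forall m X, #|sep X| < m -> P X -> X e = V e ->
    (forall f, f \in S -> dom (X f) (V f)) ->
    exists X, [/\ P X, X e = V e & forall f, f \in S -> conforms (X f) (V f)].
  by move=> /(_ #|sep X0|.+1 X0); apply.
elim=> // m IHm X; rewrite ltnS => cX PX Xe Xd.
have [s0|/set0Pn[t]] := eqVneq (sep X) finset.set0.
  exists X; split=> // f fS; apply: contrapT => /asboolPn nc.
  by have := finset.in_set0 f; rewrite -s0 inE fS nc.
rewrite inE => /andP[tS /asboolPn nt].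
have Xt : X t = - V t.
  by apply: contrapT => /(dom_conforms hk (Xd t tS)).
have Vt : V t <> 0.
  by move=> Vt; apply: nt; rewrite Xt Vt hopp0; left.
(* If some nonzero v equals [- v], then [- 1 = 1], and [X t = - V t] would conform after all. *)
have n1 (v : H) : v <> 0 -> v <> - v.
  move=> v0 ev; apply: nt; left; rewrite Xt.
  have e1 : - 1 = 1 :> H by apply: (hmulI v0); rewrite hmulxN hmulx1.
  by rewrite -[RHS]hmul1x -e1 hmulNx hmul1x.
have vv (v : H) : v [+] v = [set v].
  have [->|v0] := pselect (v = 0); first by rewrite haddx0.
  by apply: hN_absorb1 => //; [exact: ksN|exact: n1].
have VXt : V t = - X t by rewrite Xt hoppK.
have [W [VW WE Wt]] := Vel VVV (PV PX) tS VXt Vt.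
have Wc f : f \in S -> conforms (X f) (V f) -> W f = V f.
  move=> fS c; have := WE f fS; suff -> : V f [+] X f = [set V f] by [].
  by case: c => [->|].
have We : W e = V e by apply: Wc => //; left.
have WV f : f \in S -> dom (W f) (V f).
  by move=> fS; apply: (@dom_add _ Hstr (V f) (V f) (X f)); auto.
have cW : #|suppS S W| < n.
  apply: leq_trans cV; apply: proper_card; apply/properP; split.
    apply/fintype.subsetP => f; rewrite !in_suppS => /andP[fS Wf].
    rewrite fS; apply: contraNN Wf => /eqP Vf.
    have := WV f fS; rewrite Vf => /(dom0_eq hk) ->; exact: eqxx.
  by exists t; rewrite in_suppS tS ?Wt ?eqxx//=; apply/eqP.
have We0 : W e <> 0 by rewrite We.
have [Y [PY Ye Yc]] := IH W e cW VW eS We0.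
apply: (IHm Y) => //; last 2 first.
- by rewrite Ye.
- by move=> f fS; apply: (dom_trans (conforms_dom (Yc f fS))); exact: WV.
apply: leq_trans cX; apply: proper_card; apply/properP; split.
  apply/fintype.subsetP => f; rewrite !inE => /andP[fS nY].
  rewrite fS; apply: contraNN nY => /asboolP/(Wc f fS) WV'.
  by apply/asboolP; rewrite -WV'; exact: Yc.
exists t; first by rewrite inE tS; apply/asboolPn.
rewrite inE tS negbK; apply/asboolP; right.
by have := Yc t tS; rewrite Wt => /conforms0 ->; rewrite haddx0.
Qed.

(** Under [ks] the circuit X is taken conformal, so that X and W can only cancel where [X f = V f],
    the value required. Otherwise a circuit dominated by V is enough. *)
Lemma decomposition V e : VV V -> e \in S -> V e <> 0 ->
  exists X W, [/\ P X, VV W, suppS S W \proper suppS S V &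
    forall f, f \in S -> [/\ comp_rel (X f) (W f) (V f),
      V f = 0 -> X f = 0, dom (X f) (V f) & dom (W f) (V f)]].
Proof.
move=> VVV eS Ve.
have [hk|nk] := pselect (ks H).
  have [X [PX Xe Xc]] := ks_conformal_circuit hk VVV eS Ve.
  have VX f : f \in S -> V f = 0 -> X f = 0.
    by move=> fS Vf; have := Xc f fS; rewrite Vf => /conforms0.
  have [W [VW WV WE]] := eliminate_circuit VVV PX eS Ve Xe VX.
  have Wd f : f \in S -> dom (W f) (V f).
    move=> fS; apply: (@dom_add _ Hstr (V f) (V f) (- X f)) => //; last exact: WE.
    by apply: dom_opp; apply: conforms_dom; exact: Xc.
  exists X, W; split=> // f fS; split; auto; last by apply: conforms_dom; auto.
  have [XW|XV] := pselect (X f = V f).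
    have [WX|WX] := pselect (X f = - W f); first by right.
    left; rewrite -XW; apply: hN_absorb1 => //.
      by rewrite XW; apply: (Wd f fS); exact: ksN.
    by move=> WX'; apply: WX; rewrite WX' hoppK.
  left; have [//|VXV] := Xc f fS.
  have -> : W f = V f; last by rewrite haddC.
  have := WE f fS; suff -> : V f [+] (- X f) = [set V f] by [].
  apply: hN_absorb1 => //; first by apply/hN_sym/hNP; rewrite VXV.
  by move=> /hopp_inj.
have [X [PX Xe VX]] := VP VVV eS Ve.
have [a [t [a0 tS Vt Xt Xd]]] := least_ratio eS Xe VX.
have VaX f : f \in S -> V f = 0 -> lscale a X f = 0.
  by move=> fS /(VX f fS); rewrite lscaleE => ->; rewrite hmulx0.
have Xt' : lscale a X t = V t by rewrite lscaleE.
have [W [VW WV WE]] := eliminate_circuit VVV (PZ a0 PX) tS Vt Xt' VaX.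
exists (lscale a X), W; split=> //; first exact: PZ.
move=> f fS; have aXd : dom (lscale a X f) (V f) by rewrite lscaleE; exact: Xd.
split; auto; last first.
  apply: (@dom_add _ Hstr (V f) (V f) (- lscale a X f)) => //; last exact: WE.
  exact: dom_opp.
left; set x := lscale a X f in aXd *.
have VxW : (x [+] W f) (V f).
  by have := hadd_rev' (WE f fS); rewrite hoppK.
have [xW|xW] := pselect (x = - W f); last exact: hadd_single.
(* A cancelling pair would put [V f] into [hN x], hence into [hN (V f)], impossible for a nonzero
   element without [ks]. *)
have Vf : V f = 0.
  apply: contrapT => Vf; apply: (nksN nk Vf); apply: aXd.
  by rewrite /hN {2}xW hoppK.
have x0 : x = 0 by apply: VaX.
have W0 : W f = 0 by rewrite -(hoppK (W f)) -xW x0 hopp0.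
by rewrite x0 W0 Vf haddx0.
Qed.

End Decomposition.

(** * Orthogonality to boxes *)

Section Extension.
Variables (H : skewHyperfieldType) (Hstr : stringent H) (E : finType).
Variables (S : {set E}) (VV : set {ffun E -> H}).
Hypothesis (VZ : scaled (@lscale H E) VV) (Vel : eliminates S VV).
Implicit Types (V W X Y Z : {ffun E -> H}) (A : E -> set H).

Lemma hmul0_image (B : set H) : B !=set0 -> hmul 0 @` B = [set 0].
Proof.
move=> [b Bb]; apply/seteqP; split=> [_ [x _ <-]|_ ->]; first exact: hmul0x.
by exists b => //; exact: hmul0x.
Qed.

Lemma hmul_comp_rel (a b c p : H) : comp_rel a b c ->
  comp_rel (a * p) (b * p) (c * p).
Proof.
case=> [e|[hk -> ->]]; last by right; rewrite hmulNx.
by left; rewrite -hmulDl e image_set1.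
Qed.

(** Induction on the support along [decomposition], with [comp_sum] joining the two parts. A single
    element is multiplied through [comp_rel]; for a set [hN y] the bounds on levels suffice, as it
    is closed under addition. *)
Lemma box_sum_extends P A : scaled (@lscale H E) P -> P `<=` VV ->
    supports_in S VV P -> (forall f, f \in S -> box (A f)) ->
    (forall X, P X -> (\hsum_(f in S) (hmul (X f) @` A f)) 0) ->
  forall V, VV V -> (\hsum_(f in S) (hmul (V f) @` A f)) 0.
Proof.
move=> PZ PV VP bA hP V; have [n] := ubnP #|suppS S V|; elim: n V => // n IH V.
rewrite ltnS => cV VVV.
have [s0|/set0Pn[e]] := eqVneq (suppS S V) finset.set0.
  apply: (@hsum_sub _ _ S (fun=> [set 0])); last by rewrite hsum_zeros.
  move=> f fS; have -> : V f = 0.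
    apply/eqP; have := finset.in_set0 f; rewrite -s0 in_suppS fS.
    by move=> /negbFE.
  by rewrite hmul0_image//; apply: box_neq0; exact: bA.
rewrite in_suppS => /andP[eS /eqP Ve].
have [X [W [PX VW WV XWV]]] := decomposition Hstr VZ PZ PV Vel VP VVV eS Ve.
apply: (comp_sum Hstr _ (hP X PX) (IH W _ VW)); last first.
  exact: leq_trans (proper_card WV) cV.
move=> f fS; have [c _ Xd Wd] := XWV f fS.
have [[p ->]|[y ->]] := bA f fS; last first.
  left; rewrite !hN_mull => z [a [b [ha hb ab]]].
  apply: (@hN_add _ Hstr _ a b) => //.
  - by move: ha; apply: dom_mulr.
  - by move: hb; apply: dom_mulr.
rewrite !image_set1 hplus11; have [->|[hk eX ->]] := hmul_comp_rel p c.
  by left.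
by right; split=> //; exists (X f * p) => //; split=> //; rewrite eX hoppK.
Qed.

(* A Farkas lemma: the sets constraining the t-th entry are boxes, which meet
   pairwise by elimination, hence have a common point. *)
Lemma perp_in_box A : (forall f, f \in S -> box (A f)) ->
    (forall V, VV V -> (\hsum_(f in S) (hmul (V f) @` A f)) 0) ->
  exists2 u : {ffun E -> H}, forall f, f \in S -> A f (u f) &
    forall V, VV V -> perp S V u.
Proof.
pose single (B : set H) := `[< exists c, B = [set c] >].
pose free A := [set f in S | ~~ single (A f)]%SET.
have [n] := ubnP #|free A|; elim: n A => // n IH A.
rewrite ltnS => cA bA VA.
have [s0|/set0Pn[t]] := eqVneq (free A) finset.set0.
  have AE f : f \in S -> A f = [set xget 0 (A f)].
    move=> fS; have : f \notin free A by rewrite s0 finset.in_set0.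
    rewrite inE fS negbK => /asboolP[c ->].
    by congr (fun x => [set x]); apply/esym; apply: xget_unique.
  exists [ffun f => xget 0 (A f)] => [f fS|V VVV].
    by rewrite ffunE {1}AE.
  rewrite /perp; have := VA V VVV; apply: (@hsum_sub _ _ S) => f fS.
  by rewrite {1}AE// image_set1 ffunE.
rewrite inE => /andP[tS nt].
pose Sig V := \hsum_(f in S :\ t) (hmul (V f) @` A f).
have VAt V : VV V -> hplus (hmul (V t) @` A t) (Sig V) 0.
  by move=> /VA; rewrite (big_setD1 t).
have SigZ a V : Sig (lscale a V) = hmul a @` Sig V.
  rewrite hsum_mull; apply: eq_bigr => f _; rewrite image_comp lscaleE.
  by apply: eq_imagel => x _ /=; rewrite hmulA.
pose F := [set B | B = @hopp H @` A t \/
  exists V, [/\ VV V, V t = 1 & B = Sig V]].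
(* The point z is minus the entry at t still to be chosen: it has to lie in the negative of [A t]
   and, for each V normalised by [V t = 1], among the sums of the remaining terms. *)
have [z zF] : exists z, forall B, F B -> B z.
  (* Eliminating t between V and W gives a vector whose sum over the other coordinates contains 0
     and lies in [Sig V] minus [Sig W]. *)
  have meetV V W : VV V -> VV W -> V t = 1 -> W t = 1 ->
      exists2 x, Sig V x & Sig W x.
    move=> VVV VVW Vt Wt.
    have m1 : (- 1 : H) <> 0 by apply: hopp_neq0; exact: hone_neq0.
    have Vt0 : V t <> 0 by rewrite Vt; exact: hone_neq0.
    have VWt : V t = - lscale (- 1) W t by rewrite lscaleE Wt hmulx1 hoppK.
    have [Z [VVZ ZE Zt]] := Vel VVV (VZ m1 VVW) tS VWt Vt0.
    have := VAt _ VVZ; rewrite Zt hmul0_image; last exact/box_neq0/bA.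
    rewrite hplus0 => Z0.
    have : hplus (Sig V) (Sig (lscale (- 1) W)) 0.
      rewrite /Sig -big_split /=; apply: hsum_sub Z0 => f.
      rewrite !inE => /andP[_ fS] _ [a Aa <-].
      exists (V f * a), (lscale (- 1) W f * a).
      split; [by exists a|by exists a|rewrite -hmulDl].
      by apply: (@imageP _ _ (hmul^~ a)); exact: ZE.
    move=> /hplus_has0[x Vx]; rewrite SigZ => -[y Wy].
    by rewrite hmulNx hmul1x => /hopp_inj yx; exists x => //; rewrite -yx.
  have meetA V : VV V -> V t = 1 -> exists2 x, (@hopp H @` A t) x & Sig V x.
    move=> VVV Vt; have /hplus_has0[_ [a Aa <-]] := VAt V VVV.
    by rewrite Vt hmul1x => ?; exists (- a); first by exists a.
  have bSig V : box (Sig V).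
    apply: box_hsum => // f; rewrite !inE => /andP[_ fS].
    by apply: box_mull; exact: bA.
  apply: helly => [B [->|[V [_ _ ->]]]//|B1 B2].
    by apply: box_opp; exact: bA.
  move=> [->|[V [VVV Vt ->]]] [->|[W [VVW Wt ->]]].
  - by have [a Aa] := box_neq0 (bA t tS); exists (- a); exists a.
  - exact: meetA.
  - by have [x ? ?] := meetA V VVV Vt; exists x.
  - exact: meetV.
pose A' f := if f == t then [set - z] else A f.
have At' : A t (- z).
  by have [|a Aa <-] := zF (@hopp H @` A t); [left|rewrite hoppK].
have [|f fS|V VVV|u uA uV] := IH A'.
- apply: leq_trans cA; apply: proper_card; apply/properP; split.
    apply/fintype.subsetP => f; rewrite !inE /A' => /andP[->].
    by case: eqP => // _ /asboolP[]; exists (- z).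
  exists t; first by rewrite inE tS.
  by rewrite inE /A' tS eqxx negbK; apply/asboolP; exists (- z).
- by rewrite /A'; case: eqP => _; [exact: box1|exact: bA].
- rewrite (big_setD1 t)//= {1}/A' eqxx image_set1.
  rewrite (eq_bigr (fun f => hmul (V f) @` A f)); last first.
    by move=> f; rewrite /A' !inE => /andP[/negPf-> _].
  have [Vt|Vt] := pselect (V t = 0).
    have := VAt V VVV; rewrite Vt hmul0x hmul0_image//.
    exact/box_neq0/bA.
  have /zF : F (Sig (lscale (hinv (V t)) V)).
    right; exists (lscale (hinv (V t)) V); split=> //.
      by apply: VZ => //; exact: hinv_neq0.
    by rewrite lscaleE hmulVx.
  rewrite SigZ => -[w Vw wz]; apply/hplus_has0; exists (V t * - z) => //.
  by rewrite hmulxN hoppK -wz hmulKV.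
- exists u => // f fS; have := uA f fS; rewrite /A'.
  by case: eqP => [->->|].
Qed.

End Extension.

(** * The opposite hyperfield *)

(** A separate name for the same type carries the reversed multiplication. Addition is literally
    that of H, so stringency and boxes transfer by conversion, and [lscale] over the opposite is
    [rscale] over H. *)
Definition opposite (H : Type) : Type := H.

Section Opposite.
Variable H : skewHyperfieldType.

HB.instance Definition _ := Choice.on (opposite H).

Lemma opp_hmulVex (x : H) : x <> 0 -> exists y, x * y = 1 /\ y * x = 1.
Proof. by move=> /hmulVex[y []]; exists y. Qed.

HB.instance Definition _ := @isSkewHyperfield.Build (opposite H)
  (0 : H) (1 : H) (@hopp H) (fun x y => hmul y x) (@hadd H)
  (@hadd_neq0 H) (@haddC H) (@haddA H) (@haddx0 H) (@haddxN H)
  (@hopp_uniq H) (@hadd_rev H) (@hone_neq0 H)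
  (fun x y z => esym (hmulA z y x)) (@hmulx1 H) (@hmul1x H)
  (@hmulx0 H) (@hmul0x H) opp_hmulVex (@hmulDl H) (@hmulDr H).

End Opposite.

Definition opposite_hyperfield (H : skewHyperfieldType) : skewHyperfieldType :=
  opposite H.

(** * Complementary pairs satisfying the painting property *)

Section Minty.
Variables (E : finType).

(** This property, unlike a matroid structure over H, passes at once to minors and to the opposite
    hyperfield with P and Q exchanged, which is what the induction for elimination needs. *)
Record minty (H : skewHyperfieldType) (S : {set E})
    (P Q : set {ffun E -> H}) : Prop := Minty {
  mintyZl : scaled (@lscale H E) P;
  mintyZr : scaled (@rscale H E) Q;
  minty_perp : forall X Y, P X -> Q Y -> perp S X Y;
  minty_paint : forall e (R : {set E}), e \in S ->
    (exists X, [/\ P X, X e <> 0 &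
       forall f, f \in S -> X f <> 0 -> f = e \/ f \in R]) \/
    (exists Y, [/\ Q Y, Y e <> 0 &
       forall f, f \in S -> Y f <> 0 -> f = e \/ f \notin R])
}.

(** Deletion for P is contraction for Q. The old painting is applied with t in the colour of Q, so
    that a member of P obtained from it vanishes at t. *)
Lemma minty_delete (H : skewHyperfieldType) (S : {set E}) (P Q : set {ffun E -> H}) t :
  t \in S -> minty S P Q ->
  @minty (opposite_hyperfield H) (S :\ t)%SET Q (P `&` [set X | X t = 0]).
Proof.
move=> tS m; split.
- exact: (mintyZr m).
- move=> a X a0 [PX Xt]; split; first exact: (mintyZl m).
  by change (@lscale H E a X t = 0 :> H); rewrite lscaleE Xt hmulx0.
- move=> X Y QX [PY Yt].
  have := minty_perp m PY QX; rewrite /perp (big_setD1 t)//=.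
  by rewrite Yt hmul0x (@hplus0 H).
- move=> e R; rewrite in_setD1 => /andP[et eS].
  have [[X [PX Xe XR]]|[Y [QY Ye YR]]] :=
    minty_paint m (~: (t |: R))%SET eS.
    right; exists X; split=> //; last first.
      move=> f; rewrite in_setD1 => /andP[_ fS] /(XR f fS)[]; first by left.
      by rewrite !inE negb_or => /andP[]; right.
    split=> //; apply: contrapT => Xt.
    case: (XR t tS Xt) => [te|]; first by rewrite te eqxx in et.
    by rewrite !inE eqxx.
  left; exists Y; split=> // f; rewrite in_setD1 => /andP[ft fS] /(YR f fS).
  by rewrite !inE (negPf ft) negbK; case; [left|right].
Qed.

Definition perpl (H : skewHyperfieldType) (S : {set E}) (Q : set {ffun E -> H}) :
  set {ffun E -> H} := [set V | forall Y, Q Y -> perp S V Y].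

Lemma scaled_perpl (H : skewHyperfieldType) (S : {set E}) (Q : set {ffun E -> H}) :
  scaled (@lscale H E) (perpl S Q).
Proof.
move=> a V _ QV Y /QV/(imageP (hmul a)); rewrite hmulx0 hsum_mull.
rewrite /perp; apply: hsum_sub => f _; rewrite image_set1 lscaleE hmulA.
exact: subset_refl.
Qed.

(** Paint with the support of V. A member of Q obtained in this way would meet V in e only, and the
    sum would be the nonzero product of the two entries. *)
Lemma minty_supports (H : skewHyperfieldType) (S : {set E}) (P Q : set {ffun E -> H}) :
  minty S P Q -> supports_in S (perpl S Q) P.
Proof.
move=> m V e QV eS Ve.
have [[X [PX Xe XV]]|[Y [QY Ye YV]]] :=
    minty_paint m [set f | V f != 0]%SET eS.
  exists X; split=> // f fS Vf; apply: contrapT => /(XV f fS)[fe|].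
    by apply: Ve; rewrite -fe.
  by rewrite inE Vf eqxx.
case: (hmul_neq0 Ve Ye); have := QV Y QY; rewrite /perp (@sum_absorb _ _ _ _ e)//=.
move=> f fS fe; have [->|Yf] := pselect (Y f = 0).
  by rewrite hmulx0 haddx0.
case: (YV f fS Yf) => // ; rewrite inE negbK => /eqP ->.
by rewrite hmul0x haddx0.
Qed.

Lemma sum_hadd_delete (H : skewHyperfieldType) (S : {set E})
    (V W Y : {ffun E -> H}) t :
  t \in S -> V t = - W t -> perp S V Y -> perp S W Y ->
  (\hsum_(f in S :\ t) (hmul^~ (Y f) @` (V f [+] W f))) 0.
Proof.
move=> tS VWt; rewrite /perp !(big_setD1 t tS) /=.
move=> /hplus_has0[_ -> VY] /hplus_has0[_ -> WY].
have : hplus (\hsum_(f in S :\ t) [set V f * Y f])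
             (\hsum_(f in S :\ t) [set W f * Y f]) 0.
  apply/hplus_has0; exists (- (V t * Y t)) => //.
  by rewrite VWt hmulNx !hoppK.
rewrite -big_split /=; apply: hsum_sub => f _.
by rewrite hplus11 hmulDl; exact: subset_refl.
Qed.

Lemma perp_extend (H : skewHyperfieldType) (S : {set E})
    (u Y : {ffun E -> H}) t :
  t \in S -> perp (S :\ t)%SET u Y ->
  perp S [ffun f => if f == t then 0 else u f] Y.
Proof.
move=> tS uY; rewrite /perp (big_setD1 t tS) /= ffunE eqxx hmul0x hplus0.
apply: hsum_sub uY => f; rewrite !inE => /andP[/negPf ft _].
by rewrite ffunE ft; exact: subset_refl.
Qed.

(* Induction on S: the terms V f [+] W f span a box, in which perp_in_box over
   the opposite hyperfield finds Z once t has been deleted. *)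
Theorem minty_eliminates (H : skewHyperfieldType) (S : {set E}) (P Q : set {ffun E -> H}) :
  stringent H -> minty S P Q -> eliminates S (perpl S Q).
Proof.
(* H varies in the induction, since deleting t exchanges the two sides of the pair and leads to the
   opposite hyperfield. *)
have [n] := ubnP #|S|; elim: n H S P Q => // n IH H S P Q.
rewrite ltnS => cS Hstr m V W t QV QW tS VWt Vt.
have m' := minty_delete tS m.
set P' := (_ `&` _) in m'.
have Hstr' : stringent (opposite_hyperfield H) by exact: Hstr.
have cS' : #|(S :\ t)%SET| < n.
  by apply: leq_trans cS; rewrite (cardsD1 t S) tS.
have el' := IH (opposite_hyperfield H) _ _ _ cS' Hstr' m'.
have QP' : Q `<=` @perpl (opposite_hyperfield H) (S :\ t)%SET P'.
  by move=> Y QY X PX; exact: (minty_perp m').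
pose A f := V f [+] W f.
have bA f : f \in (S :\ t)%SET -> box (A f) by move=> _; exact: box_add.
have QA Y : Q Y -> (\hsum_(f in S :\ t) (hmul^~ (Y f) @` A f)) 0.
  by move=> QY; exact: (sum_hadd_delete tS VWt (QV Y QY) (QW Y QY)).
(* Q itself need not admit elimination, so [perp_in_box] is applied to the complement of [P'], which
   contains Q and admits it by induction; [box_sum_extends] carries orthogonality to the box from Q
   to it. *)
have [|u uA uV] := @perp_in_box (opposite_hyperfield H) Hstr' _ _ _
  (@scaled_perpl (opposite_hyperfield H) _ _) el' A bA.
  exact: (@box_sum_extends (opposite_hyperfield H) Hstr' _ _ _
    (@scaled_perpl (opposite_hyperfield H) _ _) el' Q A (mintyZl m') QP'
    (minty_supports m') bA QA).
exists [ffun f => if f == t then 0 else u f]; split=> [Y QY|f fS|].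
- have uY : @perp H E (S :\ t)%SET u Y := uV Y (QP' Y QY).
  exact: perp_extend tS uY.
- rewrite ffunE; case: eqP => [->|/eqP ft]; last by apply: uA; rewrite !inE ft.
  by rewrite VWt haddC; exact: haddxN.
- by rewrite ffunE eqxx.
Qed.

End Minty.

(** * Circuits and cocircuits of a matroid *)

Section SetMatroid.
Variable E : finType.
Implicit Types (A B F I K L M R T W X Y Z : {set E}) (e f g p q : E).

Record circuit_system (Cs : {set E} -> Prop) : Prop := CircuitSystem {
  cs_neq0 : ~ Cs finset.set0;
  cs_incomp : forall X Y, Cs X -> Cs Y -> X \subset Y -> X = Y;
  cs_elim : forall X Y e, Cs X -> Cs Y -> X <> Y -> e \in X -> e \in Y ->
    exists2 Z, Cs Z & Z \subset (X :|: Y) :\ e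
}.

Definition indep (Cs : {set E} -> Prop) I : Prop :=
  forall X, Cs X -> ~~ (X \subset I).

Definition hits (Cs : {set E} -> Prop) K : Prop :=
  forall X e, Cs X -> e \in X -> e \in K ->
    exists f, [/\ f \in X, f \in K & f <> e].

Definition cocircuit (Cs : {set E} -> Prop) K : Prop :=
  [/\ exists e, e \in K, hits Cs K &
    forall L, (exists e, e \in L) -> hits Cs L -> L \subset K -> L = K].

Lemma subset_of X Y : (forall x, x \in X -> x \in Y) -> X \subset Y.
Proof. by move=> h; apply/fintype.subsetP. Qed.

Lemma not_subset X Y : ~~ (X \subset Y) -> exists2 x, x \in X & x \notin Y.
Proof. by move=> /fintype.subsetPn[x]; exists x. Qed.

Variable Cs : {set E} -> Prop.
Hypothesis CS : circuit_system Cs.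

(** If weak elimination gives a Z1 without f, take g in Z1 outside X. Eliminating g between Y and Z1
    while keeping e gives a Z2 without f; eliminating e between X and Z2 then keeps f. Both unions
    are smaller: the first lacks f, the second g. *)
Lemma strong_elim X Y e f : Cs X -> Cs Y -> e \in X -> e \in Y ->
  f \in X -> f \notin Y ->
  exists Z, [/\ Cs Z, f \in Z & Z \subset (X :|: Y) :\ e].
Proof.
have [n] := ubnP #|X :|: Y|; elim: n X Y e f => // n IH X Y e f.
rewrite ltnS => cXY CX CY eX eY fX fY.
have XY : X <> Y by move=> XY; rewrite XY (negPf fY) in fX.
have [Z1 CZ1 sZ1] := cs_elim CS CX CY XY eX eY.
have [fZ1|fZ1] := boolP (f \in Z1); first by exists Z1.
have sub1 x : x \in Z1 -> x != e /\ (x \in X) || (x \in Y).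
  by move=> /(fintype.subsetP sZ1); rewrite !inE => /andP.
have [Z1X|/not_subset[g gZ1 gX]] := boolP (Z1 \subset X).
  by move: fZ1; rewrite (cs_incomp CS CZ1 CX Z1X) fX.
have gY : g \in Y by have [_] := sub1 g gZ1; rewrite (negPf gX).
have eZ1 : e \notin Z1 by apply/negP => /sub1[]; rewrite eqxx.
have [|Z2 [CZ2 eZ2 sZ2]] := IH Y Z1 g e _ CY CZ1 gY gZ1 eY eZ1.
  apply: leq_trans cXY; apply: proper_card; apply/properP; split.
    apply: subset_of => x; rewrite !inE => /orP[->|/sub1[_ //]].
    by rewrite orbT.
  by exists f; rewrite !inE ?fX// negb_or fY.
have sub2 x : x \in Z2 -> x != g /\ (x \in Y) || (x \in Z1).
  by move=> /(fintype.subsetP sZ2); rewrite !inE => /andP.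
have fZ2 : f \notin Z2.
  by apply/negP => /sub2[_]; rewrite (negPf fY) (negPf fZ1).
have sub3 x : x \in Z2 -> (x \in X) || (x \in Y).
  by move=> /sub2[_ /orP[->|/sub1[]//]]; rewrite orbT.
have [|Z [CZ fZ sZ]] := IH X Z2 e f _ CX CZ2 eX eZ2 fX fZ2.
  apply: leq_trans cXY; apply: proper_card; apply/properP; split.
    by apply: subset_of => x; rewrite !inE => /orP[->//|/sub3].
  exists g; rewrite !inE ?gY ?orbT// negb_or gX /=.
  by apply/negP => /sub2[]; rewrite eqxx.
exists Z; split=> //; apply: subset_of => x /(fintype.subsetP sZ).
by rewrite !inE => /andP[-> /orP[->//|/sub3]].
Qed.

(** If no circuit through e fits into [e |: R], enlarge R as long as this remains so. For a maximal
    R each further f shares a circuit with e inside [e |: (f |: R)], and these circuits show that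
    [e |: ~: R] itself is a cocircuit. *)
Lemma painting e R :
  (exists X, [/\ Cs X, e \in X & X \subset e |: R]) \/
  (exists K, [/\ cocircuit Cs K, e \in K & K \subset e |: ~: R]).
Proof.
have [n] := ubnP #|~: R|; elim: n R => // n IH R; rewrite ltnS => cR.
have [|noX] := pselect (exists X, [/\ Cs X, e \in X & X \subset e |: R]).
  by left.
right; have [[f [fe fR nof]]|allf] := pselect (exists f, [/\ f != e, f \notin R &
    ~ exists X, [/\ Cs X, e \in X & X \subset e |: (f |: R)]]).
  have [|//|[K [cK eK sK]]] := IH (f |: R).
    apply: leq_trans cR; apply: proper_card; apply/properP; split.
      by apply: subset_of => x; rewrite !inE negb_or => /andP[].
    by exists f; rewrite !inE ?eqxx.
  exists K; split=> //; apply: subset_of => x /(fintype.subsetP sK).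
  by rewrite !inE negb_or => /orP[->//|/andP[_ ->]]; rewrite orbT.
have pairX f : f != e -> f \notin R ->
    exists X, [/\ Cs X, e \in X, f \in X & X \subset e |: (f |: R)].
  move=> fe fR; apply: contrapT => nX; apply: allf; exists f; split=> //.
  move=> [X [CX eX sX]]; have [fX|fX] := boolP (f \in X).
    by apply: nX; exists X.
  apply: noX; exists X; split=> //; apply: subset_of => x xX.
  have := fintype.subsetP sX x xX; rewrite !inE => /or3P[->//|/eqP xf|->].
    by move: fX; rewrite -xf xX.
  by rewrite orbT.
exists (e |: ~: R); split=> //; last by rewrite !inE eqxx.
split; first by exists e; rewrite !inE eqxx.
  move=> X x CX xX xK; apply: contrapT => nof.
  have sub1 y : y \in X -> y != x -> (y != e) && (y \in R).
    move=> yX yx; rewrite -[X in _ && X]negbK -negb_or; apply/negP => yK.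
    by apply: nof; exists y; split=> //; [rewrite !inE|apply/eqP].
  have [xe|xe] := eqVneq x e.
    apply: noX; exists X; split=> //; first by rewrite -xe.
    apply: subset_of => y yX; rewrite !inE -xe; case: eqVneq => //= yx.
    by have /andP[] := sub1 y yX yx.
  have xR : x \notin R by move: xK; rewrite !inE (negPf xe).
  have [X' [CX' eX' xX' sX']] := pairX x xe xR.
  have eX : e \notin X.
    apply/negP => eX; have := sub1 e eX; rewrite eq_sym xe eqxx.
    by move=> /(_ isT).
  have [Z [CZ eZ sZ]] := strong_elim CX' CX xX' xX eX' eX.
  apply: noX; exists Z; split=> //; apply: subset_of => y.
  move=> /(fintype.subsetP sZ); rewrite !inE => /andP[yx /orP[yX'|yX]].
    have := fintype.subsetP sX' y yX'; rewrite !inE (negPf yx).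
    by [].
  by have /andP[_ ->] := sub1 y yX yx; rewrite orbT.
move=> L [l lL] hL sL.
have inK x : x \in L -> x = e \/ x \notin R.
  by move=> /(fintype.subsetP sL); rewrite !inE => /orP[/eqP|]; [left|right].
have pairL X f x : X \subset e |: (f |: R) -> x \in X -> x \in L ->
    x = e \/ x = f.
  move=> sX xX /inK[|xR]; first by left.
  have := fintype.subsetP sX x xX; rewrite !inE (negPf xR) orbF.
  by move=> /orP[/eqP|/eqP]; [left|right].
have eL : e \in L.
  apply: contraT => eL; have le : l != e by apply: contraNneq eL => <-.
  have lR : l \notin R by have [/eqP|//] := inK l lL; rewrite (negPf le).
  have [X [CX eX lX sX]] := pairX l le lR.
  have [f [fX fL fl]] := hL X l CX lX lL.
  by have [fe|//] := pairL X l f sX fX fL; rewrite -fe fL in eL.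
apply/eqP; rewrite finset.eqEsubset sL /=; apply: subset_of => f.
rewrite !inE; case: eqVneq => [->//|fe] /= fR.
have [X [CX eX fX sX]] := pairX f fe fR.
have [g [gX gL ge]] := hL X e CX eX eL.
by have [//|<-] := pairL X f g sX gX gL.
Qed.

(** Otherwise painting yields a cocircuit inside K that misses g, against the minimality of K. *)
Lemma cocircuit_circuit K e g : cocircuit Cs K -> e \in K -> g \in K ->
  e <> g -> exists X, [/\ Cs X, e \in X, g \in X & X \subset e |: (g |: ~: K)].
Proof.
move=> [K0 hK mK] eK gK eg.
have [[X [CX eX sX]]|[L [[L0 hL _] eL sL]]] := painting e (g |: ~: K).
  exists X; split=> //; have [f [fX fK fe]] := hK X e CX eX eK.
  have := fintype.subsetP sX f fX; rewrite !inE fK orbF.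
  by move=> /orP[/eqP//|/eqP <-].
have LK : L \subset K.
  apply: subset_of => x /(fintype.subsetP sL); rewrite !inE negb_or negbK.
  by move=> /orP[/eqP->//|/andP[]].
have := mK L L0 hL LK => LE; rewrite -LE in gK.
have := fintype.subsetP sL g gK; rewrite !inE eqxx orbF => /eqP ge.
by case: eg.
Qed.

(** Otherwise painting gives a circuit through f that meets the union of K and L at most in e and f.
    As it meets K in f, it contains e; then it meets L in e alone. *)
Lemma cocircuit_elim K L e f : cocircuit Cs K -> cocircuit Cs L ->
  e \in K -> e \in L -> f \in K -> f \notin L ->
  exists M : {set E}, [/\ cocircuit Cs M, f \in M & M \subset (K :|: L) :\ e].
Proof.
move=> [_ hK _] [_ hL _] eK eL fK fL.
have fe : f != e by apply: contraNneq fL => ->.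
have [[X [CX fX sX]]|[M [cM fM sM]]] := painting f (e |: ~: (K :|: L)).
  have sub x : x \in X -> x != f -> x != e -> (x \notin K) && (x \notin L).
    move=> /(fintype.subsetP sX); rewrite !inE negb_or.
    by move=> /or3P[->|->|//].
  have eX : e \in X.
    have [x [xX xK /eqP xf]] := hK X f CX fX fK.
    have [<-//|xe] := eqVneq x e.
    by have := sub x xX xf xe; rewrite xK.
  have [x [xX xL /eqP xe]] := hL X e CX eX eL.
  have xf : x != f by apply: contraNneq fL => <-.
  by have := sub x xX xf xe; rewrite xL andbF.
exists M; split=> //; apply: subset_of => x /(fintype.subsetP sM).
rewrite !inE negb_or negbK => /orP[/eqP->|/andP[->//]].
by rewrite fe fK.
Qed.

Lemma cocircuit_system : circuit_system (cocircuit Cs).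
Proof.
split.
- by move=> [[e]]; rewrite finset.in_set0.
- by move=> K L [K0 hK _] [_ _ mL]; exact: mL.
- move=> K L e cK cL KL eK eL.
  have [sKL|/not_subset[f fK fL]] := boolP (K \subset L).
    by case: KL; have [_ _ mL] := cL; have [K0 hK _] := cK; exact: mL.
  by have [M [cM _ sM]] := cocircuit_elim cK cL eK eL fK fL; exists M.
Qed.

Lemma indep_circuit_uniq I q X Y : indep Cs I -> Cs X -> Cs Y ->
  X \subset q |: I -> Y \subset q |: I -> X = Y.
Proof.
move=> iI CX CY sX sY; apply: contrapT => XY.
have inq Z : Cs Z -> Z \subset q |: I -> q \in Z.
  move=> CZ sZ; apply: contraT => qZ; have := iI Z CZ; apply: contraNT => _.
  apply: subset_of => x xZ; have := fintype.subsetP sZ x xZ; rewrite !inE.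
  by case: eqVneq => // xq; rewrite xq (negPf qZ) in xZ.
have [Z CZ sZ] := cs_elim CS CX CY XY (inq X CX sX) (inq Y CY sY).
have := iI Z CZ; apply/negP; rewrite negbK; apply: subset_of => x.
move=> /(fintype.subsetP sZ); rewrite !inE => /andP[xq /orP[xX|xY]].
  by have := fintype.subsetP sX x xX; rewrite !inE (negPf xq).
by have := fintype.subsetP sY x xY; rewrite !inE (negPf xq).
Qed.

(** Only one circuit avoids p, and a pair with smaller union, missing m, shows that it misses m.
    From a circuit through m, eliminating p against a circuit through p without m would give a
    circuit through m avoiding p; so no circuit inside the union of X and Y contains m. *)
Lemma nullity2_modular I p q X Y X' Y' : indep Cs I ->
  Cs X -> Cs Y -> Cs X' -> Cs Y' -> X' <> Y' ->
  X \subset p |: (q |: I) -> Y \subset p |: (q |: I) ->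
  ~~ (X' :|: Y' \proper X :|: Y).
Proof.
move=> iI CX CY CX' CY' XY' sX sY; apply/negP => /properP[s [m mXY]].
rewrite !inE negb_or => /andP[mX' mY'].
have sub x : x \in X :|: Y -> x != p -> x \in q |: I.
  rewrite !inE => /orP[xX|xY] /negPf xp.
    by have := fintype.subsetP sX x xX; rewrite !inE xp.
  by have := fintype.subsetP sY x xY; rewrite !inE xp.
have sX' : X' \subset X :|: Y by apply: fintype.subset_trans s; exact: finset.subsetUl.
have sY' : Y' \subset X :|: Y by apply: fintype.subset_trans s; exact: finset.subsetUr.
have nop Z : Z \subset X :|: Y -> p \notin Z -> Z \subset q |: I.
  move=> sZ pZ; apply: subset_of => x xZ; apply: sub.
    exact: (fintype.subsetP sZ).
  by apply: contraNneq pZ => <-.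
have delp Z W T : Z \subset X :|: Y -> W \subset X :|: Y ->
    T \subset (Z :|: W) :\ p -> T \subset q |: I.
  move=> sZ sW sT; apply: nop.
    apply: subset_of => x /(fintype.subsetP sT); rewrite finset.in_setD1 finset.in_setU.
    by move=> /andP[_ /orP[]]; [move: x; exact/fintype.subsetP|move: x; exact/fintype.subsetP].
  by apply/negP => /(fintype.subsetP sT); rewrite !inE eqxx.
have [Z' [CZ' mZ' sZ']] : exists Z', [/\ Cs Z', m \notin Z' & Z' \subset q |: I].
  have [pX'|pX'] := boolP (p \in X'); last by exists X'; split=> //; exact: nop.
  have [pY'|pY'] := boolP (p \in Y'); last by exists Y'; split=> //; exact: nop.
  have [Z CZ sZ] := cs_elim CS CX' CY' XY' pX' pY'.
  exists Z; split=> //; last exact: delp sZ.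
  apply/negP => /(fintype.subsetP sZ).
  by rewrite !inE (negPf mX') (negPf mY') andbF.
have [W [CW pW mW sW]] : exists W, [/\ Cs W, p \in W, m \notin W & W \subset X :|: Y].
  have [pX'|pX'] := boolP (p \in X'); first by exists X'.
  have [pY'|pY'] := boolP (p \in Y'); first by exists Y'.
  by case: XY'; apply: (indep_circuit_uniq (q := q) iI) => //; exact: nop.
have mE T : Cs T -> T \subset X :|: Y -> m \notin T.
  move=> CT sT; apply/negP => mT.
  have [Z [CZ mZ sZ]] : exists Z, [/\ Cs Z, m \in Z & Z \subset q |: I].
    have [pT|pT] := boolP (p \in T); last by exists T; split=> //; exact: nop.
    have [Z [CZ mZ sZ]] := strong_elim CT CW pT pW mT mW.
    by exists Z; split=> //; exact: delp sZ.
  by move: mZ'; rewrite -(indep_circuit_uniq iI CZ CZ' sZ sZ') mZ.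
move: mXY; rewrite inE (negPf (mE X CX (finset.subsetUl _ _))).
by rewrite (negPf (mE Y CY (finset.subsetUr _ _))).
Qed.

Lemma indep_extend A F : indep Cs A -> A \subset F ->
  exists B, [/\ A \subset B, B \subset F, indep Cs B &
    forall f, f \in F -> f \notin B ->
      exists X, [/\ Cs X, f \in X & X \subset f |: B]].
Proof.
move=> iA sAF; pose P B := (B \subset F) && `[< indep Cs B >].
have PA : P A by rewrite /P sAF; apply/asboolP.
have [B /maxsetP[/andP[sBF /asboolP iB] mB] sAB] := maxset_exists PA.
exists B; split=> // f fF fB.
apply: contrapT => nX; have : f |: B = B.
  apply: mB; last exact: finset.subsetUr.
  rewrite /P finset.subUset finset.sub1set fF sBF; apply/asboolP => X CX; apply/negP => sX.
  have := iB X CX; apply/negP; rewrite negbK; apply: subset_of => x xX.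
  have := fintype.subsetP sX x xX; rewrite !inE => /orP[/eqP xf|//].
  by case: nX; exists X; rewrite -xf; split=> //; rewrite xf.
by move=> e; move: fB; rewrite -e !inE eqxx.
Qed.

Lemma maxset_indepP (Ds : {set E} -> Prop) B :
  reflect (indep Ds B /\ forall f, f \notin B ->
             exists X, [/\ Ds X, f \in X & X \subset f |: B])
    (maxset (fun I : {set E} => `[< indep Ds I >]) B).
Proof.
apply: (iffP maxsetP) => [[/asboolP iB mB]|[iB mB]].
  split=> // f fB; apply: contrapT => nX; have : f |: B = B.
    apply: mB; last exact: finset.subsetUr.
    apply/asboolP => X CX; apply/negP => sX.
    have := iB X CX; apply/negP; rewrite negbK; apply: subset_of => x xX.
    have := fintype.subsetP sX x xX; rewrite !inE => /orP[/eqP xf|//].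
    by case: nX; exists X; rewrite -xf; split=> //; rewrite xf.
  by move=> e; move: fB; rewrite -e !inE eqxx.
split; first exact/asboolP.
move=> A /asboolP iA sBA; apply/eqP; rewrite finset.eqEsubset sBA andbT.
apply: contraT => /not_subset[f fA /mB[X [CX _ sX]]].
have := iA X CX; apply: contraNT => _; apply: fintype.subset_trans sX _.
by rewrite finset.subUset finset.sub1set fA.
Qed.

Lemma dual_basis B :
  maxset (fun I : {set E} => `[< indep (cocircuit Cs) I >]) (~: B) =
  maxset (fun I : {set E} => `[< indep Cs I >]) B.
Proof.
apply/maxset_indepP/maxset_indepP => -[iB mB]; split.
- move=> X CX; apply/negP => sX.
  have [e eX] : exists e, e \in X.
    apply/set0Pn; apply/eqP => X0; apply: (cs_neq0 CS); by rewrite -X0.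
  have eB := fintype.subsetP sX e eX.
  have [|K [[_ hK _] eK sK]] := mB e; first by rewrite inE negbK.
  have [f [fX fK fe]] := hK X e CX eX eK.
  have := fintype.subsetP sK f fK; rewrite !inE (fintype.subsetP sX f fX) orbF.
  by move=> /eqP.
- move=> f fB; have [//|[K [cK _ sK]]] := painting f B.
  have := iB K cK; apply: contraNP => _; apply: fintype.subset_trans sK _.
  by apply: subset_of => x; rewrite !inE => /orP[/eqP->|].
- move=> K [[e eK] hK _]; apply/negP => sK.
  have eB : e \notin B by have := fintype.subsetP sK e eK; rewrite inE.
  have [X [CX eX sX]] := mB e eB.
  have [f [fX fK fe]] := hK X e CX eX eK.
  have := fintype.subsetP sK f fK; have := fintype.subsetP sX f fX.
  by rewrite !inE => /orP[/eqP|->].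
- move=> f; rewrite inE negbK => fB.
  have [[X [CX _ sX]]|[K [cK fK sK]]] := painting f (B :\ f).
    have := iB X CX; rewrite (fintype.subset_trans sX)//.
    by rewrite finset.setD1K.
  exists K; split=> //; apply: fintype.subset_trans sK _.
  apply: subset_of => x; rewrite !inE negb_and negbK.
  by case: eqVneq.
Qed.

End SetMatroid.

(** * The dual of a matroid over a hyperfield *)

Section Perp.
Variables (H : skewHyperfieldType) (E : finType).
Implicit Types (X Y Z : {ffun E -> H}) (S : {set E}).

Lemma hsumE (s : seq H) : hsum s = \big[@hplus H/[set 0]]_(a <- s) [set a].
Proof.
elim: s => [|a s IH]; first by rewrite big_nil.
rewrite big_cons -IH; apply/seteqP; split=> z.
  by move=> [t st at_]; exists a, t.
by move=> [_ [t [-> st at_]]]; exists t.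
Qed.

Lemma orthogonalE X Y : orthogonal X Y <-> perp [set: E]%SET X Y.
Proof.
rewrite /orthogonal /perp hsumE big_map -big_enum /=.
suff -> : enum [set: E]%SET = enum E by [].
by apply: eq_enum => x; rewrite inE.
Qed.

Lemma perp_support S X Y : (forall e, e \notin S -> X e = 0 \/ Y e = 0) ->
  perp [set: E]%SET X Y <-> perp S X Y.
Proof.
move=> h; rewrite /perp.
suff -> : \hsum_(e in [set: E]%SET) [set X e * Y e] =
          \hsum_(e in S) [set X e * Y e] by [].
rewrite (bigID (mem S)) /= [X in hplus _ X]big1 ?[hplus _ [set 0]]hplusC ?hplus0.
  by apply: eq_bigl => e; rewrite inE.
by move=> e /andP[_ /h[->|->]]; rewrite ?hmul0x ?hmulx0.
Qed.

Lemma perp2 X Y e g : e <> g ->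
  (forall x, x <> e -> x <> g -> X x = 0 \/ Y x = 0) ->
  perp [set: E]%SET X Y <-> X e * Y e = - (X g * Y g).
Proof.
move=> /eqP eg h; rewrite (@perp_support [set e; g]%SET); last first.
  by move=> x; rewrite !inE negb_or => /andP[/eqP xe /eqP xg]; exact: h.
rewrite /perp big_setU1 ?inE//= big_set1 hplus11.
split=> [/hadd_eq0//|->].
by rewrite haddC; exact: haddxN.
Qed.

Lemma perp3 X Y e f g : e <> f -> e <> g -> f <> g ->
  (forall x, x <> e -> x <> f -> x <> g -> X x = 0 \/ Y x = 0) ->
  perp [set: E]%SET X Y <-> (X g * Y g [+] X f * Y f) (- (X e * Y e)).
Proof.
move=> /eqP ef /eqP eg /eqP fg h.
rewrite (@perp_support [set e; f; g]%SET); last first.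
  move=> x; rewrite !inE !negb_or -andbA => /and3P[/eqP xe /eqP xf /eqP xg].
  exact: h.
rewrite /perp -finset.setUA big_setU1 ?inE ?negb_or ?ef//=.
rewrite big_setU1 ?inE//= big_set1 hplus11 haddC.
rewrite hplus_has0; split; first by move=> [_ ->].
by exists (X e * Y e).
Qed.

Lemma vsupp_lscale a X : a <> 0 -> vsupp (lscale a X) = vsupp X.
Proof.
move=> a0; apply/finset.setP => e; rewrite !in_vsupp lscaleE.
congr negb; apply/eqP/eqP => [|->]; last exact: hmulx0.
by apply: contraPP => Xe; exact: hmul_neq0.
Qed.

Lemma vsupp_rscale a X : a <> 0 -> vsupp (rscale a X) = vsupp X.
Proof.
move=> a0; apply/finset.setP => e; rewrite !in_vsupp rscaleE.
congr negb; apply/eqP/eqP => [|->]; last exact: hmul0x.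
by apply: contraPP => Xe; exact: hmul_neq0.
Qed.

Lemma vsuppP X e : reflect (X e <> 0) (e \in vsupp X).
Proof. by rewrite in_vsupp; apply: (iffP negP) => h /eqP. Qed.

Lemma vsuppPn X e : reflect (X e = 0) (e \notin vsupp X).
Proof. by rewrite in_vsupp negbK; exact: eqP. Qed.

Lemma vsupp_vadd X Y Z : vadd X Y Z -> vsupp Z \subset vsupp X :|: vsupp Y.
Proof.
move=> h; apply: subset_of => e; apply: contraTT.
rewrite inE negb_or => /andP[/vsuppPn Xe /vsuppPn Ye]; apply/vsuppPn.
by have := h e; rewrite Xe Ye haddx0.
Qed.

End Perp.

(** * The underlying matroid of supports *)

Section CircuitSupports.
Variables (H : skewHyperfieldType) (E : finType) (C : set {ffun E -> H}).
Implicit Types (X Y Z W : {ffun E -> H}) (I K L : {set E}) (e f g h : E).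

Definition circuit_supports (B : set {ffun E -> H}) : {set E} -> Prop :=
  fun K => exists2 X, B X & vsupp X = K.

Lemma modular_pair_supports X Y X' Y' : vsupp X = vsupp X' ->
  vsupp Y = vsupp Y' -> modular_pair C X Y -> modular_pair C X' Y'.
Proof. by rewrite /modular_pair => -> ->. Qed.

Variable scale : H -> {ffun E -> H} -> {ffun E -> H}.
Hypothesis vsupp_scale : forall a X, a <> 0 -> vsupp (scale a X) = vsupp X.
Hypothesis scale_to : forall X e y, X e <> 0 -> y <> 0 ->
  exists2 a, a <> 0 & scale a X e = y.

(** Elimination is postulated for modular pairs only. A pair that is not modular contains in its
    union a pair with smaller union: either a member of it avoids e, or induction applies. The
    abstract [scale] covers left and right matroids. *)
Lemma circuit_system_of : circuit_axioms scale C ->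
  circuit_system (circuit_supports C).
Proof.
move=> CM; split.
- move=> [X CX X0]; apply: (circuit0 CM).
  suff <- : X = vzero H E by [].
  apply/ffunP => e; rewrite ffunE; apply/vsuppPn.
  by rewrite X0 finset.in_set0.
- move=> _ _ [X CX <-] [Y CY <-] sXY.
  have [a a0 ->] := circuit_incomp CM CX CY sXY.
  by rewrite vsupp_scale.
- move=> _ _ e [X CX <-] [Y CY <-].
  have [n] := ubnP #|vsupp X :|: vsupp Y|; elim: n X Y CX CY => // n IH X Y CX CY.
  rewrite ltnS => cXY XY eX eY.
  have [mXY|nmXY] := pselect (modular_pair C X Y).
    have Xe := vsuppP _ _ eX; have Ye := vsuppP _ _ eY.
    have [a a0 aXe] := scale_to Xe (hopp_neq0 Ye).
    have aXe0 : scale a X e <> 0 by rewrite aXe; exact: hopp_neq0.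
    have maXY := modular_pair_supports (esym (vsupp_scale X a0)) erefl mXY.
    have [Z [CZ Ze XYZ]] := circuit_elim CM (circuitZ CM a0 CX) CY maXY aXe aXe0.
    exists (vsupp Z); first by exists Z.
    apply: subset_of => x xZ; rewrite finset.in_setD1.
    have := fintype.subsetP (vsupp_vadd XYZ) x xZ.
    rewrite vsupp_scale// => ->; rewrite andbT.
    by apply: contraTneq xZ => ->; apply/vsuppPn.
  have [X' [Y' [CX' CY' XY' sXY']]] : exists X' Y', [/\ C X', C Y',
      vsupp X' <> vsupp Y' & vsupp X' :|: vsupp Y' \proper vsupp X :|: vsupp Y].
    apply: contrapT => h; apply: nmXY; split=> // X' Y' CX' CY' XY'.
    by apply/negP => s; apply: h; exists X', Y'.
  have sub x : x \in vsupp X' :|: vsupp Y' -> x \in vsupp X :|: vsupp Y.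
    by apply/fintype.subsetP; exact: proper_sub.
  have [eX'|eX'] := boolP (e \in vsupp X'); last first.
    exists (vsupp X'); first by exists X'.
    apply: subset_of => x xX'; rewrite finset.in_setD1; apply/andP; split; last first.
      by apply: sub; rewrite inE xX'.
    by apply: contraNneq eX' => <-.
  have [eY'|eY'] := boolP (e \in vsupp Y'); last first.
    exists (vsupp Y'); first by exists Y'.
    apply: subset_of => x xX'; rewrite finset.in_setD1; apply/andP; split; last first.
      by apply: sub; rewrite inE xX' orbT.
    by apply: contraNneq eY' => <-.
  have [|Z CZ sZ] := IH X' Y' CX' CY' _ XY' eX' eY'.
    exact: leq_trans (proper_card sXY') cXY.
  exists Z => //; apply: fintype.subset_trans sZ _; apply: finset.setSD.
  exact: proper_sub.
Qed.
End CircuitSupports.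

(** * Ratios of circuit entries on a cocircuit *)

Section Dual.
Variables (H : skewHyperfieldType) (E : finType) (C : set {ffun E -> H}).
Hypothesis CM : left_matroid C.
Implicit Types (X Y Z W : {ffun E -> H}) (I K L : {set E}) (e f g h : E).
Notation Cs := (circuit_supports C).

Lemma circuit_system_supports : circuit_system Cs.
Proof.
apply: circuit_system_of CM => [a X|X e y Xe y0]; first exact: vsupp_lscale.
exists (y * hinv (X e)); last by rewrite lscaleE hmulKVr.
by apply: hmul_neq0 => //; exact: hinv_neq0.
Qed.
Let CS := circuit_system_supports.

Lemma modular_in_nullity2 I p q X Y : indep Cs I -> C X -> C Y ->
  vsupp X <> vsupp Y -> vsupp X \subset p |: (q |: I) ->
  vsupp Y \subset p |: (q |: I) -> modular_pair C X Y.
Proof.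
move=> iI CX CY XY sX sY; split=> // X' Y' CX' CY' XY'.
apply: (nullity2_modular CS iI) sX sY => //; by [exists X|exists Y|exists X'|exists Y'].
Qed.

Lemma circuit_hits K X e : hits Cs K -> C X -> X e <> 0 -> e \in K ->
  exists f, [/\ X f <> 0, f \in K & f <> e].
Proof.
move=> hK CX /vsuppP eX eK; have [|f [/vsuppP]] := hK (vsupp X) e _ eX eK.
  by exists X.
by exists f.
Qed.

Lemma indep_hyperplane K I e : hits Cs K -> indep Cs I -> I \subset ~: K ->
  e \in K -> indep Cs (e |: I).
Proof.
move=> hK iI sIK eK T CT; apply/negP => sT.
have [eT|eT] := boolP (e \in T).
  have [f [fT fK fe]] := hK T e CT eT eK.
  have := fintype.subsetP sT f fT; rewrite !inE => /orP[/eqP//|].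
  by move=> /(fintype.subsetP sIK); rewrite inE fK.
have := iI T CT; apply/negP; rewrite negbK; apply: subset_of => x xT.
have := fintype.subsetP sT x xT; rewrite !inE => /orP[/eqP xe|//].
by rewrite -xe xT in eT.
Qed.

Lemma eliminate_scaled X Y e : C X -> C Y -> modular_pair C X Y ->
  X e = Y e -> X e <> 0 -> exists Z, [/\ C Z, Z e = 0 &
    forall x, (X x [+] (- Y x)) (Z x)].
Proof.
move=> CX CY mXY XYe Xe.
have m1 : (- 1 : H) <> 0 by apply: hopp_neq0; exact: hone_neq0.
have NYE x : lscale (- 1) Y x = - Y x by rewrite lscaleE hmulNx hmul1x.
have mXNY := modular_pair_supports erefl (esym (vsupp_lscale Y m1)) mXY.
have [|Z [CZ Ze XYZ]] := circuit_elim CM CX (circuitZ CM m1 CY) mXNY _ Xe.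
  by rewrite NYE hoppK.
by exists Z; split=> // x; rewrite -NYE; exact: XYZ.
Qed.

(** Both circuits lie in a set of nullity 2 and so form a modular pair. Eliminating g leaves a
    circuit that meets K at most in e, hence not at all, so the entries at e cancel. *)
Lemma ratio_adjacent K I e g h X X1 : hits Cs K -> indep Cs I ->
  I \subset ~: K -> h \notin K -> e \in K -> e <> g -> C X -> C X1 ->
  vsupp X \subset g |: (h |: (e |: I)) -> vsupp X1 \subset g |: (h |: (e |: I)) ->
  X g = X1 g -> X g <> 0 -> X e = X1 e.
Proof.
move=> hK iI sIK hnK eK eg CX CX1 sX sX1 Xg Xg0.
have [XX1|XX1] := pselect (vsupp X = vsupp X1).
  have [|a a0 eX1] := circuit_incomp CM CX CX1; first by rewrite XX1.
  have a1 : a = 1.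
    by apply: (hmulIr Xg0); rewrite hmul1x -lscaleE -eX1.
  by rewrite eX1 a1 lscaleE hmul1x.
have m := modular_in_nullity2 (indep_hyperplane hK iI sIK eK) CX CX1 XX1 sX sX1.
have [Z [CZ Zg XZ]] := eliminate_scaled CX CX1 m Xg Xg0.
have sub Y x : vsupp Y \subset g |: (h |: (e |: I)) -> x \in K -> x <> e ->
    x <> g -> Y x = 0.
  move=> sY xK /eqP/negPf xe /eqP/negPf xg; apply/vsuppPn.
  apply/negP => /(fintype.subsetP sY); rewrite !inE xg xe /= => /orP[/eqP xh|].
    by rewrite -xh xK in hnK.
  by move=> /(fintype.subsetP sIK); rewrite inE xK.
have Ze : Z e = 0.
  apply: contrapT => Ze; have [f [Zf fK fe]] := circuit_hits hK CZ Ze eK.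
  have fg : f <> g by move=> fg; apply: Zf; rewrite fg.
  by have := XZ f; rewrite (sub X)// (sub X1)// hopp0 haddx0.
by have := XZ e; rewrite Ze => /hadd_eq0; rewrite hoppK.
Qed.

(** The ratio of the entries at e and g is the same for all circuits meeting K in these two points:
    the set I is moved towards the support of [X'] one exchange at a time, and each exchange is an
    instance of [ratio_adjacent]. *)
Lemma ratio_unique K I e g X X' : hits Cs K -> indep Cs I -> I \subset ~: K ->
  e \in K -> g \in K -> e <> g -> C X -> C X' -> X e <> 0 -> X' e <> 0 ->
  vsupp X \subset e |: (g |: I) -> vsupp X' \subset e |: (g |: ~: K) ->
  X g = X' g -> X e = X' e.
Proof.
move=> hK; have [n] := ubnP #|vsupp X' :\: (e |: (g |: I))|.
elim: n X I => // n IH X I; rewrite ltnS => cn iI sIK eK gK eg CX CX' Xe X'e sX sX' Xg.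
have Xg0 : X g <> 0.
  have [f [/vsuppP fX fK fe]] := circuit_hits hK CX Xe eK.
  have := fintype.subsetP sX f fX; rewrite !inE => /or3P[/eqP//|/eqP <-|].
    exact/vsuppP.
  by move=> /(fintype.subsetP sIK); rewrite inE fK.
have [sX'I|/not_subset[h' h'X']] := boolP (vsupp X' \subset e |: (g |: I)).
  have XX' : vsupp X = vsupp X'.
    apply: (indep_circuit_uniq (q := g) CS (indep_hyperplane hK iI sIK eK)).
    - by exists X.
    - by exists X'.
    - by rewrite finset.setUCA.
    - by rewrite finset.setUCA.
  have [|a a0 eX1] := circuit_incomp CM CX CX'; first by rewrite XX'.
  have a1 : a = 1.
    by apply: (hmulIr Xg0); rewrite hmul1x -lscaleE -eX1.
  by rewrite eX1 a1 lscaleE hmul1x.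
rewrite !inE !negb_or => /and3P[h'e h'g h'I].
have h'X'0 : X' h' != 0 by rewrite -in_vsupp.
have h'K : h' \notin K.
  by have := fintype.subsetP sX' h' h'X'; rewrite !inE (negPf h'e) (negPf h'g).
have sh'I : h' |: I \subset ~: K.
  by rewrite finset.subUset finset.sub1set inE h'K.
have [ih'I|dh'I] := pselect (indep Cs (h' |: I)).
  apply: (IH X (h' |: I)) => //.
    apply: leq_trans cn; apply: proper_card; apply/properP; split.
      apply: subset_of => x; rewrite !inE !negb_or.
      by move=> /andP[/and4P[-> -> _ ->] ->].
    by exists h'; rewrite !inE ?eqxx ?orbT// !negb_or h'e h'g h'I h'X'0.
  apply: fintype.subset_trans sX _; apply: subset_of => x; rewrite !inE.
  by move=> /or3P[->|->|->]; rewrite ?orbT.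
have [T [CT sT]] : exists T, Cs T /\ T \subset h' |: I.
  apply: contrapT => nT; apply: dh'I => T CT; apply/negP => sT.
  by apply: nT; exists T.
have [h hT hX'] : exists2 h, h \in T & h \notin vsupp X'.
  apply: not_subset; apply/negP => sTX'.
  have CsX' : Cs (vsupp X') by exists X'.
  have TX' := cs_incomp CS CT CsX' sTX'.
  have : e \in T by rewrite TX'; exact/vsuppP.
  by move=> /(fintype.subsetP sT)/(fintype.subsetP sh'I); rewrite inE eK.
have hh' : h != h' by apply: contraNneq hX' => ->.
have hI : h \in I by have := fintype.subsetP sT h hT; rewrite !inE (negPf hh').
have hK' : h \notin K by have := fintype.subsetP sIK h hI; rewrite inE.
(* The element [h'] of [X'] replaces an element h of the circuit T in [h' |: I] that [X'] does not
   contain; such an h exists, as otherwise T would equal the support of [X'], which contains e. *)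
pose I1 := h' |: (I :\ h).
have sI1 : I1 \subset h' |: I.
  by apply: subset_of => x; rewrite !inE => /orP[->//|/andP[_ ->]]; rewrite orbT.
have iI1 : indep Cs I1.
  move=> T' CT'; apply/negP => sT'.
  have TT' := indep_circuit_uniq CS iI CT CT' sT (fintype.subset_trans sT' sI1).
  have := fintype.subsetP sT' h; rewrite -TT' => /(_ hT).
  by rewrite !inE (negPf hh') eqxx.
have sI1K : I1 \subset ~: K by exact: fintype.subset_trans sI1 sh'I.
have [X1 [CX1 X1e sX1 X1g]] : exists X1, [/\ C X1, X1 e <> 0,
    vsupp X1 \subset e |: (g |: I1) & X1 g = X g].
  have [hX|hX] := boolP (h \in vsupp X); last first.
    exists X; split=> //; apply: subset_of => x xX.
    have := fintype.subsetP sX x xX; rewrite !inE.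
    case: (eqVneq x h) => [xh|_]; first by rewrite -xh xX in hX.
    by move=> /or3P[->|->|->]; rewrite ?orbT.
  have eT : e \notin T.
    apply/negP => /(fintype.subsetP sT)/(fintype.subsetP sh'I).
    by rewrite inE eK.
  have CsX : Cs (vsupp X) by exists X.
  have [_ [[X1 CX1 <-] eX1 sX1]] :=
    strong_elim CS CsX CT hX hT (introT (vsuppP _ _) Xe) eT.
  have sX1' : vsupp X1 \subset e |: (g |: I1).
    apply: fintype.subset_trans sX1 _; apply: subset_of => x; rewrite !inE.
    move=> /andP[xh /orP[xX|xT]].
      have := fintype.subsetP sX x; rewrite !inE xh => /(_ xX).
      by move=> /or3P[->|->|->]; rewrite ?orbT.
    have := fintype.subsetP sT x xT; rewrite !inE xh.
    by move=> /orP[->|->]; rewrite ?orbT.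
  have X1e := vsuppP _ _ eX1.
  have X1g0 : X1 g <> 0.
    have [f [/vsuppP fX fK fe]] := circuit_hits hK CX1 X1e eK.
    have := fintype.subsetP sX1' f fX; rewrite !inE.
    move=> /or3P[/eqP//|/eqP <-|fI1]; first exact/vsuppP.
    have := fintype.subsetP sI1K f; rewrite !inE fK.
    by move=> /(_ fI1).
  pose a := X g * hinv (X1 g).
  have a0 : a <> 0 by apply: hmul_neq0 => //; exact: hinv_neq0.
  exists (lscale a X1); split.
  - exact: (circuitZ CM).
  - by rewrite lscaleE; exact: hmul_neq0.
  - by rewrite vsupp_lscale.
  - by rewrite lscaleE hmulKVr.
have -> : X e = X1 e.
  apply: (ratio_adjacent hK iI sIK h'K eK eg CX CX1) => //.
    apply: fintype.subset_trans sX _; apply: subset_of => x; rewrite !inE.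
    by move=> /or3P[->|->|->]; rewrite ?orbT.
  apply: fintype.subset_trans sX1 _; apply: subset_of => x; rewrite !inE.
  by move=> /or4P[->|->|->|/andP[_ ->]]; rewrite ?orbT.
apply: (IH X1 I1) => //; last by rewrite X1g.
apply: leq_trans cn; apply: proper_card; apply/properP; split.
  apply: subset_of => x; rewrite !inE !negb_or negb_and negbK.
  move=> /andP[/and4P[-> -> _ xI] xX']; rewrite xX' andbT /=.
  by case/orP: xI => // /eqP xh; rewrite -xh in_vsupp xX' in hX'.
by exists h'; rewrite !inE ?eqxx ?orbT// !negb_or h'e h'g h'I h'X'0.
Qed.

End Dual.

(** * Vectors supported on cocircuits *)

Section CocircuitVectors.
Variables (H : skewHyperfieldType) (E : finType) (C : set {ffun E -> H}).
Hypothesis CM : left_matroid C.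
Implicit Types (X Y Z W : {ffun E -> H}) (A I K L T : {set E}) (e f g h : E).
Notation Cs := (circuit_supports C).
Let CS := circuit_system_supports CM.

Definition spans_hyperplane K I : Prop := forall f, f \in ~: K -> f \notin I ->
  exists T : {set E}, [/\ Cs T, f \in T & T \subset f |: I].

(** A point h of L outside K would lie on a circuit inside [h |: I], which meets L in h only. *)
Lemma cocircuit_avoiding_basis K L I : cocircuit Cs K -> cocircuit Cs L ->
  spans_hyperplane K I -> (forall x, x \in I -> x \notin L) -> L = K.
Proof.
move=> [_ _ mK] [L0 hL _] spI LI; apply: mK => //.
apply: subset_of => h hL'; apply: contraT => hK'.
have [||T [CT hT sT]] := spI h; first by rewrite inE.
  by apply/negP => /LI; rewrite hL'.
have [t [tT tL /eqP/negPf th]] := hL T h CT hT hL'.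
have := fintype.subsetP sT t tT; rewrite finset.in_setU1 th /= => /LI.
by rewrite tL.
Qed.

Lemma fundamental_circuit K I f g : cocircuit Cs K -> I \subset ~: K ->
  spans_hyperplane K I -> f \in K -> g \in K -> f <> g ->
  exists X, [/\ C X, X f <> 0, X g <> 0 & vsupp X \subset f |: (g |: I)].
Proof.
move=> cK sIK spI fK gK fg; have [_ hK _] := cK.
have [[_ [[X CX <-] fX sX]]|[L [cL fL sL]]] := painting CS f (g |: I).
  exists X; split=> //; first exact/vsuppP.
  have [h [/vsuppP hX hK' hf]] := circuit_hits hK CX (vsuppP _ _ fX) fK.
  have := fintype.subsetP sX h hX; rewrite !inE => /or3P[/eqP//|/eqP <-|].
    exact/vsuppP.
  by move=> /(fintype.subsetP sIK); rewrite inE hK'.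
have LK : L = K.
  apply: cocircuit_avoiding_basis cK cL spI _ => x xI; apply/negP.
  move=> /(fintype.subsetP sL); rewrite !inE xI orbT orbF => /eqP xf.
  by have := fintype.subsetP sIK x xI; rewrite inE xf fK.
rewrite -LK in gK; have := fintype.subsetP sL g gK.
by rewrite !inE eqxx orbF => /eqP gf; case: fg.
Qed.

Lemma vsupp_pair K X e g : (forall x, x \in K -> x <> e -> x <> g -> X x = 0) ->
  vsupp X \subset e |: (g |: ~: K).
Proof.
move=> h; apply: subset_of => x /vsuppP Xx; rewrite !in_setU1 inE.
case: eqVneq => //= /eqP xe; case: eqVneq => //= /eqP xg.
by apply/negP => xK; apply: Xx; exact: h.
Qed.

Lemma vsupp_pairP K I X e g x : vsupp X \subset e |: (g |: I) ->
  I \subset ~: K -> x \in K -> x <> e -> x <> g -> X x = 0.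
Proof.
move=> sX sI xK /eqP/negPf xe /eqP/negPf xg; apply/vsuppPn/negP.
move=> /(fintype.subsetP sX); rewrite !in_setU1 xe xg /=.
by move=> /(fintype.subsetP sI); rewrite inE xK.
Qed.

Definition ratio_at K g Y : Prop := forall X e, C X -> e \in K -> e <> g ->
  X e <> 0 -> (forall x, x \in K -> x <> e -> x <> g -> X x = 0) ->
  X e * Y e = - (X g * Y g).

Lemma other_circuit_entry K X e g : cocircuit Cs K -> C X -> e \in K ->
  X e <> 0 -> (forall x, x \in K -> x <> e -> x <> g -> X x = 0) -> X g <> 0.
Proof.
move=> [_ hK _] CX eK Xe h.
have [f [Xf fK fe]] := circuit_hits hK CX Xe eK.
by have [<-//|fg] := pselect (f = g); case: Xf; exact: h.
Qed.

Lemma hyperplane_basis K A : cocircuit Cs K -> indep Cs A -> A \subset ~: K ->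
  exists I, [/\ A \subset I, I \subset ~: K, indep Cs I & spans_hyperplane K I].
Proof.
by move=> cK iA sA; have [I [? ? ? ?]] := indep_extend iA sA; exists I.
Qed.

Lemma circuit_proper_indep X A e : C X -> X e <> 0 -> A \subset vsupp X ->
  e \notin A -> indep Cs A.
Proof.
move=> CX Xe sA eA _ [T CT <-]; apply/negP => sT.
have := cs_incomp CS (ex_intro2 _ _ T CT erefl) (ex_intro2 _ _ X CX erefl).
move=> /(_ (fintype.subset_trans sT sA)) TX; move: eA.
by rewrite (fintype.subsetP sT)// TX; exact/vsuppP.
Qed.

Lemma ratio_exists K g e : cocircuit Cs K -> e \in K -> g \in K -> e <> g ->
  exists2 y, y <> 0 & forall X, C X -> X e <> 0 ->
    (forall x, x \in K -> x <> e -> x <> g -> X x = 0) -> X e * y = - X g.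
Proof.
move=> cK eK gK eg; have [_ hK _] := cK.
have i0 : indep Cs finset.set0.
  move=> T CT; rewrite finset.subset0; apply/eqP => T0; apply: (cs_neq0 CS).
  by rewrite -T0.
have [I [_ sI iI spI]] := hyperplane_basis cK i0 (finset.sub0set _).
have [X0 [CX0 X0e X0g sX0]] := fundamental_circuit cK sI spI eK gK eg.
(* Solved from [X0 e * y = - X0 g]; any other X is compared with the multiple of [X0] having the
   same entry at g. *)
exists (- (hinv (X0 e) * X0 g)).
  by apply: hopp_neq0; apply: hmul_neq0 => //; exact: hinv_neq0.
move=> X CX Xe hX; have Xg := other_circuit_entry cK CX eK Xe hX.
pose a := X g * hinv (X0 g).
have a0 : a <> 0 by apply: hmul_neq0 => //; exact: hinv_neq0.
have -> : X e = lscale a X0 e.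
  symmetry; apply: (ratio_unique CM hK iI sI eK gK eg (circuitZ CM a0 CX0) CX).
  - by rewrite lscaleE; exact: hmul_neq0.
  - by [].
  - by rewrite vsupp_lscale.
  - exact: vsupp_pair.
  - by rewrite lscaleE /a hmulKVr.
by rewrite lscaleE hmulxN -hmulA hmulKV// /a hmulKVr.
Qed.

Lemma ratio_vector K g : cocircuit Cs K -> g \in K ->
  exists2 Y, vsupp Y = K & ratio_at K g Y.
Proof.
move=> cK gK.
pose good e := [set y | y <> 0 /\ forall X, C X -> X e <> 0 ->
    (forall x, x \in K -> x <> e -> x <> g -> X x = 0) -> X e * y = - X g].
have goodP e : e \in K -> e <> g -> good e (xget 0 (good e)).
  move=> eK eg; apply: xgetPex.
  by have [y ? ?] := ratio_exists cK eK gK eg; exists y.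
pose Y := [ffun e => if e == g then 1 else if e \in K then xget 0 (good e) else 0].
exists Y.
  apply/finset.setP => e; rewrite in_vsupp ffunE.
  case: (eqVneq e g) => [->|/eqP eg].
    by rewrite gK; apply/eqP; exact: hone_neq0.
  case: ifPn => [eK|_]; last by rewrite eqxx.
  by apply/eqP; have [] := goodP e eK eg.
move=> X e CX eK eg Xe hX; rewrite !ffunE eqxx hmulx1.
rewrite (introF eqP eg) eK.
by have [_] := goodP e eK eg; apply.
Qed.

(* Eliminating f against a circuit through f and g reduces the relation on
   {e, f, g} to the one on {e, g}. *)
Lemma ratio_three K g Y X e f : cocircuit Cs K -> ratio_at K g Y -> C X ->
  e \in K -> f \in K -> g \in K -> e <> f -> e <> g -> f <> g ->
  X e <> 0 -> X f <> 0 ->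
  (forall x, x \in K -> x <> e -> x <> f -> x <> g -> X x = 0) ->
  (X g * Y g [+] X f * Y f) (- (X e * Y e)).
Proof.
move=> cK rY CX eK fK gK ef eg fg Xe Xf hX; have [_ hK _] := cK.
(* A basis containing the part of X outside K puts X and the circuit through f and g into a common
   set of nullity 2, so that they form a modular pair. *)
have [||I [sAI sI iI spI]] := @hyperplane_basis K (vsupp X :\: K) cK.
- apply: (circuit_proper_indep CX Xe); first exact: finset.subsetDl.
  by rewrite inE eK.
- by apply: subset_of => x; rewrite !inE => /andP[].
have [X0 [CX0 X0f X0g sX0]] := fundamental_circuit cK sI spI fK gK fg.
pose a := X f * hinv (X0 f).
have a0 : a <> 0 by apply: hmul_neq0 => //; exact: hinv_neq0.
pose X1 := lscale a X0; have CX1 : C X1 by exact: (circuitZ CM).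
have sX1 : vsupp X1 \subset f |: (g |: I) by rewrite vsupp_lscale.
have X1f : X f = X1 f by rewrite lscaleE hmulKVr.
have X1e : X1 e = 0 by exact: (vsupp_pairP sX1 sI eK ef eg).
have XX1 : vsupp X <> vsupp X1.
  by move=> s; have : e \in vsupp X1 by [rewrite -s; exact/vsuppP|]; move=> /vsuppP.
have m : modular_pair C X X1.
  apply: (modular_in_nullity2 CM (I := e |: I) (p := f) (q := g)) => //.
  - exact: (indep_hyperplane hK).
  - apply: subset_of => x xX; rewrite !in_setU1.
    case: eqVneq => //= /eqP xf; case: eqVneq => //= /eqP xg.
    case: eqVneq => //= /eqP xe; apply: (fintype.subsetP sAI); rewrite finset.in_setD xX andbT.
    by apply/negP => xK; apply: (vsuppP _ _ xX); exact: hX.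
  - apply: fintype.subset_trans sX1 _; apply: subset_of => x; rewrite !in_setU1.
    by move=> /or3P[->|->|->]; rewrite ?orbT.
have [Z [CZ Zf XZ]] := eliminate_scaled CM CX CX1 m X1f Xf.
have Ze : Z e = X e by have := XZ e; rewrite X1e hopp0 haddx0.
have Ze0 : Z e <> 0 by rewrite Ze.
have hZ x : x \in K -> x <> e -> x <> g -> Z x = 0.
  move=> xK xe xg; have [->//|xf] := pselect (x = f).
  by have := XZ x; rewrite hX// (vsupp_pairP sX1 sI)// hopp0 haddx0.
rewrite -Ze (rY Z e CZ eK eg Ze0 hZ) hoppK.
have hX1 x : x \in K -> x <> f -> x <> g -> X1 x = 0.
  by move=> xK; exact: (vsupp_pairP sX1 sI).
have X1f0 : X1 f <> 0 by rewrite -X1f.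
have := rY X1 f CX1 fK fg X1f0 hX1; rewrite -X1f => ->.
rewrite -hmulNx -hmulDl.
by apply: (@imageP _ _ (hmul^~ (Y g))); exact: XZ.
Qed.

(** If e and h both differ from g, then [X g = 0], and [ratio_three] degenerates to the relation
    between e and h. *)
Lemma ratio_change K g h Y : cocircuit Cs K -> g \in K -> h \in K ->
  ratio_at K g Y -> ratio_at K h Y.
Proof.
move=> cK gK hK rg X e CX eK eh Xe hX.
have Xh := other_circuit_entry cK CX eK Xe hX.
have [hg|hg] := pselect (h = g).
  by rewrite hg in eh hX *; exact: rg.
have [eg|eg] := pselect (e = g).
  rewrite eg in hX *; rewrite [X h * _](rg X h)//; first by rewrite hoppK.
  by move=> x xK xh xg; exact: hX.
have Xg : X g = 0 by apply: hX => // ge; [case: eg|case: hg].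
have := ratio_three cK rg CX eK hK gK eh eg hg Xe Xh.
rewrite Xg hmul0x hadd0x => h3.
rewrite -[LHS]hoppK; congr (- _); apply: h3 => x xK xe xh _; exact: hX.
Qed.

(** The candidate for the dual, given directly by its supports and by the orthogonality that duality
    prescribes; [cocircuitsE] identifies it with the cocircuits. *)
Definition cocircuit_vectors : set {ffun E -> H} := [set Y |
  cocircuit Cs (vsupp Y) /\ forall X, C X ->
    #|vsupp X :&: vsupp Y| <= 3 -> orthogonal X Y].
Notation D := cocircuit_vectors.

(** A circuit never meets K in exactly one point, so up to three common elements there are only the
    empty case, [ratio_at] and [ratio_three]. *)
Lemma cocircuit_vector_exists K : cocircuit Cs K ->
  exists2 Y, D Y & vsupp Y = K.
Proof.
move=> cK; have [[g0 g0K] hK _] := cK.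
have [Y YK rY0] := ratio_vector cK g0K; exists Y => //.
have rY g : g \in K -> ratio_at K g Y by move=> gK; exact: ratio_change rY0.
have Y0 x : x \notin K -> Y x = 0 by rewrite -YK => /vsuppPn.
split; first by rewrite YK.
move=> X CX; rewrite YK => c3; apply/orthogonalE.
have [XK0|/set0Pn[g]] := eqVneq (vsupp X :&: K) finset.set0.
  rewrite (@perp_support _ _ finset.set0); first by rewrite /perp big_set0.
  move=> x _; have [xK|/Y0] := boolP (x \in K); last by right.
  left; apply/vsuppPn/negP => xX.
  by have := finset.in_set0 x; rewrite -XK0 finset.in_setI xX xK.
rewrite finset.in_setI => /andP[/vsuppP Xg gK].
have [f [Xf fK /eqP fg]] := circuit_hits hK CX Xg gK.
have [h2|] := pselect (forall x, x \in K -> x <> f -> x <> g -> X x = 0).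
  apply/(@perp2 _ _ _ _ f g); [exact/eqP| |].
    move=> x xf xg; have [xK|/Y0] := boolP (x \in K); last by right.
    by left; exact: h2.
  by apply: rY => //; exact/eqP.
move=> nh2; have [e [eK ef eg Xe]] : exists e, [/\ e \in K, e <> f, e <> g & X e <> 0].
  apply: contrapT => ne; apply: nh2 => x xK xf xg; apply: contrapT => Xx.
  by apply: ne; exists x.
have h3 x : x \in K -> x <> e -> x <> f -> x <> g -> X x = 0.
  move=> xK /eqP xe /eqP xf /eqP xg; apply: contrapT => Xx; move: c3.
  rewrite leqNgt => /negP; apply.
  have -> : 4 = #|[set x; e; f; g]%SET|.
    rewrite -!finset.setUA !cardsU1 cards1 !inE !negb_or xe xf xg.
    by rewrite (introN eqP ef) (introN eqP eg) fg.
  have mem y : y \in K -> X y <> 0 -> y \in vsupp X :&: K.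
    by move=> yK Xy; rewrite finset.in_setI yK andbT; exact/vsuppP.
  by apply: subset_leq_card; rewrite !finset.subUset !finset.sub1set !mem.
apply/(@perp3 _ _ _ _ e f g) => //; first exact/eqP.
  move=> x xe xf xg; have [xK|/Y0] := boolP (x \in K); last by right.
  by left; exact: h3.
by apply: (ratio_three cK (rY g gK)) => //; exact/eqP.
Qed.
End CocircuitVectors.

Lemma maxset_indep_circuits (E : finType) (C1 C2 : {set E} -> Prop) :
  circuit_system C1 -> circuit_system C2 ->
  (forall B : {set E}, maxset (fun I : {set E} => `[< indep C1 I >]) B =
             maxset (fun I : {set E} => `[< indep C2 I >]) B) ->
  forall X, C1 X -> C2 X.
Proof.
move=> CS1 CS2 CB X CX.
have sub (D1 D2 : {set E} -> Prop) I :
    (forall B : {set E}, maxset (fun I : {set E} => `[< indep D1 I >]) B =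
               maxset (fun I : {set E} => `[< indep D2 I >]) B) ->
    indep D1 I -> indep D2 I.
  move=> DB iI; pose P (J : {set E}) := `[< indep D1 J >].
  have PI : P I by apply/asboolP.
  have [B mB sIB] := maxset_exists PI.
  have := DB B; rewrite -/P mB => /esym/maxset_indepP[iB _] T DT.
  apply/negP => sTI; have := iB T DT; rewrite (fintype.subset_trans sTI)//.
have [T CT sTX] : exists2 T, C2 T & T \subset X.
  apply: contrapT => nT.
  have iX : indep C2 X by move=> T CT; apply/negP => sT; apply: nT; exists T.
  by have := sub C2 C1 X (fun B => esym (CB B)) iX X CX; rewrite fintype.subxx.
have [T' CT' sT'T] : exists2 T', C1 T' & T' \subset T.
  apply: contrapT => nT.
  have iX : indep C1 T by move=> T' CT'; apply/negP => sT; apply: nT; exists T'.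
  by have := sub C1 C2 T CB iX T CT; rewrite fintype.subxx.
have TX : T' = X := cs_incomp CS1 CT' CX (fintype.subset_trans sT'T sTX).
suff -> : X = T by [].
by apply/eqP; rewrite finset.eqEsubset sTX -TX sT'T.
Qed.

(** * The dual is a right matroid *)

Section DualMatroid.
Variables (H : skewHyperfieldType) (E : finType) (C : set {ffun E -> H}).
Hypothesis CM : left_matroid C.
Implicit Types (X Y Z W : {ffun E -> H}) (A I K L T : {set E}) (e f g h : E).
Notation Cs := (circuit_supports C).
Notation D := (cocircuit_vectors C).
Let CS := circuit_system_supports CM.
Let DS := cocircuit_system CS.

Lemma cocircuit_vectors_supports K : circuit_supports D K <-> cocircuit Cs K.
Proof.
split=> [[Y [cY _] <-]//|cK].
by have [Y DY <-] := cocircuit_vector_exists CM cK; exists Y.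
Qed.

Lemma cocircuit_vector_orth2 X Y e g : C X -> D Y -> e <> g ->
  (forall x, x <> e -> x <> g -> X x = 0 \/ Y x = 0) ->
  X e * Y e = - (X g * Y g).
Proof.
move=> CX [_ DY] eg h; apply/(perp2 eg h)/orthogonalE; apply: DY => //.
apply: (@leq_trans #|[set e; g]%SET|); last by rewrite cards2; case: (_ != _).
apply: subset_leq_card; apply: subset_of => x; rewrite finset.in_setI in_set2.
move=> /andP[/vsuppP Xx /vsuppP Yx]; apply: contraT; rewrite negb_or.
by move=> /andP[/eqP xe /eqP xg]; have [] := h x xe xg.
Qed.

Lemma cocircuit_vector_orth3 X Y e f g : C X -> D Y ->
  e <> f -> e <> g -> f <> g ->
  (forall x, x <> e -> x <> f -> x <> g -> X x = 0 \/ Y x = 0) ->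
  (X g * Y g [+] X f * Y f) (- (X e * Y e)).
Proof.
move=> CX [_ DY] ef eg fg h; apply/(perp3 ef eg fg h)/orthogonalE; apply: DY => //.
apply: (@leq_trans #|[set e; f; g]%SET|).
  apply: subset_leq_card; apply: subset_of => x; rewrite finset.in_setI !inE.
  move=> /andP[/eqP Xx /eqP Yx]; apply: contraT; rewrite !negb_or -andbA.
  by move=> /and3P[/eqP xe /eqP xf /eqP xg]; have [] := h x xe xf xg.
rewrite -finset.setUA cardsU1 cards2.
by case: (_ \notin _); case: (_ != _).
Qed.

Lemma cocircuit_pair Y e g : D Y -> Y e <> 0 -> Y g <> 0 -> e <> g ->
  exists X, [/\ C X, X e <> 0, X g <> 0 &
    forall x, x <> e -> x <> g -> X x = 0 \/ Y x = 0].
Proof.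
move=> [cY _] /vsuppP Ye /vsuppP Yg eg.
have [_ [[X CX <-] /vsuppP Xe /vsuppP Xg sX]] := cocircuit_circuit CS cY Ye Yg eg.
exists X; split=> // x xe xg.
have [xY|/vsuppPn] := boolP (x \in vsupp Y); last by right.
by left; exact: (vsupp_pairP sX (fintype.subxx _)).
Qed.

Lemma cocircuit_vectorsZ a Y : a <> 0 -> D Y -> D (rscale a Y).
Proof.
move=> a0 [cY oY]; split; first by rewrite vsupp_rscale.
move=> X CX; rewrite vsupp_rscale// => /(oY X CX)/orthogonalE XY.
apply/orthogonalE; move: XY => /(imageP (hmul^~ a)); rewrite hmul0x hsum_mulr.
rewrite /perp; apply: hsum_sub => f _.
by rewrite image_set1 rscaleE hmulA; exact: subset_refl.
Qed.

Lemma cocircuit_vectors_incomp Y Z : D Y -> D Z -> vsupp Y \subset vsupp Z ->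
  exists2 a, a <> 0 & Z = rscale a Y.
Proof.
move=> DY DZ sYZ; have [[[g /vsuppP Yg] hY _] _] := DY.
have [[_ _ mZ] _] := DZ.
have YZ : vsupp Y = vsupp Z by apply: mZ => //; exists g; apply/vsuppP.
have Z0 x : Y x = 0 -> Z x = 0.
  by move=> /vsuppPn; rewrite YZ => /vsuppPn.
have Zg : Z g <> 0 by apply/vsuppP; rewrite -YZ; exact/vsuppP.
exists (hinv (Y g) * Z g); first by apply: hmul_neq0 => //; exact: hinv_neq0.
apply/ffunP => e; rewrite rscaleE hmulA.
have [->|eg] := pselect (e = g); first by rewrite hmulxV// hmul1x.
have [Ye|Ye] := pselect (Y e = 0); first by rewrite Ye !hmul0x Z0.
have [X [CX Xe Xg hX]] := cocircuit_pair DY Ye Yg eg.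
have hX' x : x <> e -> x <> g -> X x = 0 \/ Z x = 0.
  by move=> xe xg; have [|/Z0] := hX x xe xg; [left|right].
apply: (hmulI Xe); rewrite (cocircuit_vector_orth2 CX DZ eg hX') !hmulA.
by rewrite (cocircuit_vector_orth2 CX DY eg hX) !hmulNx hmulVKr.
Qed.

Lemma cocircuit_modular Y Z K L : modular_pair D Y Z ->
  cocircuit Cs K -> cocircuit Cs L -> K <> L ->
  K :|: L \subset vsupp Y :|: vsupp Z -> vsupp Y :|: vsupp Z \subset K :|: L.
Proof.
move=> [_ m] /cocircuit_vectors_supports[Y' DY' <-].
move=> /cocircuit_vectors_supports[Z' DZ' <-] KL sKL.
by have := m Y' Z' DY' DZ' KL; rewrite properE sKL negbK.
Qed.

(* For g in the union U of the supports, a circuit X meeting U only in g and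
   in points a, b of the two differences compares the values of Y, Y', Z. *)
Lemma cocircuit_vectors_elim Y Y' e : D Y -> D Y' -> modular_pair D Y Y' ->
  Y e = - Y' e -> Y e <> 0 ->
  exists Z, [/\ D Z, Z e = 0 & vadd Y Y' Z].
Proof.
move=> DY DY' m YY' Ye; have [cY _] := DY; have [cY' _] := DY'.
have Y'e : Y' e <> 0 by move=> Y'e; apply: Ye; rewrite YY' Y'e hopp0.
have nYY' : vsupp Y <> vsupp Y' by have [] := m.
have eY := introT (vsuppP _ _) Ye; have eY' := introT (vsuppP _ _) Y'e.
have [L cL sL] := cs_elim DS cY cY' nYY' eY eY'.
have eL : e \notin L.
  by apply/negP => /(fintype.subsetP sL); rewrite finset.in_setD1 eqxx.
have sLU : L \subset vsupp Y :|: vsupp Y'.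
  by apply: fintype.subset_trans sL _; exact: finset.subD1set.
have LY : L <> vsupp Y by move=> LE; rewrite LE eY in eL.
have LY' : L <> vsupp Y' by move=> LE; rewrite LE eY' in eL.
have [a aY' aY] : exists2 a, a \in vsupp Y' & a \notin vsupp Y.
  by apply: not_subset; apply/negP => /(cs_incomp DS cY' cY)/esym.
have [b bY bY'] : exists2 b, b \in vsupp Y & b \notin vsupp Y'.
  by apply: not_subset; apply/negP => /(cs_incomp DS cY cY').
have inL' x : x \in vsupp Y' -> x \notin vsupp Y -> x \in L.
  move=> xY' xY; have : x \in L :|: vsupp Y.
    apply: (fintype.subsetP (cocircuit_modular m cL cY LY _)).
      by rewrite finset.subUset sLU finset.subsetUl.
    by rewrite finset.in_setU xY' orbT.
  by rewrite finset.in_setU (negPf xY) orbF.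
have inL x : x \in vsupp Y -> x \notin vsupp Y' -> x \in L.
  move=> xY xY'; have : x \in L :|: vsupp Y'.
    apply: (fintype.subsetP (cocircuit_modular m cL cY' LY' _)).
      by rewrite finset.subUset sLU finset.subsetUr.
    by rewrite finset.in_setU xY.
  by rewrite finset.in_setU (negPf xY') orbF.
have [Z0 DZ0 Z0L] := cocircuit_vector_exists CM cL.
have Z0b : Z0 b <> 0 by apply/vsuppP; rewrite Z0L; exact: inL.
(* As [Y'] vanishes at b, the sum leaves only the value [Y b] for Z there; this fixes the scalar. *)
pose z := hinv (Z0 b) * Y b.
have z0 : z <> 0.
  by apply: hmul_neq0; [exact: hinv_neq0|exact/vsuppP].
pose Z := rscale z Z0; have DZ : D Z by exact: cocircuit_vectorsZ.
have ZL : vsupp Z = L by rewrite vsupp_rscale.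
have Zb : Z b = Y b by rewrite rscaleE hmulKV.
have ZU x : Y x = 0 -> Y' x = 0 -> Z x = 0.
  move=> Yx Y'x; apply/vsuppPn; rewrite ZL; apply/negP => /(fintype.subsetP sLU).
  by rewrite finset.in_setU => /orP[] /vsuppP.
have Ze : Z e = 0 by apply/vsuppPn; rewrite ZL.
have triangle p q g : Y p = 0 -> Y' p <> 0 -> Y q <> 0 -> Y' q = 0 ->
    Y g <> 0 -> Y' g <> 0 -> exists X, [/\ C X, X g <> 0 &
      forall x, x <> g -> x <> p -> x <> q -> X x = 0 \/ (Y x = 0 /\ Y' x = 0)].
  move=> Yp Y'p Yq Y'q Yg Y'g.
  have [[_ [[X CX <-] gX sX]]|[M [cM gM sM]]] :=
      painting CS g (p |: (q |: ~: (vsupp Y :|: vsupp Y'))).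
    exists X; split=> //; first exact/vsuppP.
    move=> x /eqP/negPf xg /eqP/negPf xp /eqP/negPf xq.
    have [xX|/vsuppPn] := boolP (x \in vsupp X); last by left.
    have := fintype.subsetP sX x xX; rewrite !finset.in_setU1 xg xp xq /=.
    rewrite finset.in_setC finset.in_setU negb_or.
    by move=> /andP[/vsuppPn ? /vsuppPn ?]; right.
  have pg : p <> g by move=> pg; rewrite pg in Yp.
  have qg : q <> g by move=> qg; rewrite qg in Y'q.
  have pM : p \notin M.
    apply/negP => /(fintype.subsetP sM); rewrite !finset.in_setU1 finset.in_setC.
    by rewrite !finset.in_setU1 eqxx orbF => /eqP.
  have qM : q \notin M.
    apply/negP => /(fintype.subsetP sM); rewrite !finset.in_setU1 finset.in_setC.
    by rewrite !finset.in_setU1 eqxx orbT orbF => /eqP.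
  have MY : M <> vsupp Y.
    by move=> ME; move: qM; rewrite ME => /vsuppPn.
  have sMU : M \subset vsupp Y :|: vsupp Y'.
    apply: subset_of => x /(fintype.subsetP sM).
    rewrite !(finset.in_setU1, finset.in_setC) !negb_or negbK.
    move=> /orP[/eqP->|/and3P[//]].
    by rewrite finset.in_setU; apply/orP; left; apply/vsuppP.
  have : p \in M :|: vsupp Y.
    apply: (fintype.subsetP (cocircuit_modular m cM cY MY _)).
      by rewrite finset.subUset sMU finset.subsetUl.
    by rewrite finset.in_setU; apply/orP; right; apply/vsuppP.
  by rewrite finset.in_setU (negPf pM) => /vsuppP.
(* A circuit through e, p, q gives one relation each for Y, [Y'] and Z, which vanish at p, q and e
   respectively; they are linked by [Y e = - Y' e]. *)
have compare p q : Y p = 0 -> Y' p <> 0 -> Y q <> 0 -> Y' q = 0 ->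
    Z p = Y' p <-> Z q = Y q.
  move=> Yp Y'p Yq Y'q; have [X [CX Xe hX]] := triangle p q e Yp Y'p Yq Y'q Ye Y'e.
  have ep : e <> p by move=> ep; apply: Ye; rewrite ep.
  have eq : e <> q by move=> eq; apply: Y'e; rewrite eq.
  have pq : p <> q by move=> pq; apply: Yq; rewrite -pq.
  have XY : X e * Y e = - (X q * Y q).
    apply: cocircuit_vector_orth2 => // x xe xq.
    have [->|xp] := pselect (x = p); first by right.
    by have [|[]] := hX x xe xp xq; [left|right].
  have XY' : X e * Y' e = - (X p * Y' p).
    apply: cocircuit_vector_orth2 => // x xe xp.
    have [->|xq] := pselect (x = q); first by right.
    by have [|[]] := hX x xe xp xq; [left|right].
  have XZ : X p * Z p = - (X q * Z q).
    apply: cocircuit_vector_orth2 => // x xp xq.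
    have [->|xe] := pselect (x = e); first by right.
    by have [|[? ?]] := hX x xe xp xq; [left|right; exact: ZU].
  have XYY' : X p * Y' p = - (X q * Y q).
    by rewrite -XY YY' hmulxN XY' hoppK.
  have Xq : X q <> 0.
    by move=> Xq; apply: (hmul_neq0 Xe Ye); rewrite XY Xq hmul0x hopp0.
  have Xp : X p <> 0.
    by move=> Xp; apply: (hmul_neq0 Xe Y'e); rewrite XY' Xp hmul0x hopp0.
  split=> [ZY'|ZY].
    by apply: (hmulI Xq); apply: hopp_inj; rewrite -XZ -XYY' ZY'.
  by apply: (hmulI Xp); rewrite XZ XYY' ZY.
have Ya := vsuppPn _ _ aY; have Y'a := vsuppP _ _ aY'.
have Yb := vsuppP _ _ bY; have Y'b := vsuppPn _ _ bY'.
have ZY' x : Y x = 0 -> Y' x <> 0 -> Z x = Y' x.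
  by move=> Yx Y'x; apply/(compare x b Yx Y'x Yb Y'b).
have ZY x : Y x <> 0 -> Y' x = 0 -> Z x = Y x.
  by move=> Yx Y'x; apply/(compare a x Ya Y'a Yx Y'x); exact: ZY'.
exists Z; split=> // g.
have [Yg|Yg] := pselect (Y g = 0); have [Y'g|Y'g] := pselect (Y' g = 0).
- by rewrite Yg Y'g haddx0 ZU.
- by rewrite Yg hadd0x ZY'.
- by rewrite Y'g haddx0 ZY.
have [->|ge] := pselect (g = e); first by rewrite Ze YY' haddC; exact: haddxN.
have [X [CX Xg hX]] := triangle a b g Ya Y'a Yb Y'b Yg Y'g.
have ga : g <> a by move=> ga; apply: Yg; rewrite ga.
have gb : g <> b by move=> gb; apply: Y'g; rewrite gb.
have ab : a <> b by move=> ab; apply: Yb; rewrite -ab.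
have XY : X g * Y g = - (X b * Y b).
  apply: cocircuit_vector_orth2 => // x xg xb.
  have [->|xa] := pselect (x = a); first by right.
  by have [|[]] := hX x xg xa xb; [left|right].
have XY' : X g * Y' g = - (X a * Y' a).
  apply: cocircuit_vector_orth2 => // x xg xa.
  have [->|xb] := pselect (x = b); first by right.
  by have [|[]] := hX x xg xa xb; [left|right].
have hZ x : x <> g -> x <> a -> x <> b -> X x = 0 \/ Z x = 0.
  by move=> xg xa xb; have [|[? ?]] := hX x xg xa xb; [left|right; exact: ZU].
have := cocircuit_vector_orth3 CX DZ ga gb ab hZ.
rewrite Zb (ZY' a)// => /haddNN; rewrite -XY -XY' hoppK -hmulDr.
by move=> [z' z'E] /(hmulI Xg) <-.
Qed.

Lemma cocircuit_vectors_matroid : right_matroid D.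
Proof.
split.
- move=> [[[e]]]; rewrite in_vsupp ffunE eqxx //.
- exact: cocircuit_vectorsZ.
- exact: cocircuit_vectors_incomp.
- exact: cocircuit_vectors_elim.
Qed.

Lemma basisE (B : set {ffun E -> H}) (K : {set E}) : basis B K =
  maxset (fun I : {set E} => `[< indep (circuit_supports B) I >]) K.
Proof.
rewrite /basis; congr (maxset _ _); apply/funext => I.
apply: asbool_equiv_eq; split=> h; first by move=> _ [X BX <-]; exact: h.
by move=> X BX; apply: h; exists X.
Qed.

Lemma basis_cocircuit_vectors B : basis D (~: B) = basis C B.
Proof.
rewrite !basisE -(dual_basis CS); congr (maxset _ _); apply/funext => I.
apply: asbool_equiv_eq; split=> h T.
  by move=> /cocircuit_vectors_supports/h.
by move=> /cocircuit_vectors_supports/h.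
Qed.

Lemma cocircuit_vectors_dual : is_dual C D.
Proof.
split; first exact: cocircuit_vectors_matroid.
  exact: basis_cocircuit_vectors.
by move=> X Y CX [_ oY]; exact: oY.
Qed.

(** Any dual has the bases of [D] and hence the same supports, and its vectors satisfy the
    prescribed orthogonality; so all duals lie in [D], which is one of them. *)
Lemma cocircuitsE : cocircuits C = D.
Proof.
apply/seteqP; split=> Y; last first.
  by move=> DY; exists D => //; exact: cocircuit_vectors_dual.
move=> [D' [D'M D'B D'o] D'Y]; split; last by move=> X CX; exact: D'o.
have D'S : circuit_system (circuit_supports D').
  apply: circuit_system_of D'M => [a X|X e y Xe y0]; first exact: vsupp_rscale.
  exists (hinv (X e) * y); last by rewrite rscaleE hmulKV.
  by apply: hmul_neq0 => //; exact: hinv_neq0.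
apply: (maxset_indep_circuits D'S DS _ (ex_intro2 _ _ Y D'Y erefl)) => B.
rewrite -basisE -(finset.setCK B) D'B -basis_cocircuit_vectors basisE.
congr (maxset _ _); apply/funext => I; apply: asbool_equiv_eq.
by split=> h T /cocircuit_vectors_supports/h.
Qed.

End DualMatroid.

(** * Circuits are orthogonal to cocircuits *)

Lemma hmull_comp_rel (H : skewHyperfieldType) (a b c p : H) : comp_rel a b c ->
  comp_rel (p * a) (p * b) (p * c).
Proof.
case=> [e|[hk -> ->]]; last by right; rewrite hmulxN.
by left; rewrite -hmulDr e image_set1.
Qed.

Lemma comp_rel_sum (H : skewHyperfieldType) (I : finType) (S : {set I})
    (t r z : I -> H) : stringent H ->
  (forall i, i \in S -> comp_rel (t i) (r i) (z i)) ->
  (\hsum_(i in S) [set t i]) 0 -> (\hsum_(i in S) [set r i]) 0 ->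
  (\hsum_(i in S) [set z i]) 0.
Proof.
move=> Hstr h; apply: comp_sum => // i iS; rewrite hplus11.
case: (h i iS) => [->|[hk ti ->]]; first by left.
by right; split=> //; exists (t i) => //; split=> //; rewrite ti hoppK.
Qed.

(* Take lam i j of maximal level, then i with the most k such that
   lam i k = lam i j, to exclude lam k i = lam i j. *)
Lemma extremal_pair (H : skewHyperfieldType) (I : finType) (S : {set I})
    (lam : I -> I -> H) : stringent H ->
  (forall i, i \in S -> lam i i = 0) ->
  (forall i j, i \in S -> j \in S -> lam i j = - lam j i) ->
  (forall i j k, i \in S -> j \in S -> k \in S ->
    (lam i k [+] lam k j) (lam i j)) ->
  (exists i j, [/\ i \in S, j \in S & lam i j <> 0]) ->
  exists i j, [/\ i \in S, j \in S, lam i j <> 0 &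
    forall k, k \in S -> comp_rel (lam i k) (lam k j) (lam i j)].
Proof.
move=> Hstr lam0 lamN lamD [i0 [j0 [i0S j0S lam00]]].
pose l (p : I * I) := lam p.1 p.2.
pose A := [set p : I * I | [&& p.1 \in S, p.2 \in S & l p != 0]]%SET.
have [|||[i1 j1]] := @fin_least _ (fun p q => dom (l q) (l p)) A.
- by move=> p q; apply: dom_total.
- by move=> p q r hpq hqr; apply: dom_trans hqr hpq.
- by apply/set0Pn; exists (i0, j0); rewrite inE /= i0S j0S; apply/eqP.
rewrite inE /= => /and3P[i1S j1S /eqP]; rewrite /l /=.
set mu := lam i1 j1 => mu0 maxmu.
pose B := [set p : I * I | [&& p.1 \in S, p.2 \in S & l p == mu]]%SET.
pose c (p : I * I) := #|[set k in S | lam p.1 k == mu]%SET|.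
have [|||[i j]] := @fin_least _ (fun p q => (c q <= c p)%N) B.
- by move=> p q; apply/orP; rewrite orbC; exact: leq_total.
- by move=> p q r hpq hqr; apply: leq_trans hqr hpq.
- by apply/set0Pn; exists (i1, j1); rewrite inE /= i1S j1S eqxx.
rewrite inE /= => /and3P[iS jS /eqP]; rewrite /l /= => lij maxc.
exists i, j; split; rewrite ?lij// => k kS.
have [ac|ac] := pselect (lam i k = - lam k j); last first.
  by left; apply: hadd_single => //; rewrite -lij; exact: lamD.
have muN : hN (lam k j) mu.
  by have := lamD i j k iS jS kS; rewrite ac haddC lij.
have c0 : lam k j <> 0.
  by move=> c0; move: muN; rewrite c0 hN0.
have dmax : dom (lam k j) mu.
  by apply: (maxmu (k, j)); rewrite inE /= kS jS; apply/eqP.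
have hk : ks H.
  by apply: contrapT => nk; apply: (nksN nk mu0); exact: dmax.
have [muc|muc] := ks_eqN Hstr hk (hN_dom Hstr muN) dmax; last first.
  by right; rewrite ac muc.
right; split=> //; rewrite ac -muc; apply: contrapT => muNmu.
have lki : lam k i = mu by rewrite lamN// ac hoppK muc.
have mumu : mu [+] mu = [set mu] by apply: hN_absorb1 => //; exact: ksN.
have : (c (k, j) <= c (i, j))%N by apply: maxc; rewrite inE /= kS jS /l /= muc eqxx.
rewrite leqNgt => /negP; apply; apply: proper_card; apply/properP; split.
  apply: subset_of => x; rewrite !inE => /andP[xS /eqP lix].
  by rewrite xS; have := lamD k x i kS xS iS; rewrite lki lix mumu => ->; rewrite eqxx.
exists i; rewrite !inE iS ?lki ?eqxx//= lam0//.
by apply/eqP => e; apply: mu0.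
Qed.

(** * Induction on the common support *)

Section StrongOrthogonality.
Variables (H : skewHyperfieldType) (Hstr : stringent H) (E : finType).
Variable C : set {ffun E -> H}.
Hypothesis CM : left_matroid C.
Implicit Types (X Y Z W : {ffun E -> H}) (A I K L T : {set E}) (e f g h : E).
Notation Cs := (circuit_supports C).
Notation D := (cocircuit_vectors C).
Let CS := circuit_system_supports CM.
Let DS := cocircuit_system CS.

(* A basis of the hyperplane complementary to Y containing the rest of X, and
   an element b of it such that circuits through b meet X outside. *)
Lemma hyperplane_basis_off_circuit X Y : C X -> D Y ->
    (3 <= #|vsupp X :&: vsupp Y|)%N ->
  exists A b, [/\ indep Cs A, A \subset ~: vsupp Y, spans_hyperplane C (vsupp Y) A,
    b \in A & [/\ X b = 0, forall x, X x <> 0 -> Y x = 0 -> x \in A &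
      exists T, [/\ Cs T, b \in T & forall x, x \in T -> x <> b ->
        x \in A \/ (X x <> 0 /\ Y x <> 0)]]].
Proof.
move=> CX DY c3; set K := vsupp Y; have [cK _] := DY.
have CsX : Cs (vsupp X) by exists X.
have /card_gt0P[s] : (0 < #|vsupp X :&: K|)%N by exact: leq_trans c3.
rewrite finset.in_setI => /andP[sX sK].
have iXs : indep Cs (vsupp X :\ s).
  apply: (circuit_proper_indep CM CX (vsuppP _ _ sX)).
    exact: finset.subD1set.
  by rewrite finset.in_setD1 eqxx.
have [|G [sXG sGF iG spG]] := @indep_extend _ Cs _ (vsupp X :|: ~: K) iXs.
  by apply: fintype.subset_trans (finset.subD1set _ _) _; exact: finset.subsetUl.
have iGK : indep Cs (G :\: K).
  move=> T CT; apply/negP => sT; have := iG T CT.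
  by rewrite (fintype.subset_trans sT)// finset.subsetDl.
have sGK : G :\: K \subset ~: K.
  by apply: subset_of => x; rewrite finset.in_setD finset.in_setC => /andP[].
have [A [sGA sA iA spA]] := hyperplane_basis cK iGK sGK.
have [b bA bG] : exists2 b, b \in A & b \notin G.
  (* Three common elements are needed here: besides s there are i and j, and if A were contained in
     G, a circuit through i and j with all other points in A would lie in the independent set G. *)
  apply: not_subset; apply/negP => sAG.
  have /card_gt1P[i [j [iS jS ij]]] : (1 < #|(vsupp X :&: K) :\ s|)%N.
    by move: c3; rewrite (cardsD1 s) finset.in_setI sX sK.
  move: iS jS; rewrite !(finset.in_setD1, finset.in_setI).
  move=> /and3P[iS iX iK] /and3P[jS jX jK].
  have [X1 [CX1 _ _ sX1]] := fundamental_circuit CM cK sA spA iK jK (elimN eqP ij).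
  have := iG (vsupp X1) (ex_intro2 _ _ X1 CX1 erefl); rewrite (fintype.subset_trans sX1)//.
  rewrite !finset.subUset !finset.sub1set sAG andbT.
  by rewrite !(fintype.subsetP sXG)// finset.in_setD1 ?iS ?jS.
have bK : b \notin K by have := fintype.subsetP sA b bA; rewrite inE.
have bX : b \notin vsupp X.
  apply: contra bG => bX; apply: (fintype.subsetP sXG); rewrite finset.in_setD1 bX andbT.
  by apply: contraNneq bK => ->.
exists A, b; split=> //; split; first exact/vsuppPn.
  move=> x /vsuppP xX /vsuppPn xK; apply: (fintype.subsetP sGA).
  rewrite finset.in_setD xK; apply: (fintype.subsetP sXG).
  by rewrite finset.in_setD1 xX andbT; apply: contraNneq xK => ->.
have [|T [CT bT sT]] := spG b _ bG.
  by rewrite finset.in_setU finset.in_setC bK orbT.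
exists T; split=> // x /(fintype.subsetP sT); rewrite finset.in_setU1.
move=> /orP[/eqP//|xG] xb; have [xK|xK] := boolP (x \in K).
  right; split; last exact/vsuppP.
  by have := fintype.subsetP sGF x xG; rewrite finset.in_setU finset.in_setC xK orbF => /vsuppP.
by left; apply: (fintype.subsetP sGA); rewrite finset.in_setD xK.
Qed.

Lemma cocircuit_through K A b i : cocircuit Cs K -> indep Cs A ->
    A \subset ~: K -> b \in A -> i \in K ->
  exists Y, [/\ D Y, Y b = 1, Y i = 0 & forall x, x \in A -> x <> b -> Y x = 0].
Proof.
move=> cK iA sA bA iK; have [_ hK _] := cK.
have bi : b != i.
  by apply: contraTneq iK => <-; have := fintype.subsetP sA b bA; rewrite inE.
have [[T [CT _ sT]]|[L [cL bL sL]]] := painting CS b (i |: (A :\ b)).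
  have := indep_hyperplane hK iA sA iK CT; rewrite (fintype.subset_trans sT)//.
  by apply: subset_of => x; rewrite finset.setUCA finset.setD1K.
have [Y DY YL] := cocircuit_vector_exists CM cL.
have Yb : Y b <> 0 by apply/vsuppP; rewrite YL.
have Y0 x : x \in i |: (A :\ b) -> Y x = 0.
  move=> xA; apply/vsuppPn; rewrite YL; apply/negP => /(fintype.subsetP sL).
  rewrite finset.in_setU1 finset.in_setC xA orbF => /eqP xb; move: xA.
  by rewrite xb finset.in_setU1 finset.in_setD1 (negPf bi) eqxx.
exists (rscale (hinv (Y b)) Y); split.
- by apply: cocircuit_vectorsZ => //; exact: hinv_neq0.
- by rewrite rscaleE hmulxV.
- by rewrite rscaleE Y0 ?hmul0x// finset.in_setU1 eqxx.
- move=> x xA /eqP xb; rewrite rscaleE Y0 ?hmul0x//.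
  by rewrite finset.in_setU1 finset.in_setD1 xb xA orbT.
Qed.

(** The complement of [i |: A] contains no cocircuit, so [Y1] and [- Y2] span nullity at most 2 in
    the dual and form a modular pair when their supports differ. Eliminating b leaves a cocircuit
    that avoids A, hence a multiple of Y. For equal supports [Y1 = Y2], and z is 0. *)
Lemma cocircuit_difference Y A b i Y1 Y2 : D Y -> indep Cs A ->
    A \subset ~: vsupp Y -> spans_hyperplane C (vsupp Y) A -> b \in A ->
    D Y1 -> D Y2 -> Y1 b = 1 -> Y2 b = 1 -> i \in vsupp Y -> Y1 i = 0 ->
    (forall x, x \in A -> x <> b -> Y1 x = 0) ->
    (forall x, x \in A -> x <> b -> Y2 x = 0) ->
  exists z, forall k, (Y1 k [+] (- Y2 k)) (Y k * z).
Proof.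
move=> DY iA sA spA bA DY1 DY2 Y1b Y2b iK Y1i Y1A Y2A; have [cK _] := DY.
have [Y12|Y12] := pselect (vsupp Y1 = vsupp Y2).
  have [|a a0 eY2] := cocircuit_vectors_incomp CM DY1 DY2; first by rewrite Y12.
  have a1 : a = 1.
    by move: Y2b; rewrite eY2 rscaleE Y1b hmul1x.
  by exists 0 => k; rewrite eY2 a1 rscaleE !hmulx1 hmulx0; exact: haddxN.
have m1 : (- 1 : H) <> 0 by apply: hopp_neq0; exact: hone_neq0.
pose NY2 := rscale (- 1) Y2.
have NY2E k : NY2 k = - Y2 k by rewrite rscaleE hmulxN hmulx1.
have DNY2 : D NY2 by exact: cocircuit_vectorsZ.
have iJ : indep (cocircuit Cs) (~: (i |: A)).
  move=> L cL; apply/negP => sL.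
  have nL x : x \in i |: A -> x \notin L.
    by move=> xA; apply/negP => /(fintype.subsetP sL); rewrite finset.in_setC xA.
  have LK := cocircuit_avoiding_basis cK cL spA
    (fun x xA => nL x (introT setU1P (or_intror xA))).
  by have := nL i; rewrite LK iK finset.in_setU1 eqxx => /(_ isT).
have inJ Y' : (forall x, x \in A -> x <> b -> Y' x = 0) ->
    vsupp Y' \subset b |: (i |: ~: (i |: A)).
  move=> Y'A; apply: subset_of => x /vsuppP Y'x.
  rewrite !(finset.in_setU1, finset.in_setC) negb_or.
  case: eqVneq => //= /eqP xb; case: eqVneq => //= _.
  by apply/negP => xA; apply: Y'x; exact: Y'A.
have m : modular_pair D Y1 NY2.
  split; first by rewrite vsupp_rscale.
  move=> Z1 Z2 [cZ1 _] [cZ2 _] Z12; rewrite vsupp_rscale//.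
  by apply: (nullity2_modular DS iJ DY1.1 DY2.1 cZ1 cZ2 Z12); exact: inJ.
have [||Z [DZ Zb ZE]] := cocircuit_vectors_elim CM DY1 DNY2 m (e := b).
- by rewrite NY2E hoppK Y1b Y2b.
- by rewrite Y1b; exact: hone_neq0.
have ZK : vsupp Z = vsupp Y.
  apply: (cocircuit_avoiding_basis cK DZ.1 spA) => x xA; apply/vsuppPn.
  have [->//|xb] := pselect (x = b).
  by have := ZE x; rewrite NY2E Y1A// Y2A// hopp0 haddx0.
have [|z _ eZ] := cocircuit_vectors_incomp CM DY DZ; first by rewrite ZK.
by exists z => k; rewrite -NY2E -rscaleE -eZ; exact: ZE.
Qed.

(** For each i in S there is a cocircuit [F i] through b that vanishes at i and on A outside b; it
    meets X in fewer points. For an extremal pair i, j, the multiple of Y by [lam i j] is on S a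
    composition of [F i] and [- F j], and [comp_rel_sum] applies. *)
Lemma circuit_perp_cocircuit X Y : C X -> D Y -> perp [set: E]%SET X Y.
Proof.
have [n] := ubnP #|vsupp X :&: vsupp Y|; elim: n X Y => // n IH X Y.
rewrite ltnS => cXY CX DY; have [cK oY] := DY.
have [c3|c3] := leqP #|vsupp X :&: vsupp Y| 3; first exact/orthogonalE/oY.
have [A [b [iA sA spA bA [Xb XA [T [CT bT TA]]]]]] :=
  hyperplane_basis_off_circuit CX DY (ltnW c3).
set S := vsupp X :&: vsupp Y.
have SP i : reflect (X i <> 0 /\ Y i <> 0) (i \in S).
  by rewrite finset.in_setI; apply: (iffP andP) => -[/vsuppP ? /vsuppP].
have /choice[F FP] : forall i, exists Yi, i \in S ->
    [/\ D Yi, Yi b = 1, Yi i = 0 & forall x, x \in A -> x <> b -> Yi x = 0].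
  move=> i.
  have [/SP[_ /vsuppP Yi]|_] := boolP (i \in S); last by exists Y.
  by have [Yi'] := cocircuit_through cK iA sA bA Yi; exists Yi'.
have XF i : i \in S -> perp [set: E]%SET X (F i).
  move=> iS; have [DF Fb Fi FA] := FP i iS.
  apply: IH => //; apply: leq_trans cXY; apply: proper_card; apply/properP.
  split; last first.
    exists i => //; rewrite finset.in_setI negb_and; apply/orP; right.
    exact/vsuppPn.
  apply: subset_of => x; rewrite finset.in_setI => /andP[/vsuppP Xx /vsuppP Fx].
  apply/SP; split=> // Yx; have xA := XA x Xx Yx; apply: Fx; apply: FA => // xb.
  by apply: Xx; rewrite xb.
(* Besides being the entry of [F i] relative to Y, [lam i j] is the scalar z by which Y measures the
   difference of [F i] and [F j]; hence [lam] is antisymmetric and additive like a difference. *)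
pose lam i k := hinv (Y k) * F i k.
have lamE i k : k \in S -> Y k * lam i k = F i k.
  by move=> /SP[_ Yk]; rewrite hmulKV.
have lam0 i : i \in S -> lam i i = 0.
  by move=> iS; have [_ _ Fi _] := FP i iS; rewrite /lam Fi hmulx0.
have lamB i j k : i \in S -> j \in S -> k \in S ->
    (lam i k [+] (- lam j k)) (lam i j).
  move=> iS jS kS; have [DF Fb Fi FA] := FP i iS.
  have [DF' Fb' Fi' FA'] := FP j jS; have /SP[_ /vsuppP Yi] := iS.
  have [z zP] := cocircuit_difference DY iA sA spA bA DF DF' Fb Fb' Yi Fi FA FA'.
  have /SP[_ Yj] := jS; have /SP[_ Yk] := kS.
  have -> : lam i j = z.
    apply: (hmulI Yj); rewrite lamE//.
    by have := zP j; rewrite Fi' hopp0 haddx0 => ->.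
  have := imageP (hmul (hinv (Y k))) (zP k).
  by rewrite hmulDr hmulxN hmulVK.
have lamN i j : i \in S -> j \in S -> lam i j = - lam j i.
  by move=> iS jS; have := lamB i j i iS jS iS; rewrite lam0// hadd0x.
have [||i [j [iS jS lij lc]]] := @extremal_pair H E S lam Hstr lam0 lamN.
- by move=> i j k iS jS kS; rewrite (lamN k j)//; exact: lamB.
- have /card_gt0P[s sS] : (0 < #|S|)%N by exact: leq_trans c3.
  (* Some [lam] is nonzero: the circuit T meets the cocircuit [F s] in b, hence in a second point,
     which can only lie in S. *)
  have [[[_ hF _] _] Fb Fs FA] := FP s sS.
  have Fb' : b \in vsupp (F s) by apply/vsuppP; rewrite Fb; exact: hone_neq0.
  have [x [xT /vsuppP Fx xb]] := hF T b CT bT Fb'.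
  have [xA|xS] := TA x xT xb; first by case: Fx; exact: FA.
  have xS' : x \in S by apply/SP.
  exists s, x; split=> //; apply: hmul_neq0 => //; apply: hinv_neq0.
  by case: xS.
have restrict Z : (forall x, Z x <> 0 -> x \in A -> x = b) ->
    perp [set: E]%SET X Z -> (\hsum_(k in S) [set X k * Z k]) 0.
  move=> ZA; apply: (perp_support _).1 => x xS.
  have [->|Xx] := pselect (X x = 0); first by left.
  right; apply: contrapT => Zx; have [Yx|Yx] := pselect (Y x = 0).
    by case: (Xx); rewrite (ZA x Zx (XA x Xx Yx)).
  by move/SP: xS; apply.
have FS k : k \in S -> (\hsum_(l in S) [set X l * F k l]) 0.
  move=> kS; have [_ _ _ FA] := FP k kS; apply: restrict (XF k kS) => x Fx xA.
  by apply: contrapT => xb; apply: Fx; exact: FA.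
have sum0 : (\hsum_(k in S) [set X k * Y k * lam i j]) 0.
  apply: (@comp_rel_sum _ _ _ (fun k => X k * Y k * lam i k)
                             (fun k => X k * Y k * lam k j)) => //.
  - by move=> k kS; apply: hmull_comp_rel; exact: lc.
  - apply: hsum_sub (FS i iS) => k kS.
    by rewrite -hmulA lamE//; exact: subset_refl.
  - have := imageP (@hopp H) (FS j jS); rewrite hopp0 hsumN.
    apply: hsum_sub => k kS; rewrite image_set1 -hmulA (lamN k j)// hmulxN lamE//.
    by rewrite hmulxN; exact: subset_refl.
apply/(@perp_support _ _ S) => [x xS|].
  have [->|Xx] := pselect (X x = 0); first by left.
  by right; apply: contrapT => Yx; move/SP: xS; apply.
have := imageP (hmul^~ (hinv (lam i j))) sum0; rewrite hmul0x hsum_mulr.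
by apply: hsum_sub => k kS; rewrite image_set1 hmulVKr.
Qed.

Lemma circuit_minty : minty [set: E]%SET C D.
Proof.
split.
- by move=> a X a0; exact: (circuitZ CM).
- by move=> a Y; exact: cocircuit_vectorsZ.
- exact: circuit_perp_cocircuit.
- move=> e R _.
  have [[_ [[X CX <-] /vsuppP Xe sX]]|[K [cK eK sK]]] := painting CS e R.
    left; exists X; split=> // f _ /vsuppP /(fintype.subsetP sX).
    by rewrite finset.in_setU1 => /orP[/eqP|]; [left|right].
  have [Y DY YK] := cocircuit_vector_exists CM cK.
  right; exists Y; split=> //; first by apply/vsuppP; rewrite YK.
  move=> f _ /vsuppP; rewrite YK => /(fintype.subsetP sK).
  by rewrite finset.in_setU1 finset.in_setC => /orP[/eqP|]; [left|right].
Qed.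

End StrongOrthogonality.

(** * The valuation in the Krasner and sign cases *)

Section Level.
Variables (H : skewHyperfieldType) (Hstr : stringent H) (hk : ks H).
Implicit Types x y : H.

(** The sets for x and [- x] are equal, so [xget] selects the same element from both; this gives
    canonical representatives modulo sign without a quotient. *)
Definition sign_rep x : H := xget 0 [set y | y = x \/ y = - x].

Lemma sign_repP x : sign_rep x = x \/ sign_rep x = - x.
Proof. by rewrite /sign_rep; case: xgetP => [_ _ //|/(_ x)[]]; left. Qed.

Lemma sign_repN x : sign_rep (- x) = sign_rep x.
Proof.
rewrite /sign_rep; congr xget; apply/seteqP.
by split=> y /=; rewrite hoppK => -[]; [right|left|right|left].
Qed.

Lemma sign_repK x : sign_rep (sign_rep x) = sign_rep x.
Proof. by have [e|e] := sign_repP x; rewrite e ?sign_repN e. Qed.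

Lemma sign_rep_eq x y : sign_rep x = sign_rep y -> x = y \/ x = - y.
Proof.
have [->|->] := sign_repP x; have [->|->] := sign_repP y; [by left|by right| |].
  by move=> <-; right; rewrite hoppK.
by move=> /hopp_inj; left.
Qed.

Lemma sign_rep_mul x y : sign_rep (sign_rep x * sign_rep y) = sign_rep (x * y).
Proof.
by have [->|->] := sign_repP x; have [->|->] := sign_repP y;
  rewrite ?(hmulNx, hmulxN, sign_repN).
Qed.

Lemma sign_rep_neq0 x : x <> 0 -> sign_rep x <> 0.
Proof. by have [->|->] := sign_repP x => // x0; exact: hopp_neq0. Qed.

(* The group of nonzero elements modulo sign, ordered by dom. *)
Definition level of stringent H & ks H : Type :=
  {x : H | (x != 0) && (sign_rep x == x)}.
Notation G := (level Hstr hk).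

HB.instance Definition _ := Choice.copy G {x : H | (x != 0) && (sign_rep x == x)}.

Lemma level_subproof x : let y := sign_rep (if x == 0 then 1 else x) in
  ((y != 0) && (sign_rep y == y) : Prop).
Proof.
rewrite /= sign_repK eqxx andbT; apply/eqP; apply: sign_rep_neq0.
by case: eqP => // _; exact: hone_neq0.
Qed.

Definition level_of x : G :=
  exist (fun y => (y != 0) && (sign_rep y == y)) _ (level_subproof x).

Definition level_val (g : G) : H := sval g.

Lemma level_val_neq0 g : level_val g <> 0.
Proof. by case: g => x /= /andP[/eqP]. Qed.

Lemma level_valK g : sign_rep (level_val g) = level_val g.
Proof. by case: g => x /= /andP[_ /eqP]. Qed.

Lemma level_val_inj : injective level_val.
Proof. exact: val_inj. Qed.

Lemma level_ofE x : x <> 0 -> level_val (level_of x) = sign_rep x.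
Proof. by move=> /eqP/negPf x0; rewrite /level_val /= x0. Qed.

Definition level_mul (a b : G) : G := level_of (level_val a * level_val b).

Lemma level_mulE a b :
  level_val (level_mul a b) = sign_rep (level_val a * level_val b).
Proof. by rewrite level_ofE//; apply: hmul_neq0; exact: level_val_neq0. Qed.

Definition level_inv (a : G) : G := level_of (hinv (level_val a)).

Lemma level_invE a : level_val (level_inv a) = sign_rep (hinv (level_val a)).
Proof. by rewrite level_ofE//; apply: hinv_neq0; exact: level_val_neq0. Qed.

Lemma level_oneE : level_val (level_of 1) = sign_rep 1.
Proof. by rewrite level_ofE//; exact: hone_neq0. Qed.

Lemma level_mulA : associative level_mul.
Proof.
move=> a b c; apply: level_val_inj; rewrite !level_mulE.
rewrite -{1}(level_valK a) -{2}(level_valK c) !sign_rep_mul.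
by rewrite hmulA.
Qed.

Lemma level_mul1 : left_id (level_of 1) level_mul.
Proof.
move=> a; apply: level_val_inj; rewrite level_mulE level_oneE.
by rewrite -{1}level_valK sign_rep_mul hmul1x level_valK.
Qed.

Lemma level_mulr1 : right_id (level_of 1) level_mul.
Proof.
move=> a; apply: level_val_inj; rewrite level_mulE level_oneE.
by rewrite -{1}level_valK sign_rep_mul hmulx1 level_valK.
Qed.

Lemma level_mulV : left_inverse (level_of 1) level_inv level_mul.
Proof.
move=> a; apply: level_val_inj; rewrite level_mulE level_invE level_oneE.
rewrite -{2}level_valK sign_rep_mul hmulVx//; exact: level_val_neq0.
Qed.

Lemma level_mulVr : right_inverse (level_of 1) level_inv level_mul.
Proof.
move=> a; apply: level_val_inj; rewrite level_mulE level_invE level_oneE.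
rewrite -{1}level_valK sign_rep_mul hmulxV//; exact: level_val_neq0.
Qed.

HB.instance Definition _ := isGroup.Build G
  level_mulA level_mul1 level_mulr1 level_mulV level_mulVr.

Definition level_le (a b : G) : bool := `[< dom (level_val a) (level_val b) >].

Lemma level_le_refl : reflexive level_le.
Proof. by move=> a; apply/asboolP. Qed.

Lemma level_le_anti : antisymmetric level_le.
Proof.
move=> a b /andP[/asboolP ab /asboolP ba]; apply: level_val_inj.
rewrite -level_valK -[RHS]level_valK.
by have [->|->] := ks_eqN Hstr hk ab ba; rewrite ?sign_repN.
Qed.

Lemma level_le_trans : transitive level_le.
Proof.
move=> b a c /asboolP ab /asboolP bc; apply/asboolP; exact: dom_trans ab bc.
Qed.

HB.instance Definition _ := Order.Le_isPOrder.Build (Order.Disp tt tt) G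
  level_le_refl level_le_anti level_le_trans.

Lemma level_le_total : total (<=%O : rel G).
Proof.
move=> a b; have [h|h] := dom_total Hstr (level_val a) (level_val b); apply/orP;
  [left|right]; exact/asboolP.
Qed.

HB.instance Definition _ := Order.POrder_isTotal.Build (Order.Disp tt tt) G
  level_le_total.

Lemma dom_sign_rep x y : dom (sign_rep x) (sign_rep y) <-> dom x y.
Proof.
by have [->|->] := sign_repP x; have [->|->] := sign_repP y;
  rewrite /dom ?hN_opp.
Qed.

Lemma level_ltE (a b : G) :
  (a < b)%O <-> a <> b /\ dom (level_val a) (level_val b).
Proof.
rewrite Order.POrderTheory.lt_neqAle; split.
  by move=> /andP[/eqP ab /asboolP].
by move=> [ab h]; apply/andP; split; [exact/eqP|exact/asboolP].
Qed.

Lemma level_mul2l (c a b : G) : (a < b)%O -> (c * a < c * b)%g%O.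
Proof.
move=> /level_ltE[ab h]; apply/level_ltE; split.
  by move=> /(congr1 (fun g : G => c^-1 * g)%g); rewrite !monoid.mulgA monoid.mulVg !monoid.mul1g.
by rewrite !level_mulE; apply/dom_sign_rep; exact: dom_mull.
Qed.

Lemma level_mul2r (c a b : G) : (a < b)%O -> (a * c < b * c)%g%O.
Proof.
move=> /level_ltE[ab h]; apply/level_ltE; split.
  by move=> /(congr1 (fun g : G => g * c^-1)%g); rewrite -!monoid.mulgA monoid.mulgV !monoid.mulg1.
by rewrite !level_mulE; apply/dom_sign_rep; exact: dom_mulr.
Qed.

HB.instance Definition _ := Group_isOrdered.Build (Order.Disp tt tt) G
  level_mul2l level_mul2r.

Lemma level_of_eq x y : x <> 0 -> y <> 0 -> level_of x = level_of y ->
  x = y \/ x = - y.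
Proof.
move=> x0 y0 /(congr1 level_val); rewrite !level_ofE//; exact: sign_rep_eq.
Qed.

Lemma hvaluation_level : hvaluation (level_of : H -> G).
Proof.
split.
- move=> x y x0 y0; apply: level_val_inj.
  by rewrite level_mulE !level_ofE// ?sign_rep_mul//; exact: hmul_neq0.
- move=> g; exists (level_val g); first exact: level_val_neq0.
  apply: level_val_inj; rewrite level_ofE ?level_valK//; exact: level_val_neq0.
- move=> x y x0 y0 /level_ltE[yx]; rewrite !level_ofE// => /dom_sign_rep h.
  apply: hN_absorb1 => //; first exact: h (ksN y hk).
  move=> yNx; apply: yx; apply: level_val_inj.
  by rewrite !level_ofE// yNx sign_repN.
Qed.

Lemma residue_level : residue (level_of : H -> G) = [set 0; 1; - 1].
Proof.
have n10 := @hone_neq0 H.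
apply/seteqP; split=> x.
- move=> [->|x1]; first by left; left.
  have [->|x0] := pselect (x = 0); first by left; left.
  have [->|->] := level_of_eq x0 n10 x1; first by left; right.
  by right.
- move=> [[->|->]|->]; [by left|by right|right].
  by apply: level_val_inj; rewrite !level_ofE ?sign_repN//; exact: hopp_neq0.
Qed.

Lemma ks_residue : krasner_or_sign_residue H.
Proof.
exists (Order.Disp tt tt), G, level_of; split; first exact: hvaluation_level.
have N1 : hN (1 : H) (- 1) by exact: hN_sym.
have [e1|n1] := pselect ((1 : H) = - 1).
  left; rewrite /residue_krasner /radd residue_level -e1.
  have -> : [set 0; 1; 1] = [set 0; 1] :> set H by rewrite -setUA setUid.
  split=> //; apply/seteqP; split=> x; first by case.
  move=> x01; split=> //; rewrite {2}e1.
  by case: x01 => ->; [exact: hN_has0|].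
right; rewrite /residue_sign /radd residue_level; split=> //.
  rewrite hN_absorb1//; apply/seteqP; split=> x; first by case.
  by move=> ->; split=> //; left; right.
apply/seteqP; split=> x; first by case.
move=> x01; split=> //; case: x01 => [[->|->]|->] //; exact: hN_has0.
Qed.

End Level.

(** It replaces the test of [hcomp], which ranges over all valuations, by a condition inside H. In
    both addition tables 1 lies in [1 [+] 1], which is [ks] by [hNP]. *)
Lemma krasner_or_signP (H : skewHyperfieldType) : stringent H ->
  krasner_or_sign_residue H <-> ks H.
Proof.
move=> Hstr; split; last exact: ks_residue.
move=> [d [G [psi [_ h]]]]; apply/hNP.
suff [] : radd psi (1 : H) 1 1 by [].
by case: h => [[_ ->]|[_ _ -> _]] //; right.
Qed.

(** * Vector axioms *)

Section Hcomp.
Variables (H : skewHyperfieldType) (Hstr : stringent H).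
Implicit Types a b c : H.

Lemma hcomp_eq a b c : comp_rel a b c -> hcomp a b = c.
Proof.
move=> h; rewrite /hcomp; case: asboolP => [[c' e]|ne].
  have ce d : a [+] b = [set d] -> c = d.
    move=> abd; suff : [set d] c by [].
    rewrite -abd; case: h => [->//|[hk ab ->]].
    by rewrite ab -[X in _ [+] X]hoppK; exact: ksN.
  by rewrite (ce c' e); apply: xget_unique => // d /ce; rewrite (ce c' e).
case: h => [h|[/(krasner_or_signP Hstr) hk _ ->]].
  by case: ne; exists c.
by case: asboolP.
Qed.

(** The hypothesis is the support condition of (V2)' in one coordinate. *)
Lemma hcompP a b : (hcomp a b = 0 -> a = 0 /\ b = 0) ->
  comp_rel a b (hcomp a b).
Proof.
rewrite /hcomp; case: asboolP => [[c e] _|ne].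
  have -> : xget 0 [set c | a [+] b = [set c]] = c; last by left.
  apply: xget_unique => // c'; rewrite /= e => cc'.
  by have : [set c'] c by rewrite -cc'.
have ab : a = - b by apply: contrapT => /Hstr.
case: asboolP => [/(krasner_or_signP Hstr)|_ /(_ erefl)[a0 b0]].
  by right.
by case: ne; exists 0; rewrite a0 b0 haddx0.
Qed.

End Hcomp.

(** * The matroid of minimal nonzero elements *)

Section VectorAxioms.
Variables (H : skewHyperfieldType) (E : finType) (VV : set {ffun E -> H}).
Hypothesis (VZ : scaled (@lscale H E) VV) (Vel : eliminates [set: E]%SET VV).
Implicit Types (V W X Y Z : {ffun E -> H}).
Notation C := (Min (VV `\ vzero H E)).

Lemma vzeroP V : V <> vzero H E <-> exists e, V e <> 0.
Proof.
split=> [V0|[e Ve] V0]; last by apply: Ve; rewrite V0 ffunE.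
apply: contrapT => nV; apply: V0; apply/ffunP => e; rewrite ffunE.
by apply: contrapT => Ve; apply: nV; exists e.
Qed.

Lemma eliminate_at V W h : VV V -> VV W -> V h <> 0 -> W h <> 0 ->
  exists a Z, [/\ VV Z, forall f, (V f [+] (- (a * W f))) (Z f) & Z h = 0].
Proof.
move=> VVV VVW Vh Wh.
pose a := V h * hinv (W h).
have a0 : - a <> 0.
  by apply: hopp_neq0; apply: hmul_neq0 => //; exact: hinv_neq0.
have VWh : V h = - lscale (- a) W h by rewrite lscaleE hmulNx hoppK hmulKVr.
have [Z [VZ' ZE Zh]] := Vel VVV (VZ a0 VVW) (finset.in_setT h) VWh Vh.
exists a, Z; split=> // f; have := ZE f (finset.in_setT f).
by rewrite lscaleE hmulNx.
Qed.

Lemma min_vector_multiple V X : VV V -> V <> vzero H E -> C X ->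
  vsupp V \subset vsupp X -> exists2 a, a <> 0 & V = lscale a X.
Proof.
move=> VVV V0 [[VX X0] mX] sVX; have /vzeroP[e Ve] := V0.
have Xe : X e <> 0 by apply/vsuppP; apply: (fintype.subsetP sVX); apply/vsuppP.
have [a [W [VW WE We]]] := eliminate_at VVV VX Ve Xe.
have W0 : W = vzero H E.
  apply: contrapT => nW; have /negP := mX W (conj VW nW); apply.
  apply/properP; split.
    apply: subset_of => f; apply: contraTT => /vsuppPn Xf; apply/vsuppPn.
    have Vf : V f = 0.
      apply/vsuppPn; apply/negP => /(fintype.subsetP sVX) /vsuppP; exact.
    by have := WE f; rewrite Vf Xf hmulx0 hopp0 haddx0.
  by exists e; [exact/vsuppP|apply/vsuppPn].
have VaX f : V f = a * X f.
  by have := WE f; rewrite W0 ffunE => /hadd_eq0; rewrite hoppK.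
exists a; last by apply/ffunP => f; rewrite lscaleE.
by move=> a0; apply: Ve; rewrite VaX a0 hmul0x.
Qed.

(** If V is not minimal, some nonzero Y has smaller support. Either Y is nonzero at e, or
    eliminating another point h of Y from V keeps the entry at e and shrinks the support. *)
Lemma min_vector_below V e : VV V -> V e <> 0 ->
  exists X, [/\ C X, X e <> 0 & vsupp X \subset vsupp V].
Proof.
have [n] := ubnP #|vsupp V|; elim: n V => // n IH V; rewrite ltnS => cV VVV Ve.
have [CV|nCV] := pselect (C V); first by exists V.
have V0 : V <> vzero H E by apply/vzeroP; exists e.
have [Y [VY Y0 sYV]] : exists Y, [/\ VV Y, Y <> vzero H E & vsupp Y \proper vsupp V].
  apply: contrapT => nY; apply: nCV; split=> // Y [VY Y0].
  by apply/negP => s; apply: nY; exists Y.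
have below W : VV W -> W e <> 0 -> vsupp W \proper vsupp V ->
    exists X, [/\ C X, X e <> 0 & vsupp X \subset vsupp V].
  move=> VW We sW; have [|X [CX Xe sX]] := IH W _ VW We.
    exact: leq_trans (proper_card sW) cV.
  by exists X; split=> //; exact: fintype.subset_trans sX (proper_sub sW).
have [Ye|Ye] := pselect (Y e = 0); last exact: below sYV.
have /vzeroP[h Yh] := Y0.
have Vh : V h <> 0.
  by apply/vsuppP; apply: (fintype.subsetP (proper_sub sYV)); apply/vsuppP.
have [a [W [VW WE Wh]]] := eliminate_at VVV VY Vh Yh.
apply: (below W VW).
  by have := WE e; rewrite Ye hmulx0 hopp0 haddx0 => ->.
apply/properP; split; last by exists h; [exact/vsuppP|apply/vsuppPn].
apply: subset_of => f; apply: contraTT => /vsuppPn Vf; apply/vsuppPn.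
have Yf : Y f = 0.
  apply: contrapT => /vsuppP /(fintype.subsetP (proper_sub sYV)) /vsuppP; exact.
by have := WE f; rewrite Vf Yf hmulx0 hopp0 haddx0.
Qed.

Lemma min_vectors_scaled : scaled (@lscale H E) C.
Proof.
move=> a X a0 [[VX X0] mX]; split; last by rewrite vsupp_lscale.
split; first exact: VZ.
have /vzeroP[e Xe] := X0; apply/vzeroP; exists e; rewrite lscaleE.
exact: hmul_neq0.
Qed.

Lemma min_vectors_incomp X Y : C X -> C Y -> vsupp X \subset vsupp Y ->
  exists2 a, a <> 0 & Y = lscale a X.
Proof.
move=> [[VX X0] _] CY sXY.
have [a a0 ->] := min_vector_multiple VX X0 CY sXY.
exists (hinv a); first exact: hinv_neq0.
by apply/ffunP => e; rewrite !lscaleE hmulVK.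
Qed.

Lemma min_vectors_matroid : left_matroid C.
Proof.
split.
- by move=> [[_ []]].
- exact: min_vectors_scaled.
- exact: min_vectors_incomp.
- move=> X Y e CX CY [XY mXY] XYe Xe.
  have [[VX X0] _] := CX; have [[VY Y0] _] := CY.
  have [Z [VZ' ZE Ze]] := Vel VX VY (finset.in_setT e) XYe Xe.
  have XYZ : vadd X Y Z by move=> f; exact: ZE.
  exists Z; split=> //.
  have [f fX fY] : exists2 f, f \in vsupp X & f \notin vsupp Y.
    apply: not_subset; apply/negP => /(min_vectors_incomp CX CY)[a a0 eY].
    by apply: XY; rewrite eY vsupp_lscale.
  split.
    split=> //; apply/vzeroP; exists f; have := XYZ f.
    rewrite (vsuppPn _ _ fY) haddx0 => ->; exact/vsuppP.
  (* Minimality of Z comes from modularity: a smaller W would yield two minimal vectors inside the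
     support of Z, one missing g and one containing it. Their union misses e and would be smaller
     than that of X and Y. *)
  move=> W [VW W0]; apply/negP => /properP[sWZ [g gZ gW]].
  have /vzeroP[h0 Wh0] := W0.
  have [X1 [CX1 X1h sX1]] := min_vector_below VW Wh0.
  have X1g : X1 g = 0.
    by apply/vsuppPn; apply: contra gW; exact: fintype.subsetP.
  have Zh : Z h0 <> 0.
    by apply/vsuppP; apply: (fintype.subsetP sWZ); apply/vsuppP.
  have [a [W' [VW' W'E W'h]]] := eliminate_at VZ' CX1.1.1 Zh X1h.
  have W'g : W' g <> 0.
    have := W'E g; rewrite X1g hmulx0 hopp0 haddx0 => ->; exact/vsuppP.
  have [X2 [CX2 X2g sX2]] := min_vector_below VW' W'g.
  have sX1Z := fintype.subset_trans sX1 sWZ.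
  have sX2Z : vsupp X2 \subset vsupp Z.
    apply: fintype.subset_trans sX2 _; apply: subset_of => x.
    apply: contraTT => /vsuppPn Zx; apply/vsuppPn.
    have X1x : X1 x = 0.
      by apply: contrapT => /vsuppP /(fintype.subsetP sX1Z) /vsuppP; exact.
    by have := W'E x; rewrite Zx X1x hmulx0 hopp0 haddx0.
  have X12 : vsupp X1 <> vsupp X2.
    by move=> s; have /vsuppP := X2g; rewrite -s => /vsuppP.
  have /negP := mXY X1 X2 CX1 CX2 X12; apply.
  apply/properP; split.
    apply: fintype.subset_trans (vsupp_vadd XYZ).
    by rewrite finset.subUset sX1Z.
  exists e; first by rewrite finset.in_setU; apply/orP; left; apply/vsuppP.
  rewrite finset.in_setU negb_or.
  by apply/andP; split; apply/negP => /(fintype.subsetP _);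
    [move=> /(_ _ sX1Z)|move=> /(_ _ sX2Z)] => /vsuppP.
Qed.

Lemma min_vectors_supports : supports_in [set: E]%SET VV C.
Proof.
move=> V e VVV _ Ve; have [X [CX Xe sX]] := min_vector_below VVV Ve.
exists X; split=> // f _ Vf; apply: contrapT => /vsuppP /(fintype.subsetP sX).
by move=> /vsuppP.
Qed.

End VectorAxioms.

(** * The vectors of a matroid satisfy the axioms *)

Section Vectors.
Variables (H : skewHyperfieldType) (Hstr : stringent H) (E : finType).
Variable C : set {ffun E -> H}.
Hypothesis CM : left_matroid C.
Implicit Types (V W X Y Z : {ffun E -> H}).

Lemma vectorsE : vectors C = perpl [set: E]%SET (cocircuit_vectors C).
Proof.
apply/seteqP; rewrite /vectors cocircuitsE//.
by split=> V VC Y DY; apply/orthogonalE; exact: VC.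
Qed.

Lemma vectors_scaled : scaled (@lscale H E) (vectors C).
Proof. by rewrite vectorsE; exact: scaled_perpl. Qed.

Lemma vectors_eliminates : eliminates [set: E]%SET (vectors C).
Proof. rewrite vectorsE; exact: minty_eliminates Hstr (circuit_minty Hstr CM). Qed.

Lemma vectors_support : supports_in [set: E]%SET (vectors C) C.
Proof. rewrite vectorsE; exact: minty_supports (circuit_minty Hstr CM). Qed.

Lemma circuits_vectors : C `<=` vectors C.
Proof.
rewrite vectorsE => X CX Y DY; exact: (circuit_perp_cocircuit Hstr CM CX DY).
Qed.

Lemma vectors0 : vectors C (vzero H E).
Proof.
rewrite vectorsE => Y _; rewrite /perp.
apply: (@hsum_sub _ _ _ (fun=> [set 0])); last by rewrite hsum_zeros.
by move=> f _; rewrite ffunE hmul0x.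
Qed.

Lemma vectors_comp X Y : vectors C X -> vectors C Y ->
  vsupp (vcomp X Y) = (vsupp X :|: vsupp Y)%SET -> vectors C (vcomp X Y).
Proof.
rewrite vectorsE => VX VY sXY Z DZ.
apply: (comp_rel_sum Hstr _ (VX Z DZ) (VY Z DZ)) => f _.
apply: hmul_comp_rel; rewrite ffunE; apply: hcompP => // hXY.
have : f \notin vsupp (vcomp X Y) by apply/vsuppPn; rewrite ffunE.
by rewrite sXY finset.in_setU negb_or => /andP[/vsuppPn ? /vsuppPn ?].
Qed.

(** By painting, the support of a nonzero vector contains that of a circuit; and as [vectors C]
    admits elimination, a minimal vector is a multiple of the circuit below it. *)
Lemma circuits_min : C = Min (vectors C `\ vzero H E).
Proof.
have circuit_neq0 X : C X -> X <> vzero H E.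
  by move=> CX X0; apply: (circuit0 CM); rewrite -X0.
have below V : vectors C V -> V <> vzero H E -> exists2 X, C X & vsupp X \subset vsupp V.
  move=> VV /vzeroP[e Ve]; have [X [CX _ XV]] := vectors_support VV (finset.in_setT e) Ve.
  exists X => //; apply: subset_of => f; apply: contraTT => /vsuppPn Vf.
  by apply/vsuppPn/XV => //; exact: finset.in_setT.
apply/seteqP; split=> X.
  move=> CX; split.
    by split; [exact: circuits_vectors|exact: circuit_neq0].
  move=> Y [VY Y0]; apply/negP => sYX; have [Z CZ sZY] := below Y VY Y0.
  have sZX := fintype.subset_trans sZY (proper_sub sYX).
  have [a a0 eX] := circuit_incomp CM CZ CX sZX.
  have := proper_card sYX; rewrite ltnNge => /negP; apply.
  by apply: subset_leq_card; rewrite eX vsupp_lscale.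
move=> mX; have [[VX X0] mX'] := mX; have [Z CZ sZX] := below X VX X0.
have [a a0 eZ] := min_vector_multiple vectors_scaled vectors_eliminates
  (circuits_vectors CZ) (circuit_neq0 Z CZ) mX sZX.
have -> : X = lscale (hinv a) Z.
  by apply/ffunP => e; rewrite eZ !lscaleE hmulVK.
by apply: (circuitZ CM) => //; exact: hinv_neq0.
Qed.

End Vectors.

Theorem theorem44 (H : skewHyperfieldType) (Hstr : stringent H) (E : finType)
    (V : set {ffun E -> H}) :
  ((exists2 C : set {ffun E -> H}, left_matroid C & V = vectors C) <->
   [/\ V (vzero H E),
       forall (a : H) X, V X -> V (lscale a X),
       forall X Y, V X -> V Y ->
         vsupp (vcomp X Y) = (vsupp X :|: vsupp Y)%SET ->
         V (vcomp X Y) &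
       forall X Y (e : E), V X -> V Y -> X e = - Y e -> X e <> 0 ->
         exists Z, [/\ V Z, forall f, (X f [+] Y f) (Z f) & Z e = 0]])
  /\
  (forall C : set {ffun E -> H}, left_matroid C -> V = vectors C ->
     C = Min (V `\ vzero H E)).
Proof.
split; last by move=> C CM ->; exact: circuits_min.
split=> [[C CM ->]|[V0 VZ VC VE]].
  split.
  - exact: vectors0.
  - move=> a X VX; have [->|a0] := pselect (a = 0); last exact: vectors_scaled.
    suff -> : lscale 0 X = vzero H E by exact: vectors0.
    by apply/ffunP => e; rewrite lscaleE hmul0x ffunE.
  - exact: vectors_comp.
  - move=> X Y e VX VY XYe Xe.
    have [Z [VZ ZE Ze]] := vectors_eliminates Hstr CM VX VY (finset.in_setT e) XYe Xe.
    by exists Z; split=> // f; exact: ZE (finset.in_setT f).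
have VZ' : scaled (@lscale H E) V by move=> a X _; exact: VZ.
have Vel : eliminates [set: E]%SET V.
  move=> X Y e VX VY _ XYe Xe; have [Z [VZ'' ZE Ze]] := VE X Y e VX VY XYe Xe.
  by exists Z.
set C := Min (V `\ vzero H E).
have CM : left_matroid C by exact: min_vectors_matroid.
have CV : C `<=` V by move=> X [[]].
exists C => //; apply/seteqP; split=> [W VW|W].
  rewrite vectorsE// => Y DY.
  (* The boxes are the single entries of the cocircuit Y, so orthogonality to Y extends from the
     minimal elements to all of V. *)
  have := @box_sum_extends H Hstr E [set: E]%SET V VZ' Vel C (fun f => [set Y f])
    (circuitZ CM) CV (min_vectors_supports VZ' Vel).
  move=> /(_ (fun f _ => box1 (Y f))) h; rewrite /perp.
  have -> : \hsum_(f in [set: E]%SET) [set W f * Y f] =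
            \hsum_(f in [set: E]%SET) (hmul (W f) @` [set Y f]).
    by apply: eq_bigr => f _; rewrite image_set1.
  apply: h VW => X CX; have := circuit_perp_cocircuit Hstr CM CX DY.
  by apply: hsum_sub => f _; rewrite image_set1; exact: subset_refl.
(* For the other inclusion, W is a composition of a circuit and a vector of smaller support, and
   (V2)' recomposes them inside V. *)
have [n] := ubnP #|suppS [set: E]%SET W|; elim: n W => // n IH W.
rewrite ltnS => cW VW.
have [W0|/vzeroP[e We]] := pselect (W = vzero H E); first by rewrite W0.
have [X [W' [CX VW' sW' XW]]] := decomposition Hstr (vectors_scaled CM)
  (circuitZ CM) (circuits_vectors Hstr CM) (vectors_eliminates Hstr CM)
  (vectors_support Hstr CM) VW (finset.in_setT e) We.
have WE : vcomp X W' = W.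
  apply/ffunP => f; rewrite ffunE; apply: hcomp_eq => //.
  by have [] := XW f (finset.in_setT f).
have VW'' : V W' by apply: IH => //; exact: leq_trans (proper_card sW') cW.
rewrite -WE; apply: VC => //; first exact: CV.
(* The support condition of (V2)' holds because the decomposition creates no entry outside the
   support of W, and the composition of two zeros is zero. *)
rewrite WE; apply/finset.setP => f; rewrite finset.in_setU.
have [c XW0 _ _] := XW f (finset.in_setT f).
apply/idP/orP => [/vsuppP Wf|].
  have [Xf|/vsuppP] := pselect (X f = 0); last by left.
  right; apply/vsuppP => W'f; apply: Wf; move: c; rewrite Xf W'f.
  by case=> [|[]//]; rewrite haddx0 => /seteqP[/(_ 0 erefl)].
case=> [/vsuppP Xf|W'f]; first by apply/vsuppP => /XW0.
have := fintype.subsetP (proper_sub sW') f; rewrite !in_suppS !finset.in_setT /=.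
by rewrite in_vsupp in W'f; rewrite in_vsupp; exact.
Qed.
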